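(* Consider a sequence of experiments as described in the context (independent groups $i=1,\dots,m$, the $i$-th consisting of $n_i$ i.i.d. observations with mean $\mu_i$ and variance $\sigma_i^2$; $n=\max_i n_i$, $m=m_n$, $m,n\to\infty$). Assume the following, where all constants are fixed along the sequence. (1) There exist $0<c_L\le 1\le c_U$ such that $c_L\le \sigma_i^2/\sigma_j^2\le c_U$ and $c_L\le n_i/n_j\le c_U$ for all $1\le i\ne j\le m$. (2) For some constants $r,C,\nu,K>0$, $m\le C n^r$ and $\max_{1\le i\le m}\mathbb{E}\left|(X_{1i}-\mu_i)/\sigma_i\right|^{2+4r+\nu}\le K$. (3) For all $i<j$, the reference null distribution functions $F_{ij}$ (possibly depending on $m,n_1,\dots,n_m$) are monotone increasing distribution functions with $F_{ij}(t)=1-F_{ij}(-t)$ for $t\ge 0$, and for some $c>0$, $$\max_{1\le i<j\le m}\ \sup_{0\le t\le 2\sqrt{\log m}}\left|\frac{1-F_{ij}(t)}{\bar\Phi(t)}-1\right|=O(n^{-c})\quad\text{as } m,n\to\infty.$$ Then, as $m,n\to\infty$, $$\sup_{0\le t\le\sqrt{2\log m}}\left|\frac{\sum_{(i,j)\in\mathcal{H}_+\cup\mathcal{H}_0}\mathbf{1}_{(\bar\Phi^{-1}(\bar p_{ij,L})\ge t)}+\sum_{(i,j)\in\mathcal{H}_-\cup\mathcal{H}_0}\mathbf{1}_{(\bar\Phi^{-1}(\bar p_{ij,U})\ge t)}}{\bar\Phi(t)(q+q_0)}-1\right|\longrightarrow 0\quad\text{in probability.}$$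
   Context: Setting. For each experiment in a sequence there are $m$ independent groups of observations $\{X_{ki}:1\le k\le n_i\}$, $1\le i\le m$; within group $i$ the $X_{ki}$ are i.i.d. with mean $\mu_i$ and variance $\sigma_i^2>0$, and $n_i\ge2$. Put $n=\max_i n_i$; $m=m_n$ depends on $n$, and asymptotics are as $m,n\to\infty$. The quantities $n_i,\mu_i,\sigma_i$ and the distributions may vary along the sequence. Notation. $\Phi$ is the standard normal c.d.f., $\bar\Phi=1-\Phi$, with $\bar\Phi^{-1}(0)=+\infty$ and $\bar\Phi^{-1}(1)=-\infty$. $\bar X_i=n_i^{-1}\sum_{k=1}^{n_i}X_{ki}$, $\hat\sigma_i^2=(n_i-1)^{-1}\sum_{k=1}^{n_i}(X_{ki}-\bar X_i)^2$. The centered two-sample t-statistics are $$\bar T_{ij}=\frac{(\bar X_i-\bar X_j)-(\mu_i-\mu_j)}{\sqrt{\hat\sigma_i^2/n_i+\hat\sigma_j^2/n_j}},\quad i\ne j$$ (set to $0$ if the denominator vanishes). For $i<j$, $\bar p_{ij,L}=F_{ij}(\bar T_{ij})$ and $\bar p_{ij,U}=1-F_{ij}(\bar T_{ij})$. Also $\mathcal{H}_0=\{(i,j):i<j,\ \mu_i-\mu_j=0\}$, $\mathcal{H}_+=\{(i,j):i<j,\ \mu_i-\mu_j>0\}$, $\mathcal{H}_-=\{(i,j):i<j,\ \mu_i-\mu_j<0\}$ (indices in $\{1,\dots,m\}$), $q=m(m-1)/2$ and $q_0=|\mathcal{H}_0|$. *)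

(* Defs.v *)
From HB Require Import structures.
From mathcomp Require Export all_boot all_order all_algebra.
From mathcomp Require Export all_classical all_reals all_analysis.

Set Implicit Arguments.
Unset Strict Implicit.
Unset Printing Implicit Defensive.

Export Order.TTheory GRing.Theory Num.Theory.
Export numFieldNormedType.Exports.

Local Open Scope classical_set_scope.
Local Open Scope ring_scope.

Section normal_tail.
Context {R : realType}.

Definition Phi (t : R) : R := fine (normal_prob 0 1 `]-oo, t]).

Definition barPhi (t : R) : R := 1 - Phi t.

(* barPhi is a decreasing bijection from R onto ]0, 1[, so for 0 < p < 1 the
   set below is a singleton; only arguments in [0, 1] are meaningful. *)
Definition barPhi_inv (p : R) : \bar R :=
  if p == 0 then +oo%E
  else if p == 1 then -oo%E
  else (xget 0 [set x : R | barPhi x = p])%:E.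

End normal_tail.

Section probability_notions.
Context {d : measure_display} {T : measurableType d} {R : realType}.
Variable P : probability T R.

Definition mutually_independent (I : finType) (X : I -> {RV P >-> R}) : Prop :=
  forall (J : {set I}) (B : I -> set R), (forall a, measurable (B a)) ->
    P (\bigcap_(a in [set` J]) (X a @^-1` B a)) =
    (\prod_(a in J) P (X a @^-1` B a))%E.

Definition identically_distributed (X Y : {RV P >-> R}) : Prop :=
  forall B : set R, measurable B -> distribution P X B = distribution P Y B.

End probability_notions.

Definition distribution_function (R : realType) (F : R -> R) : Prop :=
  [/\ {homo F : x y / x <= y}, right_continuous F,
      F x @[x --> -oo%R] --> (0 : R) & F x @[x --> +oo%R] --> (1 : R)].

(* Convergence to 0 in probability; the variables Z l may live on different
   probability spaces. *)
Definition cvg0_in_probability (R : realType) (d : nat -> measure_display)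
    (T : forall l, measurableType (d l)) (P : forall l, probability (T l) R)
    (Z : forall l, T l -> R) : Prop :=
  forall eps : R, 0 < eps ->
    P l [set w | eps < `|Z l w|] @[l --> \oo] --> (0 : \bar R)%E.

(* The observation X_{ki} is [obs i k], with i and k numbered from 0. *)
Record experiment (R : realType) := Experiment {
  disp : measure_display ;
  space : measurableType disp ;
  prob : probability space R ;
  ngroups : nat ;
  gsize : 'I_ngroups -> nat ;
  mean : 'I_ngroups -> R ;
  sd : 'I_ngroups -> R ;
  obs : forall i : 'I_ngroups, 'I_(gsize i) -> {RV prob >-> R} ;
  gsize_ge2 : forall i, (2 <= gsize i)%N ;
  sd_gt0 : forall i, 0 < sd i ;
  obs_independent :
    mutually_independent (fun a : {i : 'I_ngroups & 'I_(gsize i)} =>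
                            obs (tagged a)) ;
  obs_identical : forall i (k k' : 'I_(gsize i)),
    identically_distributed (obs k) (obs k') ;
  obs_mean : forall i (k : 'I_(gsize i)), 'E_prob[obs k]%E = (mean i)%:E ;
  obs_variance : forall i (k : 'I_(gsize i)),
    'V_prob[obs k]%E = (sd i ^+ 2)%:E
}.

Section statistics.
Context {R : realType}.
Variable E : experiment R.
Notation m := (ngroups E).

Definition maxsize : nat := \max_(i < m) gsize i.

Definition obs1 (i : 'I_m) : {RV prob E >-> R} :=
  obs (Ordinal (ltnW (gsize_ge2 i))).

Definition sample_mean (i : 'I_m) (w : space E) : R :=
  (gsize i)%:R^-1 * \sum_(k < gsize i) obs k w.

Definition sample_var (i : 'I_m) (w : space E) : R :=
  ((gsize i)%:R - 1)^-1 *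
  \sum_(k < gsize i) (obs k w - sample_mean i w) ^+ 2.

(* Division by 0 yields 0, which is the required convention here. *)
Definition barT (i j : 'I_m) (w : space E) : R :=
  ((sample_mean i w - sample_mean j w) - (mean i - mean j)) /
  Num.sqrt (sample_var i w / (gsize i)%:R + sample_var j w / (gsize j)%:R).

Definition H0 : {set 'I_m * 'I_m} :=
  [set ij : 'I_m * 'I_m | (ij.1 < ij.2)%N && (mean ij.1 - mean ij.2 == 0)]%SET.
Definition Hplus : {set 'I_m * 'I_m} :=
  [set ij : 'I_m * 'I_m | (ij.1 < ij.2)%N && (mean ij.1 - mean ij.2 > 0)]%SET.
Definition Hminus : {set 'I_m * 'I_m} :=
  [set ij : 'I_m * 'I_m | (ij.1 < ij.2)%N && (mean ij.1 - mean ij.2 < 0)]%SET.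

Definition q : R := m%:R * (m%:R - 1) / 2.
Definition q0 : nat := #|H0|.

Variable F : 'I_m -> 'I_m -> R -> R.

Definition barpL (i j : 'I_m) (w : space E) : R := F i j (barT i j w).
Definition barpU (i j : 'I_m) (w : space E) : R := 1 - F i j (barT i j w).

(* Here and in [sup_relative_error] the sup ranges over a bounded set, since
   barPhi is bounded below by a positive constant on a compact interval and
   the F i j take their values in [0, 1]. *)
Definition null_approx_error : R :=
  \big[Num.max/0]_(ij : 'I_m * 'I_m | (ij.1 < ij.2)%N)
    sup [set `|(1 - F ij.1 ij.2 t) / barPhi t - 1| |
          t in `[0, 2 * Num.sqrt (ln m%:R)]].

Definition rejections (t : R) (w : space E) : R :=
  \sum_(ij in (Hplus :|: H0)%SET)
     ((t%:E <= barPhi_inv (barpL ij.1 ij.2 w))%E : nat)%:R +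
  \sum_(ij in (Hminus :|: H0)%SET)
     ((t%:E <= barPhi_inv (barpU ij.1 ij.2 w))%E : nat)%:R.

Definition sup_relative_error (w : space E) : R :=
  sup [set `|rejections t w / (barPhi t * (q + q0%:R)) - 1| |
        t in `[0, Num.sqrt (2 * ln m%:R)]].

End statistics.

(* Main.v *)
From HB Require Import structures.
Require Import Defs.
From mathcomp Require Import measurable_realfun ring lra.

Set Implicit Arguments.
Unset Strict Implicit.
Unset Printing Implicit Defensive.

Local Open Scope classical_set_scope.
Local Open Scope ring_scope.

(** Orient every pair of groups so that its first mean is the smaller one, keeping
    both orientations when the means agree.  There are q + q0 oriented pairs x, and
    the numerator counts those with 1 - F_x(T_x) <= barPhi t.

    Put u = sqrt (2 ln m) + 4 and p = 2 + 4r + nu.  Truncating the standardized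
    observations at n^(1/2 - nu/(4p)) and replacing the estimated variances by the
    true ones changes T_x by a factor 1 + O(u^-4), outside an event whose probability
    vanishes by Chernoff bounds.  The statistics S_x obtained in this way are sums of
    bounded independent variables.  Lindeberg's replacement along the heat flow
    G(v, x) = Phi(x / sqrt v), with every error weighted by exp(lx + l^2 v/2) at l = t,
    gives P(S_x >= t) = barPhi t (1 + o(1)) uniformly on -1 <= t <= u - 1.

    The number of x with S_x >= t concentrates: disjoint pairs are independent, and
    pairs sharing a group have correlation at most some rho < 1, so that a Chernoff
    bound for S_x + S_y bounds their joint tail by exp(1 - t^2/(1 + rho)).  Chebyshev's
    inequality on a grid of thresholds of step u^-2 and monotonicity in t conclude. *)

(** * Taylor bounds and the normal tail *)

(** The error has to be small relative to barPhi t, which falls to about 1/m at the right end of the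
    range, while m may be any fixed power of n; a uniform normal approximation, with error of order
    n^(-1/2) at best, says nothing there. The exponential weight repairs this: at x = -t, l = t and
    v near 1 it is about exp(-t^2/2), which exceeds barPhi t by a factor of order u at most. The
    price is thus a power of u, i.e. of sqrt (ln m), and the Lindeberg errors, a negative power of
    n, absorb it.

    Concentration is also tightest at the right end. About m^3 couples of pairs share a group, each
    with joint tail about m^(-2/(1 + rho)), against a squared mean count of order m^2 up to
    logarithms. The quotient is m^(-(1 - rho)/(1 + rho)), so any fixed rho < 1 suffices, and the
    bounded ratios of variances and sizes provide one. The same exponent leaves room for a union
    over the grid, whose cardinality is a power of u. *)

Section taylor.
Context {R : realType}.
Implicit Types (f g : R -> R) (a b M : R).

Lemma is_derive1_ext f g (x df : R) :
  f =1 g -> is_derive x 1 f df -> is_derive x 1 g df.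
Proof. by move=> /funext ->. Qed.

Lemma MVT_abs f (f' : R -> R) a b :
  (forall z, `|z - a| <= `|b - a| -> is_derive z 1 f (f' z)) ->
  exists2 c, `|c - a| <= `|b - a| & f b - f a = f' c * (b - a).
Proof.
move=> df.
have cf z : `|z - a| <= `|b - a| -> {for z, continuous f}.
  by move=> /df dz; apply/differentiable_continuous/derivable1_diffP.
have [ab|ba] := leP a b.
  have [x||c] := @MVT_segment R f f' a b ab.
  - rewrite in_itv/= => /andP[? ?].
    by apply: df; rewrite !ger0_norm; lra.
  - apply: continuous_in_subspaceT => x; rewrite inE/= in_itv/= => /andP[? ?].
    by apply: cf; rewrite !ger0_norm; lra.
  - rewrite in_itv/= => /andP[ac cb] ->.
    by exists c => //; rewrite !ger0_norm; lra.
have [x||c] := @MVT_segment R f f' b a (ltW ba).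
- rewrite in_itv/= => /andP[? ?].
  by apply: df; rewrite !ler0_norm; lra.
- apply: continuous_in_subspaceT => x; rewrite inE/= in_itv/= => /andP[? ?].
  by apply: cf; rewrite !ler0_norm; lra.
rewrite in_itv/= => /andP[ac cb] e.
exists c; last by rewrite -opprB e; ring.
by rewrite !ler0_norm; lra.
Qed.

(** Two applications of the mean value theorem. This loses the factor 1/2 of the usual remainder,
    which is harmless because only the order of the error matters. *)
Lemma taylor1_bound f (f1 f2 : R -> R) a b M :
  (forall z, `|z - a| <= `|b - a| -> is_derive z 1 f (f1 z)) ->
  (forall z, `|z - a| <= `|b - a| -> is_derive z 1 f1 (f2 z)) ->
  (forall z, `|z - a| <= `|b - a| -> `|f2 z| <= M) ->
  `|f b - f a - f1 a * (b - a)| <= M * `|b - a| ^+ 2.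
Proof.
move=> d1 d2 bM; have [c cab ->] := MVT_abs d1.
have [c' c'ca e] : exists2 c', `|c' - a| <= `|c - a| &
    f1 c - f1 a = f2 c' * (c - a).
  by apply: MVT_abs => z zc; apply: d2; exact: le_trans zc cab.
rewrite -mulrBl e !normrM expr2 mulrA ler_wpM2r// ler_pM//.
by apply: bM; exact: le_trans c'ca cab.
Qed.

Lemma taylor2_bound f (f1 f2 f3 : R -> R) a b M :
  (forall z, `|z - a| <= `|b - a| -> is_derive z 1 f (f1 z)) ->
  (forall z, `|z - a| <= `|b - a| -> is_derive z 1 f1 (f2 z)) ->
  (forall z, `|z - a| <= `|b - a| -> is_derive z 1 f2 (f3 z)) ->
  (forall z, `|z - a| <= `|b - a| -> `|f3 z| <= M) ->
  `|f b - f a - f1 a * (b - a) - f2 a * (b - a) ^+ 2 / 2|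
    <= M * `|b - a| ^+ 3.
Proof.
move=> d1 d2 d3 bM.
(* The derivative of the second-order remainder is the first-order remainder of [f1], so
   [taylor1_bound] applies to it. *)
pose g z := f z - f1 a * (z - a) - f2 a * (z - a) ^+ 2 / 2.
pose g' z := f1 z - f1 a - f2 a * (z - a).
have dg z : `|z - a| <= `|b - a| -> is_derive z 1 g (g' z).
  move=> za; have ? := d1 _ za.
  apply: (@is_derive1_ext (f - (f1 a \*: (id - cst a)) -
      ((f2 a / 2) \*: ((id - cst a) ^+ 2)))).
    move=> y; rewrite /g !fctE/= /GRing.scale/=; ring.
  by apply: is_derive_eq; rewrite /g' /GRing.scale/= !fctE; field.
have [c cab e] := MVT_abs dg.
rewrite (_ : _ - _ = g b - g a); last by rewrite /g; field.
rewrite e normrM exprSr mulrA ler_wpM2r//.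
rewrite (_ : g' c = f1 c - f1 a - f2 a * (c - a)) //.
apply: le_trans (@taylor1_bound f1 f2 f3 a c M _ _ _) _.
- by move=> z zc; apply: d2; exact: le_trans zc cab.
- by move=> z zc; apply: d3; exact: le_trans zc cab.
- by move=> z zc; apply: bM; exact: le_trans zc cab.
rewrite ler_wpM2l//; first by apply: le_trans (bM a _); rewrite ?subrr ?normr0.
by rewrite lerXn2r// nnegrE.
Qed.

End taylor.

Section normal.
Context {R : realType}.
Implicit Types a b k s t u v x : R.

Definition phi t : R := normal_pdf 0 1 t.
Definition npk : R := normal_peak 1.

Lemma npk_gt0 : 0 < npk. Proof. exact: normal_peak_gt0. Qed.

Lemma npk_le1 : npk <= 1.
Proof.
rewrite /npk /normal_peak invf_le1 ?sqrtr_gt0; last first.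
  by rewrite expr1n mul1r mulrn_wgt0// pi_gt0.
rewrite -[leLHS]sqrtr1 ler_sqrt// expr1n mul1r mulr2n.
  by have := @pi_ge2 R; lra.
by have := @pi_ge2 R; lra.
Qed.

Lemma phiE t : phi t = npk * expR (- t ^+ 2 / 2).
Proof. by rewrite /phi normal_pdfE//= /normal_fun subr0 expr1n. Qed.

Lemma phi_gt0 t : 0 < phi t.
Proof. by rewrite phiE mulr_gt0 ?expR_gt0 ?npk_gt0. Qed.

Lemma phi_le t : phi t <= expR (- t ^+ 2 / 2).
Proof. by rewrite phiE ler_piMl ?expR_ge0 ?npk_le1. Qed.

Global Instance is_derive_phi t : is_derive t 1 phi (- t * phi t).
Proof.
apply: (@is_derive1_ext _ (npk \*: (expR \o ((- 2^-1) \*: (id ^+ 2))))).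
  move=> y; rewrite phiE !fctE/= /GRing.scale/=; congr (_ * expR _); lra.
apply: is_derive_eq; rewrite phiE /GRing.scale/= !fctE/=.
rewrite /GRing.scale/= (_ : - 2^-1 * t ^+ 2 = - t ^+ 2 / 2); last by lra.
by rewrite expr1; lra.
Qed.

Global Instance is_derive_Phi t : is_derive t 1 Phi (phi t).
Proof.
have [] := @continuous_FTC1 R phi -oo%O t (t + 1).
- by rewrite ltrDl.
- apply: (integrableS measurableT) => //; exact: integrable_normal_pdf.
- by rewrite ltNyr.
- exact: continuous_normal_pdf.
move=> d e; apply: DeriveDef; first exact: d.
by rewrite -derive1E -e.
Qed.

Global Instance is_derive_barPhi t : is_derive t 1 barPhi (- phi t).
Proof.
apply: (@is_derive1_ext _ (cst 1 - Phi)) => //.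
by apply: is_derive_eq; rewrite sub0r.
Qed.

Lemma Phi_ge0 t : 0 <= Phi t :> R.
Proof. by rewrite fine_ge0. Qed.

Lemma Phi_le1 t : Phi t <= 1 :> R.
Proof.
rewrite -lee_fin /Phi fineK; first exact: probability_le1.
exact: fin_num_measure.
Qed.

Lemma barPhi_ge0 t : 0 <= barPhi t.
Proof. by rewrite subr_ge0 Phi_le1. Qed.

Lemma barPhi_le1 t : barPhi t <= 1.
Proof. by rewrite lerBlDr lerDl Phi_ge0. Qed.

Lemma barPhi_MVT a b : a <= b ->
  exists2 c, a <= c <= b & barPhi a - barPhi b = phi c * (b - a).
Proof.
move=> ab; have [|c + e] := @MVT_segment R barPhi (fun t => - phi t) a b ab
    (fun x _ => is_derive_barPhi x).
  apply: continuous_subspaceT => x.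
  by apply/differentiable_continuous/derivable1_diffP.
by rewrite in_itv/= => cab; exists c => //; lra.
Qed.

Lemma barPhi_lt a b : a < b -> barPhi b < barPhi a.
Proof.
move=> ab; have [c _ e] := barPhi_MVT (ltW ab).
by rewrite -subr_gt0 e mulr_gt0 ?phi_gt0// subr_gt0.
Qed.

Lemma barPhi_le a b : a <= b -> barPhi b <= barPhi a.
Proof. by rewrite le_eqVlt => /predU1P[->//|/barPhi_lt/ltW]. Qed.

Lemma barPhi_gt0 t : 0 < barPhi t.
Proof. by apply: le_lt_trans (barPhi_ge0 (t + 1)) _; rewrite barPhi_lt// ltrDl. Qed.

Lemma barPhi_lt1 t : barPhi t < 1.
Proof. by apply: lt_le_trans (barPhi_le1 (t - 1)); rewrite barPhi_lt// gtrBl. Qed.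

(** The identity, as a random variable under the normal law, has [Phi] as its c.d.f.; the known
    limits of c.d.f.s at infinity then apply to [Phi]. *)
Let idTR : measurableTypeR R -> R := idfun.

#[local] HB.instance Definition _ :=
  @isMeasurableFun.Build _ _ _ _ idTR (@measurable_id _ _ setT).

Lemma cvg_Phi_pinfty : Phi x @[x --> +oo%R] --> (1 : R).
Proof.
have := @cvg_cdfy1 _ _ _ (normal_prob 0 1 : probability _ R)
  (idTR : {RV (normal_prob 0 1 : probability _ R) >-> R}).
by move/fine_cvg => /=; apply: cvg_trans.
Qed.

Lemma cvg_Phi_ninfty : Phi x @[x --> -oo%R] --> (0 : R).
Proof.
have := @cvg_cdfNy0 _ _ _ (normal_prob 0 1 : probability _ R)
  (idTR : {RV (normal_prob 0 1 : probability _ R) >-> R}).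
by move/fine_cvg => /=; apply: cvg_trans.
Qed.

Lemma cvg_barPhi_pinfty : barPhi x @[x --> +oo%R] --> (0 : R).
Proof.
rewrite -(subrr 1); apply: cvgB; [exact: cvg_cst|exact: cvg_Phi_pinfty].
Qed.

Lemma cvg_barPhi_ninfty : barPhi x @[x --> -oo%R] --> (1 : R).
Proof.
rewrite -[X in _ --> X](subr0 1); apply: cvgB; [exact: cvg_cst|exact: cvg_Phi_ninfty].
Qed.

(** By evenness of the density the difference of the two sides has derivative 0, and it tends to 0
    at infinity. *)
Lemma barPhiN t : barPhi (- t) = Phi t.
Proof.
pose f x : R := barPhi (- x) - Phi x.
have df x : is_derive x 1 f 0.
  apply: (@is_derive1_ext _ ((barPhi \o -%R) - Phi)) => //.
  apply: is_derive_eq; rewrite !phiE sqrrN; lra.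
apply/eqP; rewrite -subr_eq0 -/(f t); apply/eqP.
have cf : f x @[x --> +oo%R] --> (1 - 1 : R).
  apply: cvgB; last exact: cvg_Phi_pinfty.
  have := cvg_barPhi_ninfty; rewrite cvgNy_compNP; exact: cvg_trans.
have cf' : f x @[x --> +oo%R] --> f t.
  rewrite (_ : f = cst (f t)); first exact: cvg_cst.
  by apply/funext => x; exact: (@is_derive_0_is_cst _ _ x t).
rewrite subrr in cf; exact: cvg_unique cf' cf.
Qed.

Lemma barPhi0 : barPhi 0 = 2^-1 :> R.
Proof. have := barPhiN 0; rewrite oppr0 {1 2}/barPhi; lra. Qed.

Lemma barPhi_surj (p : R) : 0 < p < 1 -> exists x : R, barPhi x = p.
Proof.
move=> /andP[p0 p1].
have [b bp] : exists b, barPhi b < p.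
  have /cvgrPdist_lt/(_ _ p0) := cvg_barPhi_pinfty.
  case=> M [_ hM]; exists (M + 1).
  by have := hM (M + 1) _; rewrite sub0r normrN ger0_norm ?barPhi_ge0//; apply; rewrite ltrDl.
have [a ap] : exists a, p < barPhi a.
  have p1' : 0 < 1 - p by lra.
  have /cvgrPdist_lt/(_ _ p1') := cvg_barPhi_ninfty.
  case=> M [_ hM]; exists (M - 1).
  have := hM (M - 1) _; rewrite gtrBl => /(_ ltr01).
  by rewrite ger0_norm ?subr_ge0 ?barPhi_le1//; lra.
have ab : a <= b.
  by rewrite leNgt; apply/negP => /barPhi_lt; lra.
have [||c _ <-] := @IVT R barPhi a b p ab.
- apply: continuous_subspaceT => x.
  by apply/differentiable_continuous/derivable1_diffP.
- by rewrite minEge maxEle; case: ifPn; case: ifPn; lra.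
by exists c.
Qed.

Lemma barPhi_inj : injective (@barPhi R).
Proof.
by move=> a b e; have [/barPhi_lt|/barPhi_lt|//] := ltgtP a b; rewrite e ltxx.
Qed.

(** Removes the inverse from the rejection rule. The conventions at p = 0 and p = 1 agree with 0 <
    barPhi t < 1. *)
Lemma barPhi_invE t (p : R) : 0 <= p <= 1 ->
  (t%:E <= barPhi_inv p)%E = (p <= barPhi t).
Proof.
move=> /andP[p0 p1]; rewrite /barPhi_inv; case: eqVneq => [->|pn0].
  by rewrite leey barPhi_ge0.
case: eqVneq => [->|pn1]; first by rewrite leNgt ltNyr leNgt barPhi_lt1.
have : 0 < p < 1 by rewrite !lt_neqAle eq_sym pn0 p0 pn1 p1.
move=> /barPhi_surj[x ex].
rewrite (_ : xget 0 _ = x); last first.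
  by case: xgetP => [y -> /= ey|/(_ x)//]; apply: barPhi_inj; rewrite ey ex.
rewrite lee_fin -ex; apply/idP/idP => [|]; first exact: barPhi_le.
by rewrite leNgt => h; rewrite leNgt; apply: contra h; exact: barPhi_lt.
Qed.

(** For t, s >= 0, phi (t + s) <= exp (- t^2/2) phi s. Hence [H] is nondecreasing on s >= 0, and as
    it tends to 0 it is nonpositive at 0. *)
Lemma barPhi_le_exp t : 0 <= t -> barPhi t <= expR (- t ^+ 2 / 2).
Proof.
move=> t0.
pose H s := barPhi (t + s) - expR (- t ^+ 2 / 2) * barPhi s.
pose H' s := expR (- t ^+ 2 / 2) * phi s - phi (t + s).
have dH (s : R) : is_derive s 1 H (H' s).
  apply: (@is_derive1_ext _ ((barPhi \o (cst t + id)) -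
      expR (- t ^+ 2 / 2) \*: barPhi)) => //.
  by apply: is_derive_eq; rewrite /H' /GRing.scale/= !fctE; lra.
have H0 s : 0 <= s -> H 0 <= H s.
  move=> s0; have [|c + e] := @MVT_segment R H H' 0 s s0 (fun x _ => dH x).
    apply: continuous_subspaceT => x.
    by apply/differentiable_continuous/derivable1_diffP.
  rewrite in_itv/= => /andP[c0 _].
  rewrite -subr_ge0 e mulr_ge0 ?subr_ge0// !phiE mulrCA.
  rewrite ler_pM2l ?npk_gt0// -expRD ler_expR; nra.
have cH : H x @[x --> +oo%R] --> (0 - expR (- t ^+ 2 / 2) * 0 : R).
  apply: cvgB; last by apply: cvgMl_tmp; exact: cvg_barPhi_pinfty.
  apply: (cvg_comp (fun x => t + x) barPhi); last exact: cvg_barPhi_pinfty.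
  exact: cvg_addrl.
rewrite mulr0 subrr in cH.
have : H 0 <= 0.
  rewrite -[leRHS](cvg_lim _ cH)//; apply: limr_ge; first by apply/cvg_ex; exists 0.
  by near=> s; apply: H0; near: s; exact: nbhs_pinfty_ge.
rewrite /H addr0 barPhi0; have := expR_ge0 (- t ^+ 2 / 2); lra.
Unshelve. all: by end_near. Qed.

Definition CM : R := expR (3 / 2) / npk.

Lemma CM_gt0 : 0 < CM. Proof. by rewrite divr_gt0 ?expR_gt0 ?npk_gt0. Qed.

(** barPhi t is at least the mass of the interval from t to t + 1/u. There the square of the
    argument exceeds t^2 by at most 2 + 1, hence the 3/2 in [CM]. *)
Lemma exp_le_barPhi t u : 1 <= u -> -1 <= t <= u ->
  expR (- t ^+ 2 / 2) <= CM * u * barPhi t.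
Proof.
move=> u1 /andP[t1 tu].
have u0 : 0 < u by lra.
have iu : 0 < u^-1 by rewrite invr_gt0.
have iu1 : u * u^-1 = 1 by rewrite divff// gt_eqF.
have [|c cab e] := @barPhi_MVT t (t + u^-1); first by lra.
rewrite (addrC t) addrK (addrC _ t) in e.
apply: (@le_trans _ _ (CM * u * (phi c * u^-1))); last first.
  apply: ler_wpM2l; first by rewrite mulr_ge0// ltW// CM_gt0.
  rewrite -e.
  have := barPhi_ge0 (t + u^-1); lra.
rewrite (_ : CM * u * _ = CM * phi c); last by field; rewrite gt_eqF.
rewrite phiE /CM -mulrA mulKf ?gt_eqF ?npk_gt0// -expRD ler_expR.
have iul : u^-1 <= 1 by rewrite invf_le1.
nra.
Qed.

(** The normal density at 1. *)
Definition c0 : R := npk * expR (- 2^-1).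

Lemma c0_gt0 : 0 < c0. Proof. by rewrite mulr_gt0 ?expR_gt0 ?npk_gt0. Qed.

(** The density between t and t + k is at least [c0] times barPhi (t + k): if t + k <= 1 it is at
    least the density at 1, and otherwise [barPhi_le_exp] applies at t + k. This turns a small
    relative error into a small shift of the threshold. *)
Lemma barPhi_shift_ge t k : -1 <= t -> 0 <= k <= 1 ->
  (1 + c0 * k) * barPhi (t + k) <= barPhi t.
Proof.
move=> t1 /andP[k0 k1].
have [|c /andP[tc ctk] e] := @barPhi_MVT t (t + k); first by lra.
rewrite (addrC t) addrK (addrC _ t) in e.
suff : c0 * barPhi (t + k) <= phi c by nra.
have b1 := barPhi_le1 (t + k).
have b0 := barPhi_ge0 (t + k).
rewrite /c0 phiE -mulrA ler_pM2l ?npk_gt0//.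
have [h|h] := leP (t + k) 1.
  apply: (@le_trans _ _ (expR (- 2^-1))).
    by rewrite ler_piMr// expR_ge0.
  rewrite ler_expR; nra.
apply: (@le_trans _ _ (barPhi (t + k))).
  by rewrite ler_piMl// -expR0 ler_expR; lra.
apply: le_trans (barPhi_le_exp _) _; first by lra.
rewrite ler_expR; nra.
Qed.

Definition C1 : R := expR 1 * CM.

Lemma C1_gt0 : 0 < C1. Proof. by rewrite mulr_gt0 ?expR_gt0 ?CM_gt0. Qed.

(** As k * u <= 1, the density between t - k and t is at most e times exp (- t^2/2), which
    [exp_le_barPhi] compares with barPhi t. *)
Lemma barPhi_shift_le t k u : 1 <= u -> -1 <= t <= u -> 0 <= k -> k * u <= 1 ->
  barPhi (t - k) <= (1 + C1 * u * k) * barPhi t.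
Proof.
move=> u1 tu k0 ku; have tu' := tu; case/andP: tu' => t1 tu'.
have [|c /andP[tc ctk] e] := @barPhi_MVT (t - k) t; first by lra.
rewrite (_ : t - (t - k) = k) in e; last by lra.
suff : phi c <= C1 * u * barPhi t by nra.
apply: le_trans (phi_le _) _.
rewrite /C1 -2!mulrA.
apply: (@le_trans _ _ (expR 1 * expR (- t ^+ 2 / 2))); last first.
  by rewrite ler_pM2l ?expR_gt0// mulrA exp_le_barPhi.
rewrite -expRD ler_expR.
have [?|?] := leP 0 t; nra.
Qed.

End normal.

(** * The heat flow *)

Section heat.
Context {R : realType}.
Implicit Types a b s t u v x y z l K : R.

Definition isq v : R := (Num.sqrt v)^-1.

(* G solves the heat equation dG/dv = G2 / 2; G1, G2, G3 are its derivatives in x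
   and Gvv its second derivative in v. *)
Definition G v x : R := Phi (x * isq v).
Definition G1 v x : R := isq v * phi (x * isq v).
Definition G2 v x : R := - (isq v ^+ 3 * x * phi (x * isq v)).
Definition G3 v x : R := (isq v ^+ 5 * x ^+ 2 - isq v ^+ 3) * phi (x * isq v).
Definition Gvv v x : R :=
  4^-1 * (3 * isq v ^+ 5 * x - isq v ^+ 7 * x ^+ 3) * phi (x * isq v).

Lemma isq_gt0 v : 0 < v -> 0 < isq v.
Proof. by move=> v0; rewrite invr_gt0 sqrtr_gt0. Qed.

Lemma G_derive_x v x : is_derive x 1 (G v) (G1 v x).
Proof.
apply: (@is_derive1_ext _ (Phi \o (isq v \*: id))).
  by move=> y; rewrite /G/= /GRing.scale/= mulrC.
by apply: is_derive_eq; rewrite /G1 /GRing.scale/= mulr1 mulrC (mulrC x).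
Qed.

Lemma G1_derive_x v x : is_derive x 1 (G1 v) (G2 v x).
Proof.
apply: (@is_derive1_ext _ (isq v \*: (phi \o (isq v \*: id)))).
  by move=> y; rewrite /G1/= /GRing.scale/= (mulrC y).
apply: is_derive_eq.
by rewrite /G2 /GRing.scale/= /GRing.scale/= !mulr1 (mulrC x); ring.
Qed.

Lemma G2_derive_x v x : is_derive x 1 (G2 v) (G3 v x).
Proof.
apply: (@is_derive1_ext _ ((- isq v ^+ 3) \*: (id * (phi \o (isq v \*: id))))).
  by move=> y; rewrite /G2/= !fctE/= /GRing.scale/= (mulrC y (isq v)); ring.
apply: is_derive_eq.
by rewrite /G3 /GRing.scale/= /GRing.scale/= !mulr1 (mulrC x (isq v)); ring.
Qed.

Lemma isq_derive v : 0 < v -> is_derive v 1 isq (- 2^-1 * isq v ^+ 3).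
Proof.
move=> v0; have nz : Num.sqrt v != 0 by rewrite gt_eqF// sqrtr_gt0.
have := @is_deriveV _ _ _ _ _ nz (is_derive1_sqrt v0).
rewrite (_ : _ *: _ = - 2^-1 * isq v ^+ 3)//.
by rewrite /isq /GRing.scale/=; field.
Qed.

Lemma G_derive_v v x : 0 < v -> is_derive v 1 (G ^~ x) (2^-1 * G2 v x).
Proof.
move=> v0; have ? := isq_derive v0.
apply: (@is_derive1_ext _ (Phi \o (x \*: isq))) => //.
by apply: is_derive_eq; rewrite /G2 /GRing.scale/= /GRing.scale/=; ring.
Qed.

Lemma G2_derive_v v x : 0 < v ->
  is_derive v 1 (fun v => 2^-1 * G2 v x) (Gvv v x).
Proof.
move=> v0; have ? := isq_derive v0.
apply: (@is_derive1_ext _ ((- 2^-1 * x) \*: (isq ^+ 3 * (phi \o (x \*: isq))))).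
  by move=> y; rewrite /G2/= !fctE /GRing.scale/= /GRing.scale/=; ring.
apply: is_derive_eq; rewrite /Gvv /= !fctE /GRing.scale/= /GRing.scale/=.
by field.
Qed.

(** exp (z^2/2) is the square of exp (z^2/4) >= 1 + z^2/4, a polynomial of degree 4 in total. *)
Lemma cube_exp_bound z : 0 <= z -> (1 + z) ^+ 3 <= 64 * expR (z ^+ 2 / 2).
Proof.
move=> z0.
have z2 : 0 <= z ^+ 2 / 2 by nra.
have h : 1 + z ^+ 2 / 4 <= expR (z ^+ 2 / 4) by rewrite expR_ge1Dx.
have -> : expR (z ^+ 2 / 2) = expR (z ^+ 2 / 4) ^+ 2.
  by rewrite -expRM_natl; congr expR; field.
apply: (@le_trans _ _ (64 * (1 + z ^+ 2 / 4) ^+ 2)).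
  have [z1|z1] := leP z 1; nra.
by rewrite ler_pM2l// lerXn2r ?nnegrE ?expR_ge0//; nra.
Qed.

(* EE l v x is the mean of exp (l y) for y normal of mean x and variance v; it
   dominates the derivatives of G whatever l is. *)
Definition EE l v x : R := expR (l * x + l ^+ 2 * v / 2).

Lemma EE_gt0 l v x : 0 < EE l v x. Proof. exact: expR_gt0. Qed.

(** With y = x / sqrt v and mu = l sqrt v, the weight is exp ((y + mu)^2/2 - y^2/2). So phi y is at
    most the weight times exp (- (y + mu)^2/2), and that Gaussian factor absorbs the powers of |y +
    mu| left after 1 + |y| <= (1 + |mu|) (1 + |y + mu|). *)
Lemma cube_phi_bound l v x : 0 < v <= 2 ->
  (1 + `|x * isq v|) ^+ 3 * phi (x * isq v) <= 512 * (1 + `|l|) ^+ 3 * EE l v x.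
Proof.
move=> /andP[v0 v2]; set y := x * isq v.
have s0 : 0 < Num.sqrt v by rewrite sqrtr_gt0.
have s2 : Num.sqrt v ^+ 2 = v by rewrite sqr_sqrtr// ltW.
have sl2 : Num.sqrt v <= 2 by nra.
pose mu := l * Num.sqrt v.
have yx : l * x = mu * y by rewrite /mu /y /isq; field; rewrite gt_eqF.
have mv : l ^+ 2 * v = mu ^+ 2 by rewrite /mu exprMn s2.
have m2 : 1 + `|mu| <= 2 * (1 + `|l|).
  by rewrite /mu normrM (gtr0_norm s0); have := normr_ge0 l; nra.
have tri : 1 + `|y| <= (1 + `|mu|) * (1 + `|y + mu|).
  have : `|y| <= `|y + mu| + `|mu|.
    by rewrite -{1}(addrK mu y) (le_trans (ler_normB _ _)).
  have := normr_ge0 mu; have := normr_ge0 (y + mu); nra.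
have t3 : (1 + `|y|) ^+ 3 <= (8 * (1 + `|l|) ^+ 3) * (1 + `|y + mu|) ^+ 3.
  have -> : 8 * (1 + `|l|) ^+ 3 * (1 + `|y + mu|) ^+ 3 =
    (2 * (1 + `|l|) * (1 + `|y + mu|)) ^+ 3 by ring.
  rewrite lerXn2r ?nnegrE ?addr_ge0// ?mulr_ge0 ?addr_ge0//.
  by apply: le_trans tri _; rewrite ler_wpM2r ?addr_ge0.
apply: (@le_trans _ _ ((1 + `|y|) ^+ 3 * expR (- y ^+ 2 / 2))).
  by rewrite ler_wpM2l ?phi_le// exprn_ge0// addr_ge0.
apply: le_trans (_ : _ <= 8 * (1 + `|l|) ^+ 3 *
  (64 * expR (`|y + mu| ^+ 2 / 2)) * expR (- y ^+ 2 / 2)) _.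
  rewrite ler_wpM2r ?expR_ge0//; apply: le_trans t3 _.
  by rewrite ler_wpM2l ?mulr_ge0 ?exprn_ge0 ?addr_ge0// cube_exp_bound.
rewrite /EE yx mv (_ : 8 * (1 + `|l|) ^+ 3 * _ * _ = 512 * (1 + `|l|) ^+ 3 *
  (expR (`|y + mu| ^+ 2 / 2) * expR (- y ^+ 2 / 2))); last by ring.
rewrite -expRD real_normK ?num_real//.
have -> : (y + mu) ^+ 2 / 2 + - y ^+ 2 / 2 = mu * y + mu ^+ 2 / 2 by field.
exact: lexx.
Qed.

(** [K] bounds [isq v]. Each derivative in x costs a factor [isq v] and each derivative in v two of
    them, so the fourth power covers [Gvv] and all the others. *)
Definition QQ l K : R := 512 * (1 + `|l|) ^+ 3 * K ^+ 4.

Lemma QQ_ge0 l K : 0 <= K -> 0 <= QQ l K.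
Proof.
move=> K0; apply: mulr_ge0; last exact: exprn_ge0.
by apply: mulr_ge0; [exact: ler0n|rewrite exprn_ge0// addr_ge0].
Qed.

Section bounds.
Variables (l v x K : R).
Hypotheses (v0 : 0 < v <= 2) (K1 : 1 <= K) (kK : isq v <= K).

Let K0 : 0 <= K. Proof. by rewrite (le_trans ler01). Qed.

Let b0 y : `|y| <= (1 + `|x * isq v|) ^+ 3 * K ^+ 4 ->
  `|y * phi (x * isq v)| <= QQ l K * EE l v x.
Proof.
move=> h; rewrite normrM (gtr0_norm (phi_gt0 _)).
apply: (@le_trans _ _ ((1 + `|x * isq v|) ^+ 3 * K ^+ 4 * phi (x * isq v))).
  by rewrite ler_wpM2r// ltW// phi_gt0.
rewrite mulrAC /QQ.
have := cube_phi_bound l x v0; set c := (_ * phi _); set c' := (_ ^+ 3) => h'.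
rewrite (_ : 512 * _ * _ * _ = 512 * c' * EE l v x * K ^+ 4); last by ring.
by rewrite ler_wpM2r// exprn_ge0.
Qed.

Let k0 : 0 < isq v. Proof. by apply: isq_gt0; case/andP: v0. Qed.

Let kn n (y : R) (Y : R) : (n <= 4)%N -> `|y| <= Y ->
  `|isq v ^+ n * y| <= Y * K ^+ 4.
Proof.
move=> n4 yY; rewrite normrM mulrC ler_pM//.
rewrite normrX (gtr0_norm k0); apply: (@le_trans _ _ (K ^+ n)).
  by rewrite lerXn2r ?nnegrE ?(ltW k0).
by rewrite ler_weXn2l.
Qed.

Lemma G1_bound : `|G1 v x| <= QQ l K * EE l v x.
Proof.
apply: b0; rewrite -(mulr1 (isq v)) -{1}(expr1 (isq v)); apply: kn => //.
rewrite normr1 mulr1; have := normr_ge0 (x * isq v).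
by set a := `|x * isq v|; nra.
Qed.

Lemma G2_bound : `|G2 v x| <= QQ l K * EE l v x.
Proof.
rewrite /G2 -mulNr; apply: b0.
rewrite (_ : - _ = isq v ^+ 2 * - (x * isq v)); last by ring.
apply: kn => //; rewrite normrN.
by have := normr_ge0 (x * isq v); set a := `|x * isq v|; nra.
Qed.

Lemma G3_bound : `|G3 v x| <= QQ l K * EE l v x.
Proof.
apply: b0.
rewrite (_ : _ - _ = isq v ^+ 3 * ((x * isq v) ^+ 2 - 1)); last by ring.
apply: kn => //; apply: le_trans (ler_normB _ _) _.
rewrite normr1 normrX.
by have := normr_ge0 (x * isq v); set a := `|x * isq v|; nra.
Qed.

Lemma Gvv_bound : `|Gvv v x| <= QQ l K * EE l v x.
Proof.
apply: b0.
rewrite (_ : 4^-1 * _ = isq v ^+ 4 * (4^-1 * (3 * (x * isq v) - (x * isq v) ^+ 3)));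
  last by ring.
apply: kn => //; rewrite normrM gtr0_norm//.
apply: (@le_trans _ _ (4^-1 * (3 * `|x * isq v| + `|x * isq v| ^+ 3))).
  rewrite ler_wpM2l//; apply: le_trans (ler_normB _ _) _.
  by rewrite normrM normrX gtr0_norm.
by have := normr_ge0 (x * isq v); set a := `|x * isq v|; nra.
Qed.

End bounds.

Lemma EE_shift l v x z : `|l| * `|z| <= 1 -> EE l v (x + z) <= expR 1 * EE l v x.
Proof.
move=> lz; rewrite /EE -expRD ler_expR.
have : l * z <= 1 by apply: le_trans (ler_norm _) _; rewrite normrM.
lra.
Qed.

Lemma EE_lev l v v' x : v <= v' -> EE l v x <= EE l v' x.
Proof. move=> vv'; rewrite /EE ler_expR; have := sqr_ge0 l; nra. Qed.

Lemma isq_le v v' : 0 < v -> v <= v' -> isq v' <= isq v.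
Proof.
move=> v0 vv'; rewrite /isq lef_pV2 ?posrE ?sqrtr_gt0//; last by lra.
by rewrite ler_sqrt//; lra.
Qed.

Lemma G_taylor_x l v x K z : 0 < v <= 2 -> 1 <= K -> isq v <= K ->
  `|l| * `|z| <= 1 ->
  `|G v (x + z) - (G v x + G1 v x * z + 2^-1 * G2 v x * z ^+ 2)| <=
    expR 1 * (QQ l K * EE l v x) * `|z| ^+ 3.
Proof.
move=> v0 K1 kK lz.
have := @taylor2_bound _ (G v) (G1 v) (G2 v) (G3 v) x (x + z)
  (expR 1 * (QQ l K * EE l v x)).
have -> : x + z - x = z by ring.
rewrite (_ : G v (x + z) - (_ + _ + _) = G v (x + z) - G v x - G1 v x * z -
  G2 v x * z ^+ 2 / 2); last by field.
apply=> y yz; [exact: G_derive_x|exact: G1_derive_x|exact: G2_derive_x|].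
apply: le_trans (G3_bound l _ v0 K1 kK) _.
rewrite mulrCA ler_wpM2l ?QQ_ge0//; first by lra.
rewrite (_ : y = x + (y - x)); last by ring.
by apply: EE_shift; apply: le_trans lz; rewrite ler_wpM2l.
Qed.

Lemma G_taylor_v l v x K s : 0 < v -> 0 <= s -> v + s <= 2 -> 1 <= K ->
  isq v <= K ->
  `|G (v + s) x - (G v x + 2^-1 * G2 v x * s)| <=
    QQ l K * EE l (v + s) x * s ^+ 2.
Proof.
move=> v0 s0 vs K1 kK.
have cG w : v <= w -> {for w, continuous (G ^~ x)}.
  move=> vw; have ? := G_derive_v x (lt_le_trans v0 vw).
  by apply/differentiable_continuous/derivable1_diffP.
have cG2 w : v <= w -> {for w, continuous (fun v => 2^-1 * G2 v x)}.
  move=> vw; have ? := G2_derive_v x (lt_le_trans v0 vw).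
  by apply/differentiable_continuous/derivable1_diffP.
have vvs : v <= v + s by lra.
have [w||c] := @MVT_segment R (G ^~ x) (fun v => 2^-1 * G2 v x) v (v + s) vvs.
- by rewrite in_itv/= => /andP[vw _]; apply: G_derive_v; lra.
- apply: continuous_in_subspaceT => w; rewrite inE/= in_itv/= => /andP[? ?].
  exact: cG.
rewrite in_itv/= => /andP[vc cvs] e1.
have [w||c'] := @MVT_segment R (fun v => 2^-1 * G2 v x) (Gvv ^~ x) v c vc.
- by rewrite in_itv/= => /andP[vw _]; apply: G2_derive_v; lra.
- apply: continuous_in_subspaceT => w; rewrite inE/= in_itv/= => /andP[? ?].
  exact: cG2.
rewrite in_itv/= => /andP[vc' c'c] e2.
rewrite (_ : _ - _ = Gvv c' x * ((c - v) * s)); last first.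
  by rewrite mulrA -e2 mulrBl; move: e1; rewrite (addrC v) addrK; lra.
clear e1 e2 cG cG2.
rewrite normrM ler_pM//; last by rewrite ger0_norm; nra.
apply: le_trans (Gvv_bound l x _ K1 _) _; first by lra.
  by apply: le_trans kK; apply: isq_le.
by rewrite ler_wpM2l ?QQ_ge0 ?EE_lev//; lra.
Qed.

End heat.

Section QQ_growth.
Context {R : realType}.

Definition cQ : R := 512 * 27.

Lemma cQ_ge0 : 0 <= cQ. Proof. by apply: mulr_ge0; exact: ler0n. Qed.

(** The exponent is 3 for the factor in l plus 4 * 4 for K = u^4, the inverse of the smoothing width
    used for indicators. *)
Lemma QQ_le (t1 u : R) : 1 <= u -> `|t1| <= 2 * u -> QQ t1 (u ^+ 4) <= cQ * u ^+ 19.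
Proof.
move=> u1 t1u; rewrite /QQ /cQ.
rewrite (_ : 512 * 27 * u ^+ 19 = 512 * (3 * u) ^+ 3 * (u ^+ 4) ^+ 4); last by ring.
apply: ler_wpM2r; first by rewrite exprn_ge0// exprn_ge0; lra.
apply: ler_wpM2l; first exact: ler0n.
by rewrite lerXn2r ?nnegrE ?addr_ge0//; lra.
Qed.

End QQ_growth.

(** * Bounded random variables and independence *)

Section bounded_expectation.
Context {d : measure_display} {T : measurableType d} {R : realType}.
Variable P : probability T R.
Implicit Types (f g : T -> R) (A : set T).

(** After truncation every variable is bounded, so that measurability and a bound replace all
    integrability arguments. *)
Definition bm f : Prop :=
  measurable_fun setT f /\ exists M : R, forall w, `|f w| <= M.

Definition Ex f : R := (\int[P]_w f w)%R.

Lemma bm_meas f : bm f -> measurable_fun setT f. Proof. by case. Qed.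

Lemma bm_integrable f : bm f -> P.-integrable setT (EFin \o f).
Proof.
move=> [mf [M fM]]; apply: measurable_bounded_integrable => //.
  by rewrite (le_lt_trans (probability_le1 _ _))// ltry.
exists M; split; first exact: num_real.
by move=> y My w _; exact: le_trans (fM w) (ltW My).
Qed.

Lemma bm_cst (c : R) : bm (cst c).
Proof. by split => //; exists `|c|. Qed.

Lemma bmD f g : bm f -> bm g -> bm (fun w => f w + g w).
Proof.
move=> [mf [M fM]] [mg [N gN]]; split; first exact: measurable_funD.
by exists (M + N) => w; rewrite (le_trans (ler_normD _ _))// lerD.
Qed.

Lemma bmN f : bm f -> bm (fun w => - f w).
Proof.
move=> [mf [M fM]]; split; first exact: measurableT_comp.
by exists M => w; rewrite normrN.
Qed.

Lemma bmB f g : bm f -> bm g -> bm (fun w => f w - g w).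
Proof. by move=> bf bg; apply: bmD => //; exact: bmN. Qed.

Lemma bmM f g : bm f -> bm g -> bm (fun w => f w * g w).
Proof.
move=> [mf [M fM]] [mg [N gN]]; split; first exact: measurable_funM.
by exists (M * N) => w; rewrite normrM ler_pM.
Qed.

Lemma bmZ (c : R) f : bm f -> bm (fun w => c * f w).
Proof. by move=> bf; apply: bmM => //; exact: bm_cst. Qed.

Lemma bmX f n : bm f -> bm (fun w => f w ^+ n).
Proof.
move=> bf; elim: n => [|n ih]; first exact: bm_cst.
by under eq_fun do rewrite exprS; exact: bmM.
Qed.

Lemma bm_norm f : bm f -> bm (fun w => `|f w|).
Proof.
move=> [mf [M fM]]; split; first exact: measurableT_comp.
by exists M => w; rewrite normr_id.
Qed.

Lemma bm_expR f : bm f -> bm (fun w => expR (f w)).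
Proof.
move=> [mf [M fM]]; split; first exact: measurableT_comp.
exists (expR M) => w; rewrite ger0_norm ?expR_ge0// ler_expR.
exact: le_trans (ler_norm _) (fM w).
Qed.

Lemma bm_indic A : measurable A -> bm (\1_A).
Proof.
move=> mA; split; first exact: measurable_indic.
by exists 1 => w; rewrite ger0_norm// indicE lern1 leq_b1.
Qed.

Lemma bm_sum (I : Type) (s : seq I) (Q : pred I) (F : I -> T -> R) :
  (forall i, bm (F i)) -> bm (fun w => \sum_(i <- s | Q i) F i w).
Proof.
move=> bF; elim: s => [|i s ih].
  by under eq_fun do rewrite big_nil; exact: bm_cst.
under eq_fun do rewrite big_cons; case: (Q i) => //.
exact: bmD.
Qed.

Lemma Ex_cst (c : R) : Ex (cst c) = c.
Proof. by rewrite /Ex Rintegral_cst//= probability_setT/= mulr1. Qed.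

Lemma ExD f g : bm f -> bm g -> Ex (fun w => f w + g w) = Ex f + Ex g.
Proof. by move=> bf bg; rewrite /Ex RintegralD//; exact: bm_integrable. Qed.

Lemma ExB f g : bm f -> bm g -> Ex (fun w => f w - g w) = Ex f - Ex g.
Proof. by move=> bf bg; rewrite /Ex RintegralB//; exact: bm_integrable. Qed.

Lemma ExZ (c : R) f : bm f -> Ex (fun w => c * f w) = c * Ex f.
Proof. by move=> bf; rewrite /Ex RintegralZl//; exact: bm_integrable. Qed.

Lemma Ex_le f g : bm f -> bm g -> (forall w, f w <= g w) -> Ex f <= Ex g.
Proof.
by move=> bf bg fg; apply: le_Rintegral => //; exact: bm_integrable.
Qed.

Lemma Ex_ge0 f : (forall w, 0 <= f w) -> 0 <= Ex f.
Proof. by move=> f0; apply: Rintegral_ge0 => w _. Qed.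

Lemma Ex_norm f : bm f -> `|Ex f| <= Ex (fun w => `|f w|).
Proof. by move=> bf; apply: le_normr_Rintegral => //; exact: bm_integrable. Qed.

Lemma Ex_sum (I : Type) (s : seq I) (Q : pred I) (F : I -> T -> R) :
  (forall i, bm (F i)) ->
  Ex (fun w => \sum_(i <- s | Q i) F i w) = \sum_(i <- s | Q i) Ex (F i).
Proof.
move=> bF; elim: s => [|i s ih].
  by under eq_fun do rewrite big_nil; rewrite big_nil Ex_cst.
under eq_fun do rewrite big_cons; rewrite big_cons; case: (Q i) => //.
rewrite ExD ?ih//; exact: bm_sum.
Qed.

Lemma Ex_indic A : measurable A -> Ex (\1_A) = fine (P A).
Proof. by move=> mA; rewrite /Ex /Rintegral integral_indic// setIT. Qed.

Lemma ExE f : bm f -> (Ex f)%:E = (\int[P]_w (f w)%:E)%E.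
Proof.
move=> bf; rewrite /Ex /Rintegral fineK//.
by apply: integrable_fin_num => //; exact: bm_integrable.
Qed.

Lemma Ex_markov f A (c : R) : bm f -> (forall w, 0 <= f w) -> measurable A ->
  (forall w, A w -> c <= f w) -> 0 < c -> fine (P A) <= Ex f / c.
Proof.
move=> bf f0 mA Af c0; rewrite ler_pdivlMr// mulrC -Ex_indic// -ExZ; last exact: bm_indic.
apply: Ex_le => //; first by apply: bmZ; exact: bm_indic.
move=> w; rewrite indicE; case: (boolP (w \in A)) => [|_].
  by rewrite inE mulr1; exact: Af.
by rewrite mulr0.
Qed.

End bounded_expectation.
Arguments bm {d T R}.

(** * Independence of functions of disjoint families *)

Section independence.
Context {d : measure_display} {T : measurableType d} {R : realType}.
Variable P : probability T R.

Definition indep2 (U V : T -> R) : Prop := forall A B : set R,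
  measurable A -> measurable B ->
  P (U @^-1` A `&` V @^-1` B) = (P (U @^-1` A) * P (V @^-1` B))%E.

Section fubini.
Variables (U V : T -> R).
Hypotheses (mU : measurable_fun setT U) (mV : measurable_fun setT V).
Hypothesis UV : indep2 U V.

#[local] HB.instance Definition _ := isMeasurableFun.Build _ _ _ _ U mU.
#[local] HB.instance Definition _ := isMeasurableFun.Build _ _ _ _ V mV.

Let W (w : T) : R * R := (U w, V w).
Let mW : measurable_fun setT W. Proof. exact: measurable_fun_pair. Qed.
#[local] HB.instance Definition _ := isMeasurableFun.Build _ _ _ _ W mW.

Let dU := distribution P (U : {RV P >-> R}).
Let dV := distribution P (V : {RV P >-> R}).

Let indep2_ge0 (f : R * R -> R) : measurable_fun setT f -> (forall z, 0 <= f z) ->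
  (\int[P]_w (f (U w, V w))%:E =
   \int[P]_w \int[P]_w' (f (U w, V w'))%:E)%E /\
  @measurable_fun _ _ T (\bar R) setT (fun w => \int[P]_w' (f (U w, V w'))%:E)%E.
Proof.
move=> mf f0.
have mf' : measurable_fun setT (EFin \o f) by exact/measurable_EFinP.
have f0' z : (0 <= (EFin \o f) z)%E by rewrite lee_fin.
have e1 : (\int[P]_w (f (U w, V w))%:E = \int[dU \x dV]_z (f z)%:E)%E.
  transitivity (\int[distribution P (W : {RV P >-> _})]_z (f z)%:E)%E.
    by rewrite ge0_integral_distribution.
  apply: eq_measure_integral => A mA _.
  by apply/esym/product_measure_unique => // A' B' mA' mB'; exact: UV.
have e2 x : (\int[dV]_y (f (x, y))%:E = \int[P]_w' (f (x, V w'))%:E)%E.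
  rewrite (ge0_integral_distribution (V : {RV P >-> R}) (f := fun y => (f (x, y))%:E))//.
    by apply/measurable_EFinP; apply: measurableT_comp => //; exact: pair1_measurable.
  by move=> y; rewrite lee_fin.
have mF : measurable_fun setT (fubini_F dV (EFin \o f)).
  exact: measurable_fun_fubini_tonelli_F.
have mG : @measurable_fun _ _ R (\bar R) setT (fun x => \int[P]_w' (f (x, V w'))%:E)%E.
  by apply: eq_measurable_fun mF => x _; rewrite /fubini_F -e2.
split; last exact: (measurableT_comp mG mU).
rewrite e1 fubini_tonelli1//.
rewrite -(ge0_integral_distribution (U : {RV P >-> R})
  (f := fun x => (\int[P]_w' (f (x, V w'))%:E)%E))//.
- by apply: eq_integral => x _; rewrite /fubini_F -e2.
- by move=> x; apply: integral_ge0 => w _; rewrite lee_fin.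
Qed.

(** By independence the law of (U, V) is the product of the two laws, and Tonelli gives the iterated
    expectation. The upper bound is asked only on the range of (U, V), since the functions used
    later are not bounded on the plane. *)
Lemma indep2_Ex (f : R * R -> R) (M : R) : measurable_fun setT f ->
  (forall z, 0 <= f z) -> (forall w w', f (U w, V w') <= M) ->
  bm (fun w => Ex P (fun w' => f (U w, V w'))) /\
  Ex P (fun w => f (U w, V w)) = Ex P (fun w => Ex P (fun w' => f (U w, V w'))).
Proof.
move=> mf f0 fM.
have b1 w : bm (fun w' => f (U w, V w')).
  split; last by exists M => w'; rewrite ger0_norm.
  by apply: measurableT_comp => //; exact: measurable_fun_pair.
have b2 : bm (fun w => f (U w, V w)).
  split; last by exists M => w; rewrite ger0_norm.
  exact: measurableT_comp mW.
have [e m] := indep2_ge0 mf f0.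
have b3 : bm (fun w => Ex P (fun w' => f (U w, V w'))).
  split.
    by apply/measurable_EFinP; apply: eq_measurable_fun m => w _ /=; rewrite ExE.
  exists M => w; rewrite ger0_norm; last exact: Ex_ge0.
  by rewrite -[leRHS](Ex_cst P); apply: Ex_le => //; exact: bm_cst.
split => //; apply: EFin_inj; rewrite !ExE// e.
by apply: eq_integral => w _; rewrite ExE.
Qed.

End fubini.

Section grouping.
Variables (I : finType) (X : I -> {RV P >-> R}).
Hypothesis ind : mutually_independent X.

(* A pi-system generating the sigma-algebra of the X a, a in J. *)
Definition cyl (J : {set I}) : set (set T) :=
  [set A | exists2 B : I -> set R, (forall a, measurable (B a)) &
     A = \bigcap_(a in [set` J]) X a @^-1` B a].

Lemma cyl_measurable J : cyl J `<=` measurable.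
Proof.
move=> _ [B mB ->]; apply: fin_bigcap_measurable.
  exact: finite_finset.
by move=> a _; exact: measurable_funPTI.
Qed.

Lemma cylI J : setI_closed (cyl J).
Proof.
move=> _ _ [B mB ->] [C mC ->]; exists (fun a => B a `&` C a).
  by move=> a; exact: measurableI.
by rewrite -bigcapI.
Qed.

Lemma cylT J : cyl J setT.
Proof.
by exists (fun=> setT) => //; apply/seteqP; split.
Qed.

Lemma cyl_indep (J1 J2 : {set I}) A B : (forall a, a \in J1 -> a \notin J2) -> cyl J1 A ->
  cyl J2 B -> P (A `&` B) = (P A * P B)%E.
Proof.
move=> J12 [B1 mB1 ->] [B2 mB2 ->].
pose B' a := if a \in J1 then B1 a else B2 a.
have mB' a : measurable (B' a) by rewrite /B'; case: ifP.
have J2' a : a \in J2 -> (a \in J1) = false.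
  by move=> aJ2; apply/negbTE; apply: contraL aJ2; exact: J12.
rewrite (_ : _ `&` _ = \bigcap_(a in [set` (J1 :|: J2)%SET]) X a @^-1` B' a).
  rewrite !ind// big_mkcond/= (bigID (mem J1))/=; congr (_ * _)%E.
    rewrite [LHS]big_mkcond [RHS]big_mkcond/=; apply: eq_bigr => a _.
    by rewrite inE /B'; case: (a \in J1).
  rewrite [LHS]big_mkcond [RHS]big_mkcond/=; apply: eq_bigr => a _.
  rewrite inE /B'; have [aJ2|aJ2] := boolP (a \in J2); first by rewrite J2'.
  by case: (a \in J1).
apply/seteqP; split=> [w [h1 h2] a /=|w h].
  rewrite inE /B' => /orP[aJ|aJ]; first by rewrite aJ; exact: h1.
  by rewrite J2'//; exact: h2.
split=> a /= aJ.
  by have := h a; rewrite /= inE aJ /B' => /(_ isT); rewrite aJ.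
by have := h a; rewrite /= inE aJ orbT /B' => /(_ isT); rewrite J2'.
Qed.

Lemma sub_sigma_cyl_measurable J : <<s cyl J >> `<=` measurable.
Proof. by apply: smallest_sub => //; [exact: sigma_algebra_measurable|exact: cyl_measurable]. Qed.

(** For fixed B both sides are finite measures in A; agreeing on the pi-system [cyl J], they agree
    on the sigma-algebra it generates. *)
Let ext (J : {set I}) (B : set T) : measurable B ->
  (forall A, cyl J A -> P (A `&` B) = (P A * P B)%E) ->
  forall A, <<s cyl J >> A -> P (A `&` B) = (P A * P B)%E.
Proof.
move=> mB h A sA.
have r0 : 0 <= fine (P B) by rewrite fine_ge0.
have ms A' : mscale (NngNum r0) P A' = (P A' * P B)%E.
  by rewrite /mscale/= fineK ?fin_num_measure// muleC.
have := @g_sigma_algebra_measure_unique _ R T (cyl J) (@cyl_measurable J)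
  (fun=> setT) (fun=> @cylT J) _ (mrestr P mB) (mscale (NngNum r0) P) (@cylI J) _ _ A sA.
move=> e; transitivity (mscale (NngNum r0) P A).
  apply: e.
  - by rewrite bigcup_const.
  - by move=> A' hA'; exact: etrans (h _ hA') (esym (ms _)).
  - move=> _; change (P (setT `&` B) < +oo)%E.
    by rewrite setTI (le_lt_trans (probability_le1 _ _)) ?ltry.
exact: ms.
Qed.

Lemma sigma_cyl_indep (J1 J2 : {set I}) A B : (forall a, a \in J1 -> a \notin J2) ->
  <<s cyl J1 >> A -> <<s cyl J2 >> B -> P (A `&` B) = (P A * P B)%E.
Proof.
move=> J12 sA sB; apply: ext sA; first exact: sub_sigma_cyl_measurable sB.
move=> A' cA'; rewrite setIC muleC; apply: ext sB => //.
  exact: cyl_measurable cA'.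
by move=> B' cB'; rewrite setIC muleC; exact: cyl_indep cA' cB'.
Qed.

Definition smeas (J : {set I}) (U : T -> R) : Prop :=
  @measurable_fun _ _ (g_sigma_algebraType (cyl J)) R setT U.

Lemma smeas_X (J : {set I}) a : a \in J -> smeas J (X a).
Proof.
move=> aJ _ B mB; rewrite setTI; apply: sub_sigma_algebra.
exists (fun b => if b == a then B else setT); first by move=> b; case: ifP.
apply/seteqP; split=> [w Bw b _ /=|w /(_ a)/=]; first by case: eqP => // ->.
by rewrite eqxx; exact.
Qed.

Lemma smeas_fX (J : {set I}) a (g : R -> R) : measurable_fun setT g -> a \in J ->
  smeas J (fun w => g (X a w)).
Proof. by move=> mg aJ; exact: (measurableT_comp mg (smeas_X aJ)). Qed.

Lemma smeas_cst (J : {set I}) (c : R) : smeas J (cst c).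
Proof. exact: measurable_cst. Qed.

Lemma smeas_sum (J : {set I}) (s : seq I) (F : I -> T -> R) :
  (forall a, a \in s -> smeas J (F a)) -> smeas J (fun w => \sum_(a <- s) F a w).
Proof.
elim: s => [|a s ih] h.
  by under eq_fun do rewrite big_nil; exact: smeas_cst.
under eq_fun do rewrite big_cons.
apply: measurable_funD; first by apply: h; rewrite mem_head.
by apply: ih => b bs; apply: h; rewrite inE bs orbT.
Qed.

Lemma smeas_indep2 (J1 J2 : {set I}) U V : (forall a, a \in J1 -> a \notin J2) ->
  smeas J1 U -> smeas J2 V -> indep2 U V.
Proof.
move=> J12 mU mV A B mA mB; apply: (sigma_cyl_indep J12).
  by have := mU measurableT A mA; rewrite setTI.
by have := mV measurableT B mB; rewrite setTI.
Qed.

End grouping.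
End independence.

Local Opaque QQ.

(** * Lindeberg replacement *)

Section heat_measurable.
Context {R : realType}.
Implicit Types v x : R.

Lemma G_ge0 v x : 0 <= G v x. Proof. exact: Phi_ge0. Qed.
Lemma G_le1 v x : G v x <= 1. Proof. exact: Phi_le1. Qed.

Lemma measurable_G v : measurable_fun setT (G v).
Proof.
apply: continuous_measurable_fun => x; have ? := G_derive_x v x.
by apply/differentiable_continuous/derivable1_diffP.
Qed.

End heat_measurable.

(** The arithmetic of one replacement: a is the mean of G (v, x + xi), a1 and m are the first two
    moments of xi, and g' is the heat flow advanced by time s. *)
Lemma taylor_combine (R : realType) (a a1 m s g g' g1 g2 A B B' : R) :
  `|a - (g + g1 * a1 + 2^-1 * g2 * m)| <= A ->
  `|g' - (g + 2^-1 * g2 * s)| <= B' -> B' <= B ->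
  `|g1 * a1| <= B -> `|g2 * (m - s)| <= B -> `|a - g'| <= A + 3 * B.
Proof.
rewrite !ler_norml => /andP[? ?] /andP[? ?] ? /andP[? ?] /andP[? ?].
by apply/andP; split; lra.
Qed.

Lemma cube_combine (R : realType) (L E1 : R) : 0 <= L -> 0 <= E1 ->
  L + L ^+ 2 / 2 + E1 * L ^+ 3 <= (1 + E1) * (1 + L) ^+ 3.
Proof.
move=> L0 E0.
have h1 : 0 <= E1 * L by exact: mulr_ge0.
have h2 : 0 <= E1 * L ^+ 2 by rewrite mulr_ge0 ?exprn_ge0.
have h3 : 0 <= L ^+ 2 by rewrite exprn_ge0.
have h4 : 0 <= L ^+ 3 by rewrite exprn_ge0.
rewrite (_ : (1 + E1) * _ = 1 + 3 * L + 3 * L ^+ 2 + L ^+ 3 +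
  E1 + 3 * (E1 * L) + 3 * (E1 * L ^+ 2) + E1 * L ^+ 3); last by ring.
lra.
Qed.

Section single_variable.
Context {d : measure_display} {T : measurableType d} {R : realType}.
Variable P : probability T R.
Variables (xi : T -> R) (b e s l : R).
Hypotheses (bxi : bm xi) (xib : forall w, `|xi w| <= b) (lb : `|l| * b <= 1).
Hypotheses (e1 : `|Ex P xi| <= e) (e2 : `|Ex P (fun w => xi w ^+ 2) - s| <= e).
Hypotheses (e3 : b * Ex P (fun w => xi w ^+ 2) <= e).
Hypotheses (e4 : s ^+ 2 <= e) (s0 : 0 <= s).

Definition cS : R := expR 1 + 3.

Lemma bm_G v x : bm (fun w => G v (x + xi w)).
Proof.
split; last by exists 1 => w; rewrite ger0_norm ?G_ge0 ?G_le1.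
apply: (measurableT_comp (measurable_G v)).
by apply: measurable_funD => //; exact: bm_meas.
Qed.

Let b0 : 0 <= b.
Proof.
rewrite -(Ex_cst P b); apply: (@le_trans _ _ (Ex P (fun w => `|xi w|))).
  exact: Ex_ge0.
by apply: Ex_le => //; [exact: bm_norm|exact: bm_cst].
Qed.
Let m2 := Ex P (fun w => xi w ^+ 2).
Let e0 : 0 <= e. Proof. exact: le_trans e1. Qed.
Let bxi2 : bm (fun w => xi w ^+ 2). Proof. exact: bmX. Qed.

Let third (c : R) : 0 <= c -> Ex P (fun w => c * `|xi w| ^+ 3) <= c * e.
Proof.
move=> c0; have b3 : bm (fun w => `|xi w| ^+ 3) by apply: bmX; exact: bm_norm.
rewrite ExZ// ler_wpM2l//; apply: le_trans e3.
rewrite -ExZ//; apply: Ex_le => //; first exact: bmZ.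
by move=> w; rewrite exprS real_normK ?num_real// ler_wpM2r ?sqr_ge0.
Qed.

(** Adding xi and running the heat flow for time s agree to leading order, because the derivative of
    G in v is half its second derivative in x. What remains is the third-order remainder, giving the
    e = exp 1 of [cS], and three errors from the mean, the variance and s^2, giving its 3. *)
Lemma step_bound (v x K : R) : 0 < v -> v + s <= 2 -> 1 <= K -> isq v <= K ->
  `|Ex P (fun w => G v (x + xi w)) - G (v + s) x| <=
    cS * QQ l K * e * EE l (v + s) x.
Proof.
move=> v0 vs K1 kK; have s0' := s0.
have v2 : 0 < v <= 2 by lra.
have K0 : 0 <= K by lra.
have vvs : v <= v + s by lra.
set Q := QQ l K; set D := EE l (v + s) x.
have Q0 : 0 <= Q by exact: QQ_ge0.
have D0 : 0 <= D by exact/ltW/EE_gt0.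
have QD0 : 0 <= Q * D by exact: mulr_ge0.
have Dv : Q * EE l v x <= Q * D by rewrite ler_wpM2l// EE_lev.
have g1 : `|G1 v x| <= Q * D by exact: le_trans (G1_bound l x v2 K1 kK) Dv.
have g2 : `|G2 v x| <= Q * D by exact: le_trans (G2_bound l x v2 K1 kK) Dv.
have bp : bm (fun w => G v x + G1 v x * xi w + 2^-1 * G2 v x * xi w ^+ 2).
  by apply: bmD; [apply: bmD; [exact: bm_cst|exact: bmZ]|exact: bmZ].
have ep : Ex P (fun w => G v x + G1 v x * xi w + 2^-1 * G2 v x * xi w ^+ 2) =
    G v x + G1 v x * Ex P xi + 2^-1 * G2 v x * m2.
  rewrite ExD; [|by apply: bmD; [exact: bm_cst|exact: bmZ]|exact: bmZ].
  by rewrite ExD; [rewrite Ex_cst !ExZ|exact: bm_cst|exact: bmZ].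
have h1 : `|Ex P (fun w => G v (x + xi w)) -
    (G v x + G1 v x * Ex P xi + 2^-1 * G2 v x * m2)| <= expR 1 * (Q * D) * e.
  rewrite -ep -ExB//; last exact: bm_G.
  have bd : bm (fun w => G v (x + xi w) -
     (G v x + G1 v x * xi w + 2^-1 * G2 v x * xi w ^+ 2)).
    by apply: bmB => //; exact: bm_G.
  apply: le_trans (Ex_norm P bd) _.
  apply: (@le_trans _ _ (Ex P (fun w => expR 1 * (Q * D) * `|xi w| ^+ 3))).
    apply: Ex_le; first exact: bm_norm.
      by apply: bmZ; apply: bmX; exact: bm_norm.
    move=> w; apply: le_trans (@G_taylor_x _ l v x K (xi w) v2 K1 kK _) _.
      by apply: le_trans lb; rewrite ler_wpM2l.
    by rewrite ler_wpM2r ?exprn_ge0// ler_wpM2l ?expR_ge0.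
  by apply: third; rewrite mulr_ge0 ?expR_ge0.
have h2 := @G_taylor_v _ l v x K s v0 s0 vs K1 kK.
rewrite -/Q -/D in h2.
have h2' : Q * D * s ^+ 2 <= Q * D * e by rewrite ler_wpM2l.
have h3 : `|G1 v x * Ex P xi| <= Q * D * e by rewrite normrM ler_pM.
have h4 : `|G2 v x * (m2 - s)| <= Q * D * e by rewrite normrM ler_pM.
rewrite (_ : cS * Q * e * D = expR 1 * (Q * D) * e + 3 * (Q * D * e));
  last by rewrite /cS; ring.
exact: taylor_combine h1 h2 h2' h3 h4.
Qed.

Definition cE : R := 1 + expR 1.

(** A second-order expansion of exp at 0 followed by 1 + z <= exp z. It controls the mean of the
    weight [EE] when its argument is shifted by xi. *)
Lemma mgf_bound :
  Ex P (fun w => expR (l * xi w)) <=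
    expR (l ^+ 2 * s / 2 + cE * (1 + `|l|) ^+ 3 * e).
Proof.
have bl : bm (fun w => expR (l * xi w)) by apply: bm_expR; exact: bmZ.
pose c := expR 1 * `|l| ^+ 3 : R.
have c0 : 0 <= c by rewrite mulr_ge0 ?expR_ge0 ?exprn_ge0.
have h w : expR (l * xi w) <=
    (1 + l * xi w + l ^+ 2 / 2 * xi w ^+ 2) + c * `|xi w| ^+ 3.
  have z1 : `|l * xi w| <= 1.
    by rewrite normrM; apply: le_trans lb; rewrite ler_wpM2l.
  have := @taylor2_bound R expR expR expR expR 0 (l * xi w) (expR 1).
  rewrite expR0 subr0.
  have hb z : `|z - 0| <= `|l * xi w| -> `|expR z| <= expR 1.
    rewrite subr0 => zl; rewrite ger0_norm ?expR_ge0// ler_expR.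
    by apply: le_trans (ler_norm _) _; exact: le_trans zl z1.
  move=> /(_ (fun z _ => is_derive_expR z) (fun z _ => is_derive_expR z)
    (fun z _ => is_derive_expR z) hb).
  rewrite normrM exprMn mulrA -/c => /ler_normlP[_].
  rewrite exprMn /c; lra.
have bb : bm (fun w => 1 + l * xi w + l ^+ 2 / 2 * xi w ^+ 2).
  by apply: bmD; [apply: bmD; [exact: bm_cst|exact: bmZ]|exact: bmZ].
have b3 : bm (fun w => c * `|xi w| ^+ 3).
  by apply: bmZ; apply: bmX; exact: bm_norm.
apply: le_trans (Ex_le P bl _ h) _; first exact: bmD.
have b3' : bm (fun w => `|xi w| ^+ 3) by apply: bmX; exact: bm_norm.
have -> : Ex P (fun w => 1 + l * xi w + l ^+ 2 / 2 * xi w ^+ 2 +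
    c * `|xi w| ^+ 3) = 1 + l * Ex P xi + l ^+ 2 / 2 * m2 +
    c * Ex P (fun w => `|xi w| ^+ 3).
  rewrite ExD// ExD; [|by apply: bmD; [exact: bm_cst|exact: bmZ]|exact: bmZ].
  rewrite ExD; [|exact: bm_cst|exact: bmZ].
  by rewrite (Ex_cst P 1) (ExZ P l bxi) (ExZ P _ bxi2) (ExZ P c b3'). apply: le_trans (expR_ge1Dx _).
have t3 := third c0; rewrite ExZ// in t3.
have l0 := normr_ge0 l.
have h1 : l * Ex P xi <= `|l| * e.
  by apply: le_trans (ler_norm _) _; rewrite normrM ler_wpM2l.
have h2 : l ^+ 2 * (m2 - s) <= l ^+ 2 * e.
  by rewrite ler_wpM2l ?sqr_ge0//; exact: le_trans (ler_norm _) e2.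
have h3 : (`|l| + `|l| ^+ 2 / 2 + c) * e <= cE * (1 + `|l|) ^+ 3 * e.
  by rewrite ler_wpM2r// /cE /c; exact: cube_combine (expR_ge0 _).
move: h3; rewrite real_normK ?num_real//; lra.
Qed.

End single_variable.

Section sums.
Context {d : measure_display} {T : measurableType d} {R : realType}.
Variable P : probability T R.
Variables (I : finType) (X : I -> {RV P >-> R}).
Hypothesis ind : mutually_independent X.
Variables (f : I -> R -> R) (b : R).
Hypothesis mf : forall a, measurable_fun setT (f a).
Hypothesis fb : forall a y, `|f a y| <= b.

Definition SX (s : seq I) (w : T) : R := \sum_(a <- s) f a (X a w).

Lemma bm_fX a : bm (fun w => f a (X a w)).
Proof. by split; [exact: measurableT_comp|exists b => w]. Qed.

Lemma bm_SX s : bm (SX s).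
Proof. by apply: bm_sum => a; exact: bm_fX. Qed.

Lemma indep_cons a s : a \notin s -> indep2 P (fun w => f a (X a w)) (SX s).
Proof.
move=> aNs; apply: (@smeas_indep2 _ _ _ _ _ _ ind [set a]%SET [set x in s]%SET).
- by move=> x /set1P ->; rewrite inE.
- by apply: smeas_fX => //; rewrite inE.
- by apply: smeas_sum => x xs; apply: smeas_fX => //; rewrite inE.
Qed.

Lemma SX_cons a s w : SX (a :: s) w = f a (X a w) + SX s w.
Proof. by rewrite /SX big_cons. Qed.

Lemma SX_bound s : exists M, forall w, `|SX s w| <= M.
Proof. by have [] := bm_SX s. Qed.

Lemma mgf_prod (eta : I -> R) (s : seq I) : uniq s ->
  (forall a, a \in s -> Ex P (fun w => expR (f a (X a w))) <= expR (eta a)) ->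
  Ex P (fun w => expR (SX s w)) <= expR (\sum_(a <- s) eta a).
Proof.
elim: s => [|a s ih] /=.
  move=> _ _; rewrite big_nil expR0.
  by under [in leLHS]eq_fun do rewrite /SX big_nil expR0; rewrite Ex_cst.
move=> /andP[aNs us] h; rewrite big_cons.
under [in leLHS]eq_fun do rewrite SX_cons.
have [M sM] := SX_bound s.
have [] := @indep2_Ex _ _ _ P _ _ (bm_meas (bm_fX a)) (bm_meas (bm_SX s))
  (indep_cons aNs) (fun z => expR (z.1 + z.2)) (expR (b + M)).
- by apply: measurableT_comp => //; exact: measurable_funD.
- by move=> z; exact: expR_ge0.
- move=> w w' /=; rewrite ler_expR lerD//.
    exact: le_trans (ler_norm _) (fb _ _).
  exact: le_trans (ler_norm _) (sM _).
move=> /= _ ->.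
under [in leLHS]eq_fun => w.
  under eq_fun do rewrite expRD.
  rewrite ExZ; last by apply: bm_expR; exact: bm_SX.
  over.
under [in leLHS]eq_fun do rewrite mulrC.
rewrite ExZ; last by apply: bm_expR; exact: bm_fX.
rewrite addrC expRD ler_pM ?Ex_ge0//.
- by apply: ih => // x xs; apply: h; rewrite inE xs orbT.
- by apply: h; rewrite mem_head.
Qed.

Section lindeberg.
Variables (e sg : I -> R) (l K : R).
Hypotheses (lb : `|l| * b <= 1) (K1 : 1 <= K).
Hypotheses (e1 : forall a, `|Ex P (fun w => f a (X a w))| <= e a).
Hypotheses (e2 : forall a, `|Ex P (fun w => f a (X a w) ^+ 2) - sg a| <= e a).
Hypotheses (e3 : forall a, b * Ex P (fun w => f a (X a w) ^+ 2) <= e a).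
Hypotheses (e4 : forall a, sg a ^+ 2 <= e a) (s0 : forall a, 0 <= sg a).

(** Induction on [s]. Conditionally on the first variable the induction hypothesis applies at the
    shifted point, where its bound [A] is merely multiplied by exp (l xi). The mean of that factor
    is given by [mgf_bound]: its part l^2 sg/2 advances the weight [EE] in v by the variance of xi,
    and the rest enters the exponential of the errors. [step_bound] then replaces the first variable
    itself. *)
Lemma lindeberg (s : seq I) (v x : R) : uniq s -> 0 < v -> isq v <= K ->
  v + \sum_(a <- s) sg a <= 2 ->
  `|Ex P (fun w => G v (x + SX s w)) - G (v + \sum_(a <- s) sg a) x| <=
   cS * QQ l K * (\sum_(a <- s) e a) *
   expR (cE * (1 + `|l|) ^+ 3 * \sum_(a <- s) e a) *
   EE l (v + \sum_(a <- s) sg a) x.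
Proof.
move=> us v0 kK.
have e0 a : 0 <= e a by exact: le_trans (e1 a).
have Q0 : 0 <= cS * QQ l K.
  have K0 : 0 <= K by exact: le_trans K1.
  by apply: mulr_ge0; [rewrite addr_ge0 ?expR_ge0|exact: QQ_ge0].
elim: s us x => [|a s ih] /=.
  move=> _ x _; rewrite !big_nil !addr0 mulr0 mul0r mul0r.
  under eq_fun do rewrite /SX big_nil addr0.
  by rewrite Ex_cst subrr normr0.
move=> /andP[aNs us] x; rewrite !big_cons.
set V := \sum_(j <- s) sg j; set E := \sum_(j <- s) e j => V2.
have V0 : 0 <= V by exact: sumr_ge0.
have E0 : 0 <= E by exact: sumr_ge0.
have sa := s0 a.
have vV2 : v + V <= 2 by lra.
have vV0 : 0 < v + V by lra.
have kV : isq (v + V) <= K by apply: le_trans kK; apply: isq_le => //; lra.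
under eq_fun do rewrite SX_cons addrA.
pose A (y : R) := cS * QQ l K * E * expR (cE * (1 + `|l|) ^+ 3 * E) *
  EE l (v + V) y.
have AS y z : A (y + z) = A y * expR (l * z).
  have -> : A (y + z) = cS * QQ l K * E * expR (cE * (1 + `|l|) ^+ 3 * E) *
    EE l (v + V) (y + z) by [].
  have -> : EE l (v + V) (y + z) = EE l (v + V) y * expR (l * z).
    by rewrite /EE -expRD; congr expR; ring.
  by rewrite mulrA.
have A0 y : 0 <= A y.
  apply: mulr_ge0; last exact: expR_ge0.
  by apply: mulr_ge0; [exact: mulr_ge0|exact: expR_ge0].
have [] := @indep2_Ex _ _ _ P _ _ (bm_meas (bm_fX a)) (bm_meas (bm_SX s))
  (indep_cons aNs) (fun z => G v (x + z.1 + z.2)) 1.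
- apply: (measurableT_comp (measurable_G v)).
  by apply: measurable_funD => //; exact: measurable_funD.
- by move=> z; exact: G_ge0.
- by move=> w w'; exact: G_le1.
move=> /= bI ->.
have bG := @bm_G _ _ _ _ (bm_fX a) (v + V) x.
have h1 : `|Ex P (fun w => Ex P (fun w' => G v (x + f a (X a w) + SX s w'))) -
    Ex P (fun w => G (v + V) (x + f a (X a w)))| <=
    A x * expR (l ^+ 2 * sg a / 2 + cE * (1 + `|l|) ^+ 3 * e a).
  rewrite -ExB//; apply: le_trans (Ex_norm P (bmB bI bG)) _.
  apply: (@le_trans _ _ (Ex P (fun w => A x * expR (l * f a (X a w))))).
    apply: Ex_le; first by apply: bm_norm; exact: bmB.
      by apply: bmZ; apply: bm_expR; apply: bmZ; exact: bm_fX.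
    by move=> w; rewrite -AS; exact: ih.
  rewrite ExZ; last by apply: bm_expR; apply: bmZ; exact: bm_fX.
  rewrite ler_wpM2l//.
  exact: (mgf_bound (bm_fX a) (fun w => fb a (X a w)) lb (e1 a) (e2 a) (e3 a)).
have h2 := @step_bound _ _ _ P _ b (e a) (sg a) l (bm_fX a)
  (fun w => fb a (X a w)) lb (e1 a) (e2 a) (e3 a) (e4 a) (s0 a) (v + V) x K
  vV0 _ K1 kV.
have {}h2 := h2 ltac:(lra).
have h3 : A x * expR (l ^+ 2 * sg a / 2 + cE * (1 + `|l|) ^+ 3 * e a) =
    cS * QQ l K * E * expR (cE * (1 + `|l|) ^+ 3 * (e a + E)) *
    EE l (v + V + sg a) x.
  transitivity (cS * QQ l K * E * (expR (cE * (1 + `|l|) ^+ 3 * E) *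
    EE l (v + V) x * expR (l ^+ 2 * sg a / 2 + cE * (1 + `|l|) ^+ 3 * e a))).
    by rewrite /A !mulrA.
  by rewrite -[RHS]mulrA; congr (_ * _); rewrite /EE -!expRD; congr expR; field.
(* The error of the new step is enlarged by an exponential factor at least 1, to give it the same
   shape as the inherited one. *)
have h4 : cS * QQ l K * e a * EE l (v + V + sg a) x <=
  cS * QQ l K * e a * expR (cE * (1 + `|l|) ^+ 3 * (e a + E)) * EE l (v + V + sg a) x.
  apply: ler_wpM2r; first exact: expR_ge0.
  apply: ler_peMr; first exact: mulr_ge0.
  have : 0 <= cE * (1 + `|l|) ^+ 3 * (e a + E).
    by rewrite mulr_ge0 ?addr_ge0// mulr_ge0 ?exprn_ge0 ?addr_ge0 ?expR_ge0.
  by rewrite -ler_expR expR0.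
rewrite (addrC (sg a)) addrA.
rewrite (_ : cS * QQ l K * (e a + E) * _ * _ =
  cS * QQ l K * E * expR (cE * (1 + `|l|) ^+ 3 * (e a + E)) *
    EE l (v + V + sg a) x +
  cS * QQ l K * e a * expR (cE * (1 + `|l|) ^+ 3 * (e a + E)) *
    EE l (v + V + sg a) x); last by ring.
rewrite -h3; apply: le_trans (lerD h1 (le_trans h2 h4)).
by apply: le_trans (ler_normD _ _); rewrite addrA subrK.
Qed.

End lindeberg.
End sums.

Section isq_facts.
Context {R : realType}.
Implicit Types v h : R.

Lemma isq_sqr h : 0 < h -> isq (h ^+ 2) = h^-1.
Proof. by move=> h0; rewrite /isq sqrtr_sqr gtr0_norm. Qed.

Lemma isq1D_le1 v : 0 <= v -> isq (1 + v) <= 1.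
Proof.
move=> v0; rewrite -[leRHS]invr1 -[X in _ <= X^-1]sqrtr1.
by apply: isq_le => //; rewrite lerDl.
Qed.

Lemma isq1D_ge v : 0 <= v -> 1 - v <= isq (1 + v).
Proof.
move=> v0; have k1 := isq1D_le1 v0.
have k0 : 0 < isq (1 + v) by apply: isq_gt0; lra.
have k2 : isq (1 + v) ^+ 2 * (1 + v) = 1.
  by rewrite /isq exprVn sqr_sqrtr ?mulVf ?gt_eqF//; lra.
nra.
Qed.

End isq_facts.

Section arith.
Context {R : realType}.
Implicit Types t u iu E : R.

Lemma sqr_shift (t t1 u iu : R) : 4 <= u -> 0 < iu -> iu <= 4^-1 -> u * iu = 1 ->
  -1 <= t <= u -> `|t1 - t| <= 2 * iu ^+ 3 ->
  - t1 ^+ 2 / 2 + 2^-1 <= 1 + - t ^+ 2 / 2.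
Proof.
move=> u4 iu0 iu4 iuu tu; set z := iu ^+ 3; rewrite ler_norml => /andP[a1 a2].
have uz : u * z <= 16^-1.
  rewrite /z (_ : u * iu ^+ 3 = (u * iu) * iu ^+ 2); last by ring.
  by rewrite iuu mul1r; nra.
have z0 : 0 < z by rewrite exprn_gt0.
have h : - (2 * (u * z)) <= (t1 - t) * t.
  clear uz iuu iu4.
  have [tp|tp] := leP 0 t.
    apply: (@le_trans _ _ (- (2 * z) * t)); first by nra.
    by rewrite ler_wpM2r.
  apply: (@le_trans _ _ ((2 * z) * t)); first by nra.
  by rewrite ler_wnM2r// ltW.
have e : t1 ^+ 2 = t ^+ 2 + 2 * ((t1 - t) * t) + (t1 - t) ^+ 2 by ring.
have := sqr_ge0 (t1 - t); rewrite e; clear - uz h; lra.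
Qed.

Lemma pow_small u iu : 4 <= u -> 0 < iu -> iu <= 4^-1 -> u * iu = 1 ->
  (u * iu ^+ 4) ^+ 2 <= 4^-1.
Proof.
move=> u4 iu0 iu4 iuu.
have -> : u * iu ^+ 4 = (u * iu) * iu ^+ 3 by ring.
rewrite iuu mul1r -exprM.
have : iu ^+ 6 <= iu ^+ 1 by rewrite ler_wiXn2l//; lra.
rewrite expr1 /=; lra.
Qed.

(** The lower bracket subtracts barPhi (2 * u), which must be small relative to barPhi u; the upper
    one divides by 1 - barPhi (2 * u). In both cases exp (- 2 u^2) is split into two factors exp (-
    u^2), each at most u^(-2). *)
Lemma barPhi_2u u iu : 4 <= u -> 0 < iu -> iu <= 4^-1 -> u * iu = 1 ->
  barPhi (2 * u) <= CM * iu * barPhi u /\ barPhi (2 * u) <= iu / 2.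
Proof.
move=> u4 iu0 iu4 iuu.
have u2 : 0 <= 2 * u by lra.
have h1 := barPhi_le_exp u2.
have i2 : iu ^+ 2 * u ^+ 2 = 1 by rewrite -exprMn mulrC iuu expr1n.
have u20 : 0 < u ^+ 2 by rewrite exprn_gt0//; lra.
have ei : expR (- u ^+ 2) <= iu ^+ 2.
  have := @expR_ge1Dx R (u ^+ 2) => e1.
  have e2 : expR (- u ^+ 2) * expR (u ^+ 2) = 1 by rewrite -expRD addNr expR0.
  have e3 := expR_gt0 (- u ^+ 2).
  rewrite -(ler_pM2r u20) i2 -e2 ler_pM2l//; lra.
have e22 : expR (- (2 * u) ^+ 2 / 2) = expR (- u ^+ 2) * expR (- u ^+ 2).
  by rewrite -expRD; congr expR; field.
have eu1 : 0 <= expR (- u ^+ 2) by exact: expR_ge0.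
have i2' : iu ^+ 2 <= iu * 4^-1 by rewrite expr2 ler_wpM2l// ltW.
split.
  apply: (le_trans h1).
  apply: (@le_trans _ _ (iu ^+ 2 * expR (- u ^+ 2 / 2))).
    by rewrite e22 ler_pM// ler_expR; lra.
  have hu : -1 <= u <= u by lra.
  have h2 := @exp_le_barPhi _ u u ltac:(lra) hu.
  apply: (@le_trans _ _ (iu ^+ 2 * (CM * u * barPhi u))).
    by rewrite ler_wpM2l// exprn_ge0// ltW.
  have -> : iu ^+ 2 * (CM * u * barPhi u) = (u * iu) * (CM * iu * barPhi u) by ring.
  by rewrite iuu mul1r.
apply: (le_trans h1); rewrite e22.
apply: (@le_trans _ _ (iu ^+ 2 * iu ^+ 2)); first exact: ler_pM.
have : iu ^+ 2 * iu ^+ 2 <= iu ^+ 2 * 1 by rewrite ler_wpM2l ?exprn_ge0 ?(ltW iu0)//; lra.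
lra.
Qed.

(** One shift of 2 * iu^3 comes from bracketing the indicator; the tolerance of the same size allows
    for the variance 1 + h^2 in place of 1. *)
Lemma barPhi_shift_below t u iu s : 4 <= u -> 0 < iu -> iu <= 4^-1 -> u * iu = 1 ->
  -1 <= t <= u -> `|s - (t - 2 * iu ^+ 3)| <= 2 * iu ^+ 3 ->
  barPhi s <= (1 + 4 * C1 * iu ^+ 2) * barPhi t.
Proof.
move=> u4 iu0 iu4 iuu tu; rewrite ler_norml => /andP[s1 _].
have h1 : t - 4 * iu ^+ 3 <= s by lra.
apply: le_trans (barPhi_le h1) _.
have k0 : 0 <= 4 * iu ^+ 3 by rewrite mulr_ge0// exprn_ge0// ltW.
have ku : 4 * iu ^+ 3 * u = 4 * iu ^+ 2.
  have -> : 4 * iu ^+ 3 * u = 4 * iu ^+ 2 * (u * iu) by ring.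
  by rewrite iuu mulr1.
have ku1 : 4 * iu ^+ 3 * u <= 1 by rewrite ku; clear - iu0 iu4; nra.
have u1 : 1 <= u by lra.
have := barPhi_shift_le u1 tu k0 ku1.
have -> : 4 * C1 * iu ^+ 2 = C1 * (4 * iu ^+ 2) by ring.
by rewrite -ku -[C1 * u * _]mulrA (mulrC u).
Qed.

Lemma barPhi_shift_above t u iu s : 4 <= u -> 0 < iu -> iu <= 4^-1 -> u * iu = 1 ->
  -1 <= t <= u - 1 -> `|s - (t + 2 * iu ^+ 3)| <= 2 * iu ^+ 3 ->
  (1 - 4 * C1 * iu ^+ 2) * barPhi t <= barPhi s.
Proof.
move=> u4 iu0 iu4 iuu tu; rewrite ler_norml => /andP[_ s2].
have h1 : s <= t + 4 * iu ^+ 3 by lra.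
apply: le_trans (barPhi_le h1).
have k0 : 0 <= 4 * iu ^+ 3 by rewrite mulr_ge0// exprn_ge0// ltW.
have ku : 4 * iu ^+ 3 * u = 4 * iu ^+ 2.
  have -> : 4 * iu ^+ 3 * u = 4 * iu ^+ 2 * (u * iu) by ring.
  by rewrite iuu mulr1.
have ku1 : 4 * iu ^+ 3 * u <= 1 by rewrite ku; clear - iu0 iu4; nra.
have k1 : 4 * iu ^+ 3 <= 1.
  apply: le_trans ku1; rewrite ler_peMr//; lra.
have u1 : 1 <= u by lra.
have tk : -1 <= t + 4 * iu ^+ 3 <= u by clear - tu k0 k1; lra.
have := barPhi_shift_le u1 tk k0 ku1.
rewrite -[C1 * u * _]mulrA (mulrC u) ku addrK.
have h2 : barPhi (t + 4 * iu ^+ 3) <= barPhi t by apply: barPhi_le; lra.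
have c2 : 0 <= C1 * (4 * iu ^+ 2) :> R.
  by rewrite mulr_ge0 ?(ltW C1_gt0)// mulr_ge0// sqr_ge0.
have := ler_wpM2l c2 h2.
move: (barPhi _) (barPhi _) => x y; lra.
Qed.

Lemma sub_chain (y1 y2 y3 a b e p x z : R) : - e <= y1 - y2 -> y1 <= p + y3 ->
  a <= y2 -> e <= b -> y3 <= x -> x <= z -> a - b - z <= p.
Proof. by lra. Qed.

Lemma tail_arith (p B iu eta c1 cx cm : R) : 0 < B -> 0 <= p -> 0 < iu -> iu <= 4^-1 ->
  0 <= eta -> 0 <= c1 -> 0 <= cx -> 0 <= cm ->
  p * (1 - iu / 2) <= (1 + 4 * c1 * iu ^+ 2 + cx * eta) * B ->
  (1 - 4 * c1 * iu ^+ 2 - cx * eta - cm * iu) * B <= p ->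
  `|p - B| <= (1 + 8 * c1 + 2 * cx + cm) * (iu + eta) * B.
Proof.
move=> B0 p0 iu0 iu4 eta0 c10 cx0 cm0 up lo.
have i2' : iu ^+ 2 <= iu * 4^-1 by rewrite expr2 ler_wpM2l// ltW.
have i2 : c1 * iu ^+ 2 <= c1 * iu * 4^-1 by rewrite -mulrA ler_wpM2l.
have Ci : 0 <= c1 * iu by rewrite mulr_ge0// ltW.
have Me : 0 <= cm * iu by rewrite mulr_ge0// ltW.
have Ce : 0 <= cx * eta by rewrite mulr_ge0.
have Ci2 : 0 <= cx * iu by rewrite mulr_ge0// ltW.
have Ce2 : 0 <= c1 * eta by rewrite mulr_ge0.
have Me2 : 0 <= cm * eta by rewrite mulr_ge0.
rewrite ler_norml; apply/andP; split.
  suff : (1 - (1 + 8 * c1 + 2 * cx + cm) * (iu + eta)) * B <= p by lra.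
  apply: le_trans lo; rewrite ler_wpM2r ?(ltW B0)//; lra.
(* Division by 1 - iu/2 is replaced by multiplication by 1 + iu: their product is 1 + iu (1 - iu)/2
   >= 1. *)
have up2 : p <= (1 + iu) * ((1 + 4 * c1 * iu ^+ 2 + cx * eta) * B).
  apply: le_trans (ler_wpM2l _ up); last by lra.
  have : 0 <= p * (iu * (1 - iu)) by rewrite mulr_ge0// mulr_ge0//; lra.
  lra.
suff : p <= (1 + (1 + 8 * c1 + 2 * cx + cm) * (iu + eta)) * B by lra.
apply: (le_trans up2); rewrite mulrA ler_wpM2r ?(ltW B0)//.
have : cx * eta * iu <= cx * eta by rewrite ler_piMr//; lra.
have : c1 * iu ^+ 2 * iu <= c1 * iu ^+ 2.
  by rewrite ler_piMr//; [rewrite mulr_ge0 ?exprn_ge0// ltW|lra].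
lra.
Qed.

End arith.
Local Opaque cQ.

(** * From the heat flow to tail probabilities *)

Section tail.
Context {d : measure_display} {T : measurableType d} {R : realType}.
Variable P : probability T R.
Variables (I : finType) (X : I -> {RV P >-> R}).
Hypothesis ind : mutually_independent X.
Variables (f : I -> R -> R) (b : R).
Hypothesis mf : forall a, measurable_fun setT (f a).
Hypothesis fb : forall a y, `|f a y| <= b.

Definition SXT (w : T) : R := \sum_a f a (X a w).

Lemma bm_SXT : bm SXT. Proof. exact: (bm_SX X mf fb (index_enum I)). Qed.

Lemma measurable_SXT_ge (t : R) : measurable [set w | t <= SXT w].
Proof.
have := (bm_meas bm_SXT) measurableT `[t, +oo[%classic (measurable_itv _).
by rewrite setTI; congr (measurable _); apply/seteqP; split=> w /=;
  rewrite in_itv/= andbT.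
Qed.

Variables (e sg : I -> R) (u iu : R).
Hypotheses (e1 : forall a, `|Ex P (fun w => f a (X a w))| <= e a).
Hypotheses (e2 : forall a, `|Ex P (fun w => f a (X a w) ^+ 2) - sg a| <= e a).
Hypotheses (e3 : forall a, b * Ex P (fun w => f a (X a w) ^+ 2) <= e a).
Hypotheses (e4 : forall a, sg a ^+ 2 <= e a) (s0 : forall a, 0 <= sg a).
Hypothesis sg1 : \sum_a sg a = 1.
Hypotheses (u4 : 4 <= u) (ub : 2 * u * b <= 1).
Hypotheses (iu0 : 0 < iu) (iu4 : iu <= 4^-1) (iuu : u * iu = 1).
Let E := \sum_a e a.
Hypothesis uE : cE * 27 * u ^+ 3 * E <= 1.

(* The indicator of t <= S is bracketed, up to barPhi (2 * u), by G (h ^+ 2) (S - t')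
   with t' = t -/+ 2 * u * h. *)
Local Notation h := (iu ^+ 4).

Let u0 : 0 < u. Proof. exact: lt_le_trans u4. Qed.
Let h0 : 0 < h. Proof. by rewrite exprn_gt0. Qed.
Let hle : h <= 1.
Proof. have := iu4; have := iu0 => ? ?; rewrite exprn_ile1//; lra. Qed.
Let e0 a : 0 <= e a. Proof. exact: le_trans (e1 a). Qed.
Let E0 : 0 <= E. Proof. by apply: sumr_ge0. Qed.
Let invh : h^-1 = u ^+ 4.
Proof. by apply: (mulIf (lt0r_neq0 h0)); rewrite mulVf ?gt_eqF// -exprMn iuu expr1n. Qed.

(** The flow starts at variance h^2 and the sum contributes 1. With l = t1 at the point -t1 the
    exponent of the weight is - t1^2 + t1^2 (1 + h^2)/2, that is - t1^2/2 up to t1^2 h^2/2 <=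
    1/2. *)
Lemma lindeberg_barPhi t1 : `|t1| <= 2 * u ->
  `|Ex P (fun w => G (h ^+ 2) (SXT w - t1)) - barPhi (t1 * isq (1 + h ^+ 2))| <=
  cS * cQ * expR 1 * u ^+ 19 * E * expR (- t1 ^+ 2 / 2 + 2^-1).
Proof.
move=> t1u.
have u0' := u0; have u4' := u4; have iu0' := iu0; have iu4' := iu4; have iuu' := iuu.
have E0' := E0; have h0' := h0; have hle' := hle.
have lb : `|t1| * b <= 1.
  apply: le_trans ub.
  (* A negative b would leave no index at all, contradicting [sg1]. *)
  have [b0|b0] := leP 0 b; first by rewrite ler_wpM2r.
  have [a|/eq_card0 c0] := pickP (mem I).
    by have := le_lt_trans (fb a 0) b0; rewrite normr_lt0.
  exfalso; move: sg1; rewrite big_pred0//; last by move=> a; have := c0; rewrite /= => /card0_eq /(_ a).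
  by move=> /esym/eqP; rewrite oner_eq0.
have kK : isq (h ^+ 2) <= u ^+ 4.
  by rewrite isq_sqr// invh.
have u41 : 1 <= u ^+ 4 by rewrite exprn_ege1//; lra.
have h2 : 0 < h ^+ 2 by rewrite exprn_gt0.
have := @lindeberg _ _ _ P I X ind f b mf fb e sg t1 (u ^+ 4) lb u41 e1 e2 e3 e4
  s0 (index_enum I) (h ^+ 2) (- t1) (index_enum_uniq I) h2 kK.
rewrite sg1 -/E (addrC (h ^+ 2)) => /(_ _).
have -> : G (1 + h ^+ 2) (- t1) = barPhi (t1 * isq (1 + h ^+ 2)).
  by rewrite /G -barPhiN -mulNr opprK.
under eq_fun do rewrite addrC.
move=> /(_ ltac:(nra)) hL; apply: le_trans hL _.
rewrite -/E.
have q1 : QQ t1 (u ^+ 4) <= cQ * u ^+ 19 by apply: QQ_le => //; lra.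
have q2 : expR (cE * (1 + `|t1|) ^+ 3 * E) <= expR 1.
  rewrite ler_expR; apply: le_trans uE; rewrite ler_wpM2r// -mulrA ler_wpM2l//.
    by rewrite addr_ge0 ?expR_ge0.
  rewrite (_ : 27 * u ^+ 3 = (3 * u) ^+ 3); last by ring.
  by rewrite lerXn2r ?nnegrE ?addr_ge0//; lra.
have q3 : EE t1 (1 + h ^+ 2) (- t1) <= expR (- t1 ^+ 2 / 2 + 2^-1).
  rewrite /EE ler_expR.
  have : t1 ^+ 2 <= (2 * u) ^+ 2.
    by rewrite -[leLHS]real_normK ?num_real// lerXn2r ?nnegrE//; lra.
  have uh2 := pow_small u4 iu0 iu4 iuu; rewrite exprMn in uh2.
  have h20 : 0 <= h ^+ 2 by exact: ltW.
  move=> tt; have : t1 ^+ 2 * h ^+ 2 <= (2 * u) ^+ 2 * h ^+ 2 by rewrite ler_wpM2r.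
  by rewrite exprMn; lra.
have c0 : 0 <= cS :> R by rewrite addr_ge0 ?expR_ge0.
rewrite (_ : cS * cQ * expR 1 * u ^+ 19 * E =
  cS * (cQ * u ^+ 19) * E * expR 1); last by ring.
have Q0 : 0 <= QQ t1 (u ^+ 4) by apply: QQ_ge0; lra.
rewrite ler_pM ?expR_ge0//.
  by apply: mulr_ge0; [exact: mulr_ge0 (mulr_ge0 _ _) _|exact: expR_ge0].
apply: ler_pM => //; [exact: mulr_ge0 (mulr_ge0 _ _) _|].
by rewrite ler_wpM2r// ler_wpM2l.
Qed.

Definition Cx : R := cS * cQ * expR 1 * (expR 1 * CM).
Definition C0 : R := 1 + 8 * C1 + 2 * Cx + CM.

Lemma Cx_ge0 : 0 <= Cx.
Proof.
apply: mulr_ge0; last by apply: mulr_ge0; [exact: expR_ge0|exact: ltW CM_gt0].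
apply: mulr_ge0; last exact: expR_ge0.
by apply: mulr_ge0; [rewrite addr_ge0 ?expR_ge0|exact: cQ_ge0].
Qed.

Lemma C0_ge0 : 0 <= C0.
Proof.
have := Cx_ge0; have : 0 < C1 :> R := C1_gt0; have : 0 < CM :> R := CM_gt0.
rewrite /C0; lra.
Qed.

Let bG (t : R) : bm (fun w => G (h ^+ 2) (SXT w - t)).
Proof.
under eq_fun do rewrite addrC.
exact: bm_G bm_SXT _ _.
Qed.

(** Passing from exp (- t^2/2) to barPhi t costs one more factor u, whence u^20 from here on. *)
Let err (t t1 : R) : -1 <= t <= u -> `|t1 - t| <= 2 * iu ^+ 3 ->
  cS * cQ * expR 1 * u ^+ 19 * E * expR (- t1 ^+ 2 / 2 + 2^-1) <=
  Cx * (u ^+ 20 * E) * barPhi t.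
Proof.
move=> tu tt1.
have ex : expR (- t1 ^+ 2 / 2 + 2^-1) <= expR 1 * (CM * u * barPhi t).
  apply: (@le_trans _ _ (expR 1 * expR (- t ^+ 2 / 2))).
    by rewrite -expRD ler_expR; exact: sqr_shift u4 iu0 iu4 iuu tu tt1.
  rewrite ler_wpM2l ?expR_ge0//; apply: exp_le_barPhi => //.
  by apply: le_trans u4; rewrite ler1n.
rewrite (_ : Cx * (u ^+ 20 * E) * barPhi t =
  cS * cQ * expR 1 * u ^+ 19 * E * (expR 1 * (CM * u * barPhi t)));
  last by rewrite /Cx; ring.
apply: ler_wpM2l => //; apply: mulr_ge0 => //.
apply: mulr_ge0; last by rewrite exprn_ge0// ltW.
apply: mulr_ge0; last exact: expR_ge0.
by apply: mulr_ge0; [rewrite addr_ge0 ?expR_ge0|exact: cQ_ge0].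
Qed.

Theorem tail_approx (t : R) : -1 <= t <= u - 1 -> u ^+ 20 * E <= 1 ->
  `|fine (P [set w | t <= SXT w]) - barPhi t| <=
  C0 * (iu + u ^+ 20 * E) * barPhi t.
Proof.
move=> /andP[tm tu1] uE1.
have u0' := u0; have u4' := u4; have iu0' := iu0; have iu4' := iu4; have iuu' := iuu.
have E0' := E0; have h0' := h0; have hle' := hle.
have tu : -1 <= t <= u by lra.
set p := fine _; set B := barPhi t.
have B0 : 0 < B by exact: barPhi_gt0.
have p0 : 0 <= p by rewrite fine_ge0.
set eta := u ^+ 20 * E.
have eta0 : 0 <= eta by rewrite mulr_ge0// exprn_ge0// ltW.
have i3 : 0 < iu ^+ 3 by rewrite exprn_gt0.
have i3' : iu ^+ 3 <= iu ^+ 2 * 4^-1.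
  by rewrite exprSr ler_wpM2l// exprn_ge0// ltW.
have i2' : iu ^+ 2 <= iu * 4^-1 by rewrite expr2 ler_wpM2l// ltW.
have hL : h * (2 * u) = 2 * iu ^+ 3.
  have -> : h * (2 * u) = 2 * iu ^+ 3 * (u * iu) by ring.
  by rewrite iuu mulr1.
have hh : 2 * u * h ^+ 2 <= 2 * iu ^+ 3.
  by rewrite -hL; nra.
have shift (t1 : R) : `|t1| <= 2 * u -> `|t1 * isq (1 + h ^+ 2) - t1| <= 2 * iu ^+ 3.
  move=> t1u; rewrite -{2}(mulr1 t1) -mulrBr normrM.
  apply: le_trans hh; apply: ler_pM => //.
  have hp : 0 <= h ^+ 2 by rewrite exprn_ge0// ltW.
  have := isq1D_le1 hp; have := isq1D_ge hp.
  by rewrite ler_norml; lra.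
have tn : `|t| <= u by rewrite ler_norml; lra.
have C1' := @C1_gt0 R; have CM' := @CM_gt0 R.
have Cx0 := Cx_ge0.
have [L1 L2] := barPhi_2u u4 iu0 iu4 iuu.
have mt := measurable_SXT_ge t.
have pE : p = Ex P (\1_[set w | t <= SXT w]) by rewrite Ex_indic.
have up : p * (1 - iu / 2) <= (1 + 4 * C1 * iu ^+ 2 + Cx * eta) * B.
  pose t1 := t - 2 * iu ^+ 3.
  have t1u : `|t1| <= 2 * u.
    by move: tn; rewrite !ler_norml /t1; nra.
  have := lindeberg_barPhi t1u; have := shift _ t1u.
  rewrite !ler_norml => /andP[s1 s2] /andP[g1 g2].
  have er : cS * cQ * expR 1 * u ^+ 19 * E * expR (- t1 ^+ 2 / 2 + 2^-1) <= Cx * eta * B.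
    by apply: err => //; rewrite /t1 addrAC subrr sub0r normrN ger0_norm//; lra.
  have pG : p * (1 - iu / 2) <= Ex P (fun w => G (h ^+ 2) (SXT w - t1)).
    rewrite pE mulrC -ExZ; last exact: bm_indic.
    apply: Ex_le => //; first by apply: bmZ; exact: bm_indic.
    move=> w; rewrite indicE; case: (boolP (w \in _)) => [|_]; last by rewrite mulr0 G_ge0.
    rewrite inE/= => tS; rewrite mulr1 /G isq_sqr//.
    apply: (@le_trans _ _ (1 - barPhi (2 * u))); first by lra.
    rewrite {1}/barPhi opprB addrC subrK -!barPhiN; apply: barPhi_le.
    rewrite lerN2 ler_pdivlMr// mulrC hL /t1; lra.
  have sh : barPhi (t1 * isq (1 + h ^+ 2)) <= (1 + 4 * C1 * iu ^+ 2) * B.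
    apply: (barPhi_shift_below u4 iu0 iu4 iuu tu).
    by rewrite -/t1 ler_norml s1.
  by rewrite [leRHS]mulrDl; apply: le_trans pG _; apply: le_trans (lerD sh er); rewrite -lerBlDl.
have lo : (1 - 4 * C1 * iu ^+ 2 - Cx * eta - CM * iu) * B <= p.
  pose t1 := t + 2 * iu ^+ 3.
  have t1u : `|t1| <= 2 * u.
    by move: tn; rewrite !ler_norml /t1; nra.
  have := lindeberg_barPhi t1u; have := shift _ t1u.
  rewrite !ler_norml => /andP[s1 s2] /andP[g1 g2].
  have er : cS * cQ * expR 1 * u ^+ 19 * E * expR (- t1 ^+ 2 / 2 + 2^-1) <= Cx * eta * B.
    by apply: err => //; rewrite /t1 (addrC t) addrK ger0_norm//; lra.
  have pG : Ex P (fun w => G (h ^+ 2) (SXT w - t1)) <= p + barPhi (2 * u).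
    rewrite pE -(Ex_cst P (barPhi (2 * u))) -ExD; [|exact: bm_indic|exact: bm_cst].
    apply: Ex_le => //; first by apply: bmD; [exact: bm_indic|exact: bm_cst].
    move=> w; rewrite indicE; case: (boolP (w \in _)) => [_|].
      by apply: (le_trans (G_le1 _ _)); rewrite lerDl barPhi_ge0.
    rewrite notin_setE/= => /negP; rewrite -ltNge => tS.
    rewrite add0r /G isq_sqr// -barPhiN; apply: barPhi_le.
    rewrite -mulNr ler_pdivlMr// mulrC hL /t1; lra.
  have sh : (1 - 4 * C1 * iu ^+ 2) * B <= barPhi (t1 * isq (1 + h ^+ 2)).
    have tu' : -1 <= t <= u - 1 by rewrite tm.
    apply: (barPhi_shift_above u4 iu0 iu4 iuu tu').
    by rewrite -/t1 ler_norml s1.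
  have Bu : barPhi u <= B by apply: barPhi_le; lra.
  have : CM * iu * barPhi u <= CM * iu * B by rewrite ler_wpM2l// mulr_ge0// ltW.
  rewrite [(1 - 4 * C1 * iu ^+ 2 - Cx * eta - CM * iu) * B]mulrBl.
  rewrite [(1 - 4 * C1 * iu ^+ 2 - Cx * eta) * B]mulrBl.
  exact: sub_chain g1 pG sh er L1.
exact: tail_arith (ltW C1') Cx0 (ltW CM') up lo.
Qed.

End tail.

(** * Truncated observations *)

Section chernoff.
Context {d : measure_display} {T : measurableType d} {R : realType}.
Variable P : probability T R.
Variables (I : finType) (X : I -> {RV P >-> R}).
Hypothesis ind : mutually_independent X.
Variables (f : I -> R -> R) (b : R).
Hypothesis mf : forall a, measurable_fun setT (f a).
Hypothesis fb : forall a y, `|f a y| <= b.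
Variables (e sg : I -> R) (l : R).
Hypotheses (e1 : forall a, `|Ex P (fun w => f a (X a w))| <= e a).
Hypotheses (e2 : forall a, `|Ex P (fun w => f a (X a w) ^+ 2) - sg a| <= e a).
Hypotheses (e3 : forall a, b * Ex P (fun w => f a (X a w) ^+ 2) <= e a).
Hypothesis lb : `|l| * b <= 1.

Lemma mgf_SXT : Ex P (fun w => expR (l * SXT X f w)) <=
  expR (l ^+ 2 * (\sum_a sg a) / 2 + cE * (1 + `|l|) ^+ 3 * \sum_a e a).
Proof.
have mlf a : measurable_fun setT (fun y => l * f a y) by exact: measurable_funM.
have lfb a y : `|l * f a y| <= 1.
  by rewrite normrM; apply: le_trans lb; rewrite ler_wpM2l.
have := @mgf_prod _ _ _ P I X ind (fun a y => l * f a y) 1 mlf lfb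
  (fun a => l ^+ 2 * sg a / 2 + cE * (1 + `|l|) ^+ 3 * e a) (index_enum I)
  (index_enum_uniq I).
rewrite /SX big_split/= -mulr_suml -!mulr_sumr.
have -> : (fun w => expR (\sum_a l * f a (X a w))) =
    (fun w => expR (l * SXT X f w)).
  by apply/funext => w; rewrite -mulr_sumr.
apply=> a _.
exact: (mgf_bound (bm_fX X mf fb a) (fun w => fb a (X a w)) lb (e1 a) (e2 a) (e3 a)).
Qed.

Lemma chernoff_ge (t : R) : 0 <= l -> fine (P [set w | t <= SXT X f w]) <=
  expR (- (l * t) + l ^+ 2 * (\sum_a sg a) / 2 +
     cE * (1 + `|l|) ^+ 3 * \sum_a e a).
Proof.
move=> l0.
have bS : bm (fun w => expR (l * SXT X f w)).
  by apply: bm_expR; apply: bmZ; exact: bm_SXT mf fb.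
have mS := measurable_SXT_ge X mf fb t.
apply: le_trans (Ex_markov P bS (fun w => expR_ge0 _) mS _ (expR_gt0 (l * t))) _.
  by move=> w /= tS; rewrite ler_expR ler_wpM2l.
rewrite -expRN mulrC -addrA expRD ler_wpM2l ?expR_ge0//.
exact: mgf_SXT.
Qed.

End chernoff.

Section truncation.
Context {R : realType}.
Implicit Types B y p : R.

Definition trunc B y : R := if `|y| <= B then y else 0.

Lemma measurable_trunc B : measurable_fun setT (trunc B).
Proof.
by apply: measurable_fun_if => //; apply: measurable_fun_ler.
Qed.

Lemma trunc_bound B y : 0 <= B -> `|trunc B y| <= B.
Proof. by move=> B0; rewrite /trunc; case: ifP => //; rewrite normr0. Qed.

Lemma truncE B y : `|y| <= B -> trunc B y = y.
Proof. by rewrite /trunc => ->. Qed.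

Lemma trunc_sqr_le B y : trunc B y ^+ 2 <= y ^+ 2.
Proof. by rewrite /trunc; case: ifP => //; rewrite expr0n/= sqr_ge0. Qed.

(** Used with q = 0, 1, 2: what truncation removes is paid for by the moment of order p. *)
Lemma powR_tail B y p (q : R) : 0 < B -> B < `|y| -> q <= p ->
  `|y| `^ q <= B `^ (q - p) * `|y| `^ p.
Proof.
move=> B0 By qp.
have y0 : 0 < `|y| by exact: lt_trans By.
have yB : B `^ (p - q) <= `|y| `^ (p - q).
  by apply: ge0_ler_powR; rewrite ?nnegrE ?subr_ge0// ltW.
have e1 : `|y| `^ p = `|y| `^ q * `|y| `^ (p - q).
  rewrite -powRD; last by rewrite (gt_eqF y0) /= implybT.
  by rewrite addrC subrK.
have e2 : B `^ (q - p) * B `^ (p - q) = 1.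
  rewrite -powRD; last by rewrite (gt_eqF B0) /= implybT.
  by rewrite -opprB addNr powRr0.
have y0' := powR_gt0 q y0.
have B0' := powR_gt0 (q - p) B0.
rewrite e1 mulrCA -[leLHS]mulr1 ler_wpM2l//.
by rewrite -e2 ler_wpM2l// ltW.
Qed.

End truncation.

Section truncated_moments.
Context {d : measure_display} {T : measurableType d} {R : realType}.
Variable P : probability T R.
Variables (Y : T -> R) (p K B : R).
Hypotheses (mY : measurable_fun setT Y) (p2 : 2 <= p) (B0 : 0 < B).
Hypothesis EYp : (\int[P]_w (`|Y w| `^ p)%:E <= K%:E)%E.
Hypothesis EY : (\int[P]_w (Y w)%:E = 0)%E.
Hypothesis EY2 : (\int[P]_w (Y w ^+ 2)%:E = 1)%E.

Let iYp : P.-integrable setT (EFin \o (fun w => `|Y w| `^ p)).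
Proof.
apply/integrableP; split.
  apply/measurable_EFinP; apply: (measurableT_comp (measurable_powR p)).
  exact: measurableT_comp.
under eq_integral do rewrite /= ger0_norm ?powR_ge0//.
exact: le_lt_trans EYp (ltry K).
Qed.

Let iY2 : P.-integrable setT (EFin \o (fun w => Y w ^+ 2)).
Proof.
apply/integrableP; split.
  by apply/measurable_EFinP; exact: measurable_funX.
by under eq_integral do rewrite /= ger0_norm ?sqr_ge0//; rewrite EY2 ltry.
Qed.

Let iY : P.-integrable setT (EFin \o Y).
Proof.
have i1 : P.-integrable setT (EFin \o (fun w => 1 + Y w ^+ 2)).
  exact: (integrableD measurableT (bm_integrable P (bm_cst 1)) iY2).
apply: le_integrable i1 => //; first exact/measurable_EFinP.
move=> w _ /=; rewrite lee_fin [leRHS]ger0_norm; last by rewrite addr_ge0 ?sqr_ge0.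
rewrite -(real_normK (num_real (Y w))); have := normr_ge0 (Y w); nra.
Qed.

Let bT : bm (fun w => trunc B (Y w)).
Proof.
split; first exact: (measurableT_comp (measurable_trunc B)).
by exists B => w; rewrite trunc_bound// ltW.
Qed.

Let EYpr : Ex P (fun w => `|Y w| `^ p) <= K.
Proof.
rewrite -lee_fin /Ex /Rintegral fineK//.
exact: integrable_fin_num.
Qed.

(** As Y is centered, the truncated mean is minus the mean of the part cut off. *)
Lemma trunc_mean : `|Ex P (fun w => trunc B (Y w))| <= K * B `^ (1 - p).
Proof.
have iD : P.-integrable setT (EFin \o (fun w => Y w - trunc B (Y w))).
  exact: (integrableB _ iY (bm_integrable P bT)).
have -> : Ex P (fun w => trunc B (Y w)) =
    - Ex P (fun w => Y w - trunc B (Y w)).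
  have EY0 : (\int[P]_w Y w)%R = 0 by rewrite /Rintegral EY.
  by rewrite /Ex RintegralB ?EY0 ?sub0r ?opprK//; exact: bm_integrable.
rewrite normrN; apply: le_trans (le_normr_Rintegral _ iD) _ => //.
apply: (@le_trans _ _ (Ex P (fun w => B `^ (1 - p) * `|Y w| `^ p))); last first.
  by rewrite /Ex RintegralZl// mulrC ler_wpM2r ?powR_ge0.
apply: le_Rintegral => //.
- exact: (integrable_norm iD).
- exact: (integrableZl _ (B `^ (1 - p)) iYp).
move=> w _; rewrite /trunc; case: ifPn => [_|]; last rewrite -ltNge => By.
  by rewrite subrr normr0 mulr_ge0 ?powR_ge0.
rewrite subr0 -{1}(powRr1 (normr_ge0 (Y w))); apply: powR_tail => //.
by apply: le_trans p2; lra.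
Qed.

Lemma trunc_sqr_le1 : Ex P (fun w => trunc B (Y w) ^+ 2) <= 1.
Proof.
have -> : 1 = Ex P (fun w => Y w ^+ 2) by rewrite /Ex /Rintegral EY2.
apply: le_Rintegral => //; first exact: (bm_integrable P (bmX 2 bT)).
by move=> w _; exact: trunc_sqr_le.
Qed.

Lemma trunc_sqr_mean :
  `|Ex P (fun w => trunc B (Y w) ^+ 2) - 1| <= K * B `^ (2 - p).
Proof.
have bT2 := bm_integrable P (bmX 2 bT).
have iD : P.-integrable setT (EFin \o (fun w => Y w ^+ 2 - trunc B (Y w) ^+ 2)).
  exact: (integrableB _ iY2 bT2).
have -> : Ex P (fun w => trunc B (Y w) ^+ 2) - 1 =
    - Ex P (fun w => Y w ^+ 2 - trunc B (Y w) ^+ 2).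
  by rewrite /Ex RintegralB// opprB; congr (_ - _); rewrite /Rintegral EY2.
rewrite normrN; apply: le_trans (le_normr_Rintegral _ iD) _ => //.
apply: (@le_trans _ _ (Ex P (fun w => B `^ (2 - p) * `|Y w| `^ p))); last first.
  by rewrite /Ex RintegralZl// mulrC ler_wpM2r ?powR_ge0.
apply: le_Rintegral => //.
- exact: (integrable_norm iD).
- exact: (integrableZl _ (B `^ (2 - p)) iYp).
move=> w _; rewrite /trunc; case: ifPn => [_|]; last rewrite -ltNge => By.
  by rewrite subrr normr0 mulr_ge0 ?powR_ge0.
rewrite expr0n/= subr0 normrX -powR_mulrn//; exact: powR_tail.
Qed.

Lemma trunc_tail : fine (P [set w | B < `|Y w|]) <= K * B `^ (- p).
Proof.
have mA : measurable [set w | B < `|Y w|].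
  have mn : measurable_fun setT (fun w => `|Y w|) by exact: measurableT_comp.
  have := mn measurableT `]B, +oo[%classic (measurable_itv _).
  by rewrite setTI; congr (measurable _); apply/seteqP; split=> w /=;
    rewrite in_itv/= andbT.
rewrite -Ex_indic//.
apply: (@le_trans _ _ (Ex P (fun w => B `^ (- p) * `|Y w| `^ p))); last first.
  by rewrite /Ex RintegralZl// mulrC ler_wpM2r ?powR_ge0.
apply: le_Rintegral => //.
- exact: (bm_integrable P (bm_indic mA)).
- exact: (integrableZl _ (B `^ (- p)) iYp).
move=> w _; rewrite indicE; case: (boolP (w \in _)) => [|_]; last first.
  by rewrite mulr_ge0 ?powR_ge0.
rewrite inE/= => By; rewrite -(powRr0 `|Y w|) -(sub0r p); apply: powR_tail => //.
by apply: le_trans p2; lra.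
Qed.

End truncated_moments.

Section experiment_moments.
Context {R : realType}.
Variable E : experiment R.
Notation m := (ngroups E).
Notation idx := {i : 'I_m & 'I_(gsize i)}.
Variables (p K : R).
Hypothesis p2 : 2 <= p.
Hypothesis moment : forall i : 'I_m,
  ('E_(prob E)[fun w => (`|(obs1 i w - mean i) / sd i| `^ p)%R] <= K%:E)%E.

Definition Xz (z : idx) : {RV prob E >-> R} := obs (tagged z).

Definition stdz (i : 'I_m) (x : R) : R := (x - mean i) / sd i.

Definition Yz (z : idx) (w : space E) : R := stdz (tag z) (Xz z w).

Lemma measurable_stdz i : measurable_fun setT (stdz i).
Proof. by apply: measurable_funM => //; exact: measurable_funB. Qed.

Lemma measurable_Yz z : measurable_fun setT (Yz z).
Proof. exact: (measurableT_comp (measurable_stdz _)). Qed.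

Lemma ind_Xz : mutually_independent Xz.
Proof. exact: obs_independent. Qed.

Let X2 z : (\int[prob E]_w ((Xz z w - mean (tag z)) ^+ 2)%:E =
  (sd (tag z) ^+ 2)%:E)%E.
Proof.
have := obs_variance (tagged z); rewrite /variance unlock obs_mean/=.
by rewrite unlock => <-; apply: eq_integral => w _; rewrite expr2.
Qed.

Lemma EYz2 z : (\int[prob E]_w (Yz z w ^+ 2)%:E = 1)%E.
Proof.
have s0 := sd_gt0 (tag z).
have mX : measurable_fun setT (fun w => ((Xz z w - mean (tag z)) ^+ 2)%:E).
  apply/measurable_EFinP; apply: measurable_funX; exact: measurable_funB.
rewrite (eq_integral (fun w => ((sd (tag z) ^- 2)%:E *
  ((Xz z w - mean (tag z)) ^+ 2)%:E)%E)); last first.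
  by move=> w _; rewrite -EFinM /Yz /stdz exprMn exprVn mulrC.
rewrite ge0_integralZl//=; last 2 first.
- by move=> w _; rewrite lee_fin sqr_ge0.
- by rewrite lee_fin invr_ge0 sqr_ge0.
by rewrite X2 -EFinM mulVf// expf_neq0// gt_eqF.
Qed.

(** The identity mean = sd * E Y + mean is solved for E Y, which is finite because |Y| <= 1 +
    Y^2. *)
Lemma EYz z : (\int[prob E]_w (Yz z w)%:E = 0)%E.
Proof.
have s0 := sd_gt0 (tag z).
have iY : (prob E).-integrable setT (EFin \o Yz z).
  have i2 : (prob E).-integrable setT (EFin \o (fun w => Yz z w ^+ 2)).
    apply/integrableP; split.
      by apply/measurable_EFinP; apply: measurable_funX; exact: measurable_Yz.
    under eq_integral do rewrite /= ger0_norm ?sqr_ge0//.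
    by rewrite EYz2 ltry.
  have i1 : (prob E).-integrable setT (EFin \o (fun w => 1 + Yz z w ^+ 2)).
    exact: (integrableD measurableT (bm_integrable (prob E) (bm_cst 1)) i2).
  apply: le_integrable i1 => //; first exact/measurable_EFinP/measurable_Yz.
  move=> w _ /=; rewrite lee_fin [leRHS]ger0_norm; last by rewrite addr_ge0 ?sqr_ge0.
  rewrite -(real_normK (num_real (Yz z w))); have := normr_ge0 (Yz z w); nra.
have := obs_mean (tagged z); rewrite unlock.
rewrite (eq_integral (fun w => ((sd (tag z))%:E * (Yz z w)%:E + (mean (tag z))%:E)%E));
    last first.
  move=> w _; rewrite -EFinM -EFinD; congr EFin.
  by rewrite /Yz /stdz /Xz; field; rewrite gt_eqF.
rewrite integralD//=; last 2 first.
- exact: (integrableZl _ (sd (tag z)) iY).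
- exact: (bm_integrable (prob E) (bm_cst (mean (tag z)))).
rewrite integralZl//= integral_cst//= probability_setT mule1.
have : (\int[prob E]_w (Yz z w)%:E)%E \is a fin_num by exact: integrable_fin_num.
case: (\int[prob E]_w (Yz z w)%:E)%E => //= r _ [].
rewrite -[RHS]add0r => /addIr/eqP; rewrite mulf_eq0 gt_eqF//= => /eqP ->.
by [].
Qed.

(** The moment assumption concerns the first observation of a group; equality of the laws transports
    it to the others. *)
Lemma EYzp z : (\int[prob E]_w (`|Yz z w| `^ p)%:E <= K%:E)%E.
Proof.
have := moment (tag z); rewrite unlock; apply: le_trans.
pose h (x : R) : \bar R := (`|stdz (tag z) x| `^ p)%:E.
have mh : measurable_fun setT h.
  apply/measurable_EFinP; apply: (measurableT_comp (measurable_powR p)).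
  by apply: measurableT_comp => //; exact: measurable_stdz.
have h0 x : (0 <= h x)%E by rewrite lee_fin powR_ge0.
rewrite -(ge0_integral_distribution (Xz z) mh h0).
rewrite -[leRHS](ge0_integral_distribution (obs1 (tag z)) mh h0).
rewrite (@eq_measure_integral _ _ _ _ (distribution (prob E) (obs1 (tag z))))//.
by move=> A mA _; exact: obs_identical.
Qed.

Lemma sum_tag (F : 'I_m -> R) :
  \sum_(z : idx) F (tag z) = \sum_i (gsize i)%:R * F i.
Proof.
rewrite -(sig_big_dep xpredT (fun i => xpredT) (fun i _ => F i))/=.
by apply: eq_bigr => i _; rewrite sumr_const card_ord mulr_natl.
Qed.

End experiment_moments.

Section forms.
Context {R : realType}.
Variable E : experiment R.
Notation m := (ngroups E).
Notation idx := {i : 'I_m & 'I_(gsize i)}.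
Notation N i := ((gsize i)%:R : R).
Notation P := (prob E).
Variables (p K B : R).
Hypothesis p2 : 2 <= p.
Hypothesis moment : forall i : 'I_m,
  ('E_P[fun w => (`|(obs1 i w - mean i) / sd i| `^ p)%R] <= K%:E)%E.
Hypotheses (B0 : 0 < B) (K0 : 0 <= K).
Implicit Types (c : 'I_m -> R) (gm : R) (z : idx).

(* LF and QF sum the truncated standardized observations, respectively their squares
   minus 1, with weight c i in group i; errS and errQ are their total Lindeberg
   errors when the weights are bounded by gm. *)
Definition fz c (z : idx) (x : R) : R := c (tag z) * trunc B (stdz (tag z) x).

Definition LF c (w : space E) : R := SXT (@Xz R E) (fz c) w.

Let mtr (z : idx) : measurable_fun setT (fun x => trunc B (stdz (tag z) x)).
Proof. by apply: (measurableT_comp (measurable_trunc B)); exact: measurable_stdz. Qed.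

Lemma measurable_fz c z : measurable_fun setT (fz c z).
Proof. by apply: measurable_funM => //; exact: mtr. Qed.

Lemma fz_bound c gm z x : (forall i, `|c i| <= gm) -> `|fz c z x| <= gm * B.
Proof. by move=> cg; rewrite normrM ler_pM// trunc_bound// ltW. Qed.

Let K1 := K * B `^ (1 - p).
Let K2 := K * B `^ (2 - p).
Let K10 : 0 <= K1. Proof. by rewrite mulr_ge0 ?powR_ge0. Qed.
Let K20 : 0 <= K2. Proof. by rewrite mulr_ge0 ?powR_ge0. Qed.

Let bmT (z : idx) : bm (fun w => trunc B (Yz z w)).
Proof.
split; first by apply: (measurableT_comp (mtr z)).
by exists B => w; rewrite trunc_bound// ltW.
Qed.

Let m1 (z : idx) : `|Ex P (fun w => trunc B (Yz z w))| <= K1.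
Proof.
exact: (trunc_mean (measurable_Yz z) p2 B0 (EYzp moment z) (EYz z) (EYz2 z)).
Qed.

Let m2 (z : idx) : `|Ex P (fun w => trunc B (Yz z w) ^+ 2) - 1| <= K2.
Proof. exact: (trunc_sqr_mean (measurable_Yz z) p2 B0 (EYzp moment z) (EYz2 z)). Qed.

Let m2' (z : idx) : Ex P (fun w => trunc B (Yz z w) ^+ 2) <= 1.
Proof. exact: (trunc_sqr_le1 (measurable_Yz z) B0 (EYz2 z)). Qed.

(** The summands meet the four requirements of [lindeberg] on one observation: K1 for the mean, K2
    for the variance, gm * B for the third moment and gm^2 for the squared variance. *)
Definition ez c gm (z : idx) : R :=
  `|c (tag z)| * K1 + c (tag z) ^+ 2 * (K2 + gm * B + gm ^+ 2).

Definition errS c gm : R := (\sum_i N i * `|c i|) * K1 +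
  (\sum_i N i * c i ^+ 2) * (K2 + gm * B + gm ^+ 2).

Lemma sum_ez c gm : \sum_z ez c gm z = errS c gm.
Proof.
rewrite /ez (sum_tag (fun i => `|c i| * K1 + c i ^+ 2 * (K2 + gm * B + gm ^+ 2))).
rewrite /errS !mulr_suml -big_split/=; apply: eq_bigr => i _; ring.
Qed.

Section gm.
Variables (c : 'I_m -> R) (gm : R).
Hypothesis cg : forall i, `|c i| <= gm.
Variable z : idx.

Let gm0 : 0 <= gm. Proof. exact: le_trans (cg (tag z)). Qed.
Let gB : 0 <= gm * B. Proof. by rewrite mulr_ge0// ltW. Qed.
Let cc : 0 <= c (tag z) ^+ 2. Proof. exact: sqr_ge0. Qed.
Let cg2 : c (tag z) ^+ 2 <= gm ^+ 2.
Proof. by rewrite -[leLHS]real_normK ?num_real// lerXn2r ?nnegrE. Qed.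

Lemma ez1 : `|Ex P (fun w => fz c z (Xz z w))| <= ez c gm z.
Proof.
rewrite /fz (ExZ P (c (tag z)) (bmT z)) normrM /ez.
apply: (@le_trans _ _ (`|c (tag z)| * K1)); first by rewrite ler_wpM2l// m1.
by rewrite lerDl mulr_ge0// !addr_ge0// sqr_ge0.
Qed.

Let sq : Ex P (fun w => fz c z (Xz z w) ^+ 2) =
  c (tag z) ^+ 2 * Ex P (fun w => trunc B (Yz z w) ^+ 2).
Proof.
rewrite -(ExZ P _ (bmX 2 (bmT z))); congr (Ex P _).
by apply/funext => w; rewrite /fz exprMn.
Qed.

Lemma ez2 : `|Ex P (fun w => fz c z (Xz z w) ^+ 2) - c (tag z) ^+ 2| <= ez c gm z.
Proof.
rewrite sq -{2}(mulr1 (_ ^+ 2)) -mulrBr normrM ger0_norm// /ez.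
apply: (@le_trans _ _ (c (tag z) ^+ 2 * K2)); first by rewrite ler_wpM2l// m2.
apply: ler_wpDl; first by rewrite mulr_ge0.
rewrite ler_wpM2l//.
by rewrite -addrA lerDl addr_ge0// sqr_ge0.
Qed.

Lemma ez3 : gm * B * Ex P (fun w => fz c z (Xz z w) ^+ 2) <= ez c gm z.
Proof.
rewrite sq /ez; apply: (@le_trans _ _ (c (tag z) ^+ 2 * (gm * B))).
  by rewrite mulrC -mulrA ler_wpM2l// ler_piMl// m2'.
apply: ler_wpDl; first by rewrite mulr_ge0.
rewrite ler_wpM2l//.
by rewrite (addrC K2) -addrA lerDl addr_ge0// sqr_ge0.
Qed.

Lemma ez4 : (c (tag z) ^+ 2) ^+ 2 <= ez c gm z.
Proof.
rewrite /ez expr2; apply: ler_wpDl; first by rewrite mulr_ge0.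
rewrite ler_wpM2l//.
by apply: (le_trans cg2); rewrite lerDr addr_ge0.
Qed.

End gm.

Lemma LF_tail c gm (u iu t : R) : (forall i, `|c i| <= gm) ->
  \sum_i N i * c i ^+ 2 = 1 -> 4 <= u -> 0 < iu -> iu <= 4^-1 -> u * iu = 1 ->
  2 * u * (gm * B) <= 1 -> cE * 27 * u ^+ 3 * errS c gm <= 1 ->
  u ^+ 20 * errS c gm <= 1 -> -1 <= t <= u - 1 ->
  `|fine (P [set w | t <= LF c w]) - barPhi t| <=
  C0 * (iu + u ^+ 20 * errS c gm) * barPhi t.
Proof.
move=> cg c1 u4 iu0 iu4 iuu ub uE uE1 tu.
rewrite -sum_ez; rewrite -sum_ez in uE uE1.
apply: (tail_approx (@ind_Xz R E) (measurable_fz c)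
  (fun z x => fz_bound z x cg) (ez1 cg) (ez2 cg) (ez3 cg) (ez4 cg)) => //.
- by move=> z; exact: sqr_ge0.
- by rewrite (sum_tag (fun i => c i ^+ 2)).
Qed.

Lemma LF_chernoff c gm (l t : R) : (forall i, `|c i| <= gm) ->
  0 <= l -> l * (gm * B) <= 1 ->
  fine (P [set w | t <= LF c w]) <=
  expR (- (l * t) + l ^+ 2 * (\sum_i N i * c i ^+ 2) / 2 +
        cE * (1 + l) ^+ 3 * errS c gm).
Proof.
move=> cg l0 lb.
have lb' : `|l| * (gm * B) <= 1 by rewrite ger0_norm.
have := @chernoff_ge _ _ _ P _ _ (@ind_Xz R E) _ _ (measurable_fz c)
  (fun z x => fz_bound z x cg) _ _ l (ez1 cg) (ez2 cg) (ez3 cg) lb' t l0.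
by rewrite sum_ez (sum_tag (fun i => c i ^+ 2)) ger0_norm.
Qed.

Lemma measurable_LF_ge c (t : R) : measurable [set w | t <= LF c w].
Proof.
apply: (@measurable_SXT_ge _ _ _ P _ _ _ ((\sum_i `|c i|) * B)).
  exact: measurable_fz.
move=> z x; apply: fz_bound => i; rewrite (bigD1 i)//= lerDl.
by apply: sumr_ge0 => j _.
Qed.

Lemma LF_smeas c (J : {set idx}) : (forall z, z \notin J -> c (tag z) = 0) ->
  smeas (@Xz R E) J (LF c).
Proof.
move=> cJ; apply: (@smeas_sum _ _ _ _ _ (@Xz R E) J (index_enum _)
  (fun z w => fz c z (Xz z w))) => z _.
have [zJ|/cJ zJ] := boolP (z \in J).
  by apply: smeas_fX => //; exact: measurable_fz.
rewrite (_ : (fun w => _) = cst 0); first exact: smeas_cst.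
by apply/funext => w; rewrite /fz zJ mul0r.
Qed.

Definition fq c (z : idx) (x : R) : R :=
  c (tag z) * (trunc B (stdz (tag z) x) ^+ 2 - 1).

Definition QF c (w : space E) : R := SXT (@Xz R E) (fq c) w.

Definition B2 : R := B ^+ 2 + 1.
Let B20 : 0 <= B2. Proof. by rewrite addr_ge0 ?sqr_ge0. Qed.

Lemma measurable_fq c z : measurable_fun setT (fq c z).
Proof.
apply: measurable_funM => //; apply: measurable_funB => //.
by apply: measurable_funX; exact: mtr.
Qed.

Let tr2 (y : R) : trunc B y ^+ 2 <= B ^+ 2.
Proof.
rewrite -[leLHS]real_normK ?num_real// lerXn2r ?nnegrE ?(ltW B0)//.
by rewrite trunc_bound// ltW.
Qed.

Lemma fq_bound c gm z x : (forall i, `|c i| <= gm) -> `|fq c z x| <= gm * B2.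
Proof.
move=> cg; rewrite normrM ler_pM// /B2.
have := tr2 (stdz (tag z) x); have := sqr_ge0 (trunc B (stdz (tag z) x)).
by rewrite ler_norml; lra.
Qed.

Definition qz c gm (z : idx) : R :=
  `|c (tag z)| * K2 + c (tag z) ^+ 2 * (B2 * (1 + gm * B2)).

Definition errQ c gm : R := (\sum_i N i * `|c i|) * K2 +
  (\sum_i N i * c i ^+ 2) * (B2 * (1 + gm * B2)).

Let bmQ (z : idx) : bm (fun w => trunc B (Yz z w) ^+ 2 - 1).
Proof. by apply: bmB; [exact: bmX|exact: bm_cst]. Qed.

(** A crude bound is enough, so the variance is set to 0 and the whole second moment is counted as
    error. Fourth moments need not exist; the truncation level bounds the second moment of trunc^2 -
    1 by B^2 + 1. *)
Lemma QF_chernoff c gm (l t : R) : (forall i, `|c i| <= gm) ->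
  0 <= l -> l * (gm * B2) <= 1 ->
  fine (P [set w | t <= QF c w]) <=
  expR (- (l * t) + cE * (1 + l) ^+ 3 * errQ c gm).
Proof.
move=> cg l0 lb.
have lb' : `|l| * (gm * B2) <= 1 by rewrite ger0_norm.
have q1 z : `|Ex P (fun w => trunc B (Yz z w) ^+ 2 - 1)| <= K2.
  rewrite ExB; [|exact: bmX|exact: bm_cst].
  by rewrite (Ex_cst P 1).
have q2 z : Ex P (fun w => (trunc B (Yz z w) ^+ 2 - 1) ^+ 2) <= B2.
  apply: (@le_trans _ _ (Ex P (fun w => B ^+ 2 * trunc B (Yz z w) ^+ 2 + 1))).
    apply: Ex_le; first exact: bmX.
      by apply: bmD; [apply: bmZ; exact: bmX|exact: bm_cst].
    move=> w; have := tr2 (Yz z w); have := sqr_ge0 (trunc B (Yz z w)).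
    set y := trunc _ _ ^+ 2; set b2 := B ^+ 2; nra.
  rewrite ExD; [|by apply: bmZ; exact: bmX|exact: bm_cst].
  rewrite (Ex_cst P 1) (ExZ P _ (bmX 2 (bmT z))) lerD2r.
  by rewrite ler_piMr ?sqr_ge0.
have gm0 (z : idx) : 0 <= gm by exact: le_trans (cg (tag z)).
have sq z : Ex P (fun w => fq c z (Xz z w) ^+ 2) =
    c (tag z) ^+ 2 * Ex P (fun w => (trunc B (Yz z w) ^+ 2 - 1) ^+ 2).
  rewrite -(ExZ P _ (bmX 2 (bmQ z))); congr (Ex P _).
  by apply/funext => w; rewrite /fq exprMn.
have sq0 z : 0 <= Ex P (fun w => (trunc B (Yz z w) ^+ 2 - 1) ^+ 2).
  by apply: Ex_ge0 => w; exact: sqr_ge0.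
have h1 z : `|Ex P (fun w => fq c z (Xz z w))| <= qz c gm z.
  rewrite /fq (ExZ P (c (tag z)) (bmQ z)) normrM /qz; apply: ler_wpDr; last by rewrite ler_wpM2l.
  by rewrite mulr_ge0 ?sqr_ge0// mulr_ge0// addr_ge0// mulr_ge0// (gm0 z).
have h2 z : `|Ex P (fun w => fq c z (Xz z w) ^+ 2) - 0| <= qz c gm z.
  rewrite subr0 sq ger0_norm; last by rewrite mulr_ge0// sqr_ge0.
  rewrite /qz.
  apply: ler_wpDl; first by rewrite mulr_ge0.
  rewrite ler_wpM2l ?sqr_ge0//; apply: (le_trans (q2 z)).
  by rewrite ler_peMr// lerDl mulr_ge0// (gm0 z).
have h3 z : gm * B2 * Ex P (fun w => fq c z (Xz z w) ^+ 2) <= qz c gm z.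
  rewrite sq /qz; apply: ler_wpDl; first by rewrite mulr_ge0.
  rewrite mulrCA ler_wpM2l ?sqr_ge0//.
  rewrite mulrC ler_pM// ?mulr_ge0 ?(gm0 z)//.
  by rewrite lerDr.
have := @chernoff_ge _ _ _ P _ _ (@ind_Xz R E) _ _ (measurable_fq c)
  (fun z x => fq_bound z x cg) _ (fun=> 0) l h1 h2 h3 lb' t l0.
have -> : \sum_z qz c gm z = errQ c gm.
  rewrite /qz (sum_tag (fun i => `|c i| * K2 + c i ^+ 2 * (B2 * (1 + gm * B2)))).
  rewrite /errQ !mulr_suml -big_split/=; apply: eq_bigr => i _; ring.
by rewrite big1// mulr0 mul0r addr0 ger0_norm.
Qed.

Lemma measurable_QF_ge c (t : R) : measurable [set w | t <= QF c w].
Proof.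
apply: (@measurable_SXT_ge _ _ _ P _ _ _ ((\sum_i `|c i|) * B2)).
  exact: measurable_fq.
move=> z x; apply: fq_bound => i; rewrite (bigD1 i)//= lerDl.
by apply: sumr_ge0 => j _.
Qed.

Lemma obs_tail z : fine (P [set w | B < `|Yz z w|]) <= K * B `^ (- p).
Proof. exact: (trunc_tail (measurable_Yz z) p2 B0 (EYzp moment z)). Qed.

End forms.

(** * Pair statistics *)

Section delta.
Context {R : realType} {m : nat}.
Implicit Types (a b i : 'I_m) (h : 'I_m -> R).

Lemma sum_delta a h : \sum_i (i == a)%:R * h i = h a.
Proof.
rewrite (bigD1 a)//= eqxx mul1r big1 ?addr0// => i /negbTE ->.
by rewrite mul0r.
Qed.

Definition dl (x : 'I_m * 'I_m) i : R := (i == x.1)%:R - (i == x.2)%:R.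

Lemma dl_mul x y i : dl x i * dl y i =
  (i == x.1)%:R * (x.1 == y.1)%:R - (i == x.1)%:R * (x.1 == y.2)%:R -
  (i == x.2)%:R * (x.2 == y.1)%:R + (i == x.2)%:R * (x.2 == y.2)%:R.
Proof.
rewrite /dl; case: x => a b; case: y => c d /=.
by case: (eqVneq i a) => [<-|_]; case: (eqVneq i b) => [<-|_] /=; ring.
Qed.

Lemma sum_dl_mul x y h : \sum_i dl x i * dl y i * h i =
  (x.1 == y.1)%:R * h x.1 - (x.1 == y.2)%:R * h x.1 -
  (x.2 == y.1)%:R * h x.2 + (x.2 == y.2)%:R * h x.2.
Proof.
under eq_bigr => i _.
  rewrite dl_mul (_ : _ * h i = (i == x.1)%:R * ((x.1 == y.1)%:R * h i) -
  (i == x.1)%:R * ((x.1 == y.2)%:R * h i) -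
  (i == x.2)%:R * ((x.2 == y.1)%:R * h i) +
  (i == x.2)%:R * ((x.2 == y.2)%:R * h i)); last by ring.
  over.
by rewrite big_split/= !sumrB !sum_delta.
Qed.

End delta.

Section pairs.
Context {R : realType}.
Variable E : experiment R.
Notation m := (ngroups E).
Notation idx := {i : 'I_m & 'I_(gsize i)}.
Notation N i := ((gsize i)%:R : R).
Notation P := (prob E).
Implicit Types (i j : 'I_m) (x y : 'I_m * 'I_m).

Lemma N_gt0 i : 0 < N i.
Proof. by rewrite ltr0n; apply: leq_trans (gsize_ge2 i). Qed.

(** [wt i] is the variance of a sample mean and [dd x] the standard deviation of the difference for
    the pair x. The weights [cp x] express the centered difference divided by [dd x] through the
    standardized observations. *)
Definition wt i : R := sd i ^+ 2 / N i.
Definition dd x : R := Num.sqrt (wt x.1 + wt x.2).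
Definition cp x i : R := dl x i * (sd i / (N i * dd x)).

Lemma wt_gt0 i : 0 < wt i.
Proof. by rewrite divr_gt0 ?N_gt0 ?exprn_gt0 ?sd_gt0. Qed.

Lemma dd_gt0 x : 0 < dd x.
Proof. by rewrite sqrtr_gt0 addr_gt0 ?wt_gt0. Qed.

Lemma dd_sqr x : dd x ^+ 2 = wt x.1 + wt x.2.
Proof. by rewrite sqr_sqrtr// ltW// addr_gt0 ?wt_gt0. Qed.

Lemma cp_mul x y i : N i * (cp x i * cp y i) =
  dl x i * dl y i * (wt i / (dd x * dd y)).
Proof.
have ? : N i != 0 by rewrite gt_eqF ?N_gt0.
have ? : dd x != 0 by rewrite gt_eqF ?dd_gt0.
have ? : dd y != 0 by rewrite gt_eqF ?dd_gt0.
by rewrite /cp /wt; field; apply/and3P.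
Qed.

Lemma cp_norm x : x.1 != x.2 -> \sum_i N i * cp x i ^+ 2 = 1.
Proof.
move=> x12; under eq_bigr do rewrite expr2 cp_mul.
rewrite sum_dl_mul !eqxx (negbTE x12) eq_sym (negbTE x12) !mul1r !mul0r !subr0.
rewrite -mulrDl -expr2 -dd_sqr divff// expf_neq0// gt_eqF// dd_gt0//.
Qed.

(* The truncated pair statistic, with the true standard deviation dd x of the
   difference of the sample means instead of the estimated one. *)
Definition Sx (B : R) x (w : space E) : R := LF B (cp x) w.

End pairs.

Section finite_union.
Context {d : measure_display} {T : measurableType d} {R : realType}.
Variable P : probability T R.

Lemma measurable_exists (J : finType) (A : J -> set T) :
  (forall j, measurable (A j)) -> measurable [set w | exists j, A j w].
Proof.
move=> mA; rewrite (_ : [set w | _] = \bigcup_(j in [set: J]) A j).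
  by apply: fin_bigcup_measurable => //; exact: finite_finset.
by apply/seteqP; split=> w [j]; [exists j|exists j].
Qed.

Lemma prob_exists_le (J : finType) (A : J -> set T) :
  (forall j, measurable (A j)) ->
  fine (P [set w | exists j, A j w]) <= \sum_j fine (P (A j)).
Proof.
move=> mA; have mU := measurable_exists mA.
rewrite -Ex_indic// (eq_bigr (fun j => Ex P (\1_(A j)))); last first.
  by move=> j _; rewrite Ex_indic.
rewrite -(Ex_sum P (index_enum J) xpredT (F := fun j => \1_(A j))); last first.
  by move=> j; exact: bm_indic.
apply: Ex_le; [exact: bm_indic|by apply: bm_sum => j; exact: bm_indic|].
move=> w; rewrite indicE; case: (boolP (w \in _)) => [|_]; last exact: sumr_ge0.
rewrite inE => -[j Ajw]; rewrite (bigD1 j)//= indicE mem_set//= lerDl.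
exact: sumr_ge0.
Qed.

Lemma prob_setU_le (A B : set T) : measurable A -> measurable B ->
  fine (P (A `|` B)) <= fine (P A) + fine (P B).
Proof.
move=> mA mB; have mAB := measurableU _ _ mA mB.
rewrite -!Ex_indic// -ExD; [|exact: bm_indic|exact: bm_indic].
apply: Ex_le; [exact: bm_indic|by apply: bmD; exact: bm_indic|].
move=> w; rewrite !indicE in_setU; case: (w \in A); case: (w \in B) => /=;
  rewrite ?addr0 ?add0r//; lra.
Qed.

Lemma prob_le (A B : set T) : measurable A -> measurable B -> A `<=` B ->
  fine (P A) <= fine (P B).
Proof.
move=> mA mB AB; apply: fine_le; rewrite ?fin_num_measure//.
by apply: le_measure; rewrite ?inE.
Qed.

End finite_union.

(** The quotient is the sample variance over the true one: a is the deviation of the mean square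
    from 1, b the squared mean, and q the inverse sample size, present because of the divisor n_i -
    1. *)
Lemma ratio_bound (R : realType) (th a b q : R) : 0 < th -> th <= 4^-1 ->
  `|a| <= th -> 0 <= b -> b <= th / 8 -> 0 < q -> 64 * q <= th ->
  `|(1 + a - b) / (1 - q) - 1| <= 2 * th.
Proof.
move=> th0 th1 + b0 b8 q0 q8; rewrite !ler_norml => /andP[a1 a2].
have q1' : 0 < 1 - q by lra.
have tq : th * q <= th * 256^-1 by rewrite ler_wpM2l//; lra.
have tq0 : 0 <= th * q by rewrite mulr_ge0// ltW.
apply/andP; split.
  rewrite lerBrDr ler_pdivlMr//; lra.
rewrite lerBlDr ler_pdivrMr//; lra.
Qed.

(** * Studentization when means and variances behave *)

Section studentization.
Context {R : realType}.
Variable E : experiment R.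
Notation m := (ngroups E).
Notation idx := {i : 'I_m & 'I_(gsize i)}.
Notation N i := ((gsize i)%:R : R).
Notation P := (prob E).
Implicit Types (i j : 'I_m) (x y : 'I_m * 'I_m) (w : space E).

Definition SY i w : R := \sum_(k < gsize i) stdz i (obs k w).
Definition SQ i w : R := \sum_(k < gsize i) stdz i (obs k w) ^+ 2.

Lemma sum_idx (F : idx -> R) :
  \sum_z F z = \sum_i \sum_(k < gsize i) F (Tagged (fun i => 'I_(gsize i)) k).
Proof.
rewrite (sig_big_dep xpredT (fun i => xpredT)
  (fun i k => F (Tagged (fun i => 'I_(gsize i)) k)))/=.
by apply: eq_bigr => -[i k] _.
Qed.

Variables (B : R) (w : space E).
Hypothesis YB : forall z, `|Yz z w| <= B.

Lemma LF_good (c : 'I_m -> R) : LF B c w = \sum_i c i * SY i w.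
Proof.
rewrite /LF /SXT sum_idx; apply: eq_bigr => i _; rewrite mulr_sumr.
apply: eq_bigr => k _; rewrite /fz/= truncE//.
exact: (YB (Tagged (fun i => 'I_(gsize i)) k)).
Qed.

Lemma QF_good (c : 'I_m -> R) : QF B c w = \sum_i c i * (SQ i w - N i).
Proof.
rewrite /QF /SXT sum_idx; apply: eq_bigr => i _; rewrite /SQ.
have -> : N i = \sum_(k < gsize i) (1 : R) by rewrite sumr_const card_ord.
rewrite -sumrB mulr_sumr.
apply: eq_bigr => k _; rewrite /fq/= truncE//.
exact: (YB (Tagged (fun i => 'I_(gsize i)) k)).
Qed.

Lemma obs_stdz i (k : 'I_(gsize i)) v : obs k v = mean i + sd i * stdz i (obs k v).
Proof. by rewrite /stdz; field; rewrite gt_eqF// sd_gt0. Qed.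

Lemma sample_meanE i v : sample_mean i v = mean i + sd i * SY i v / N i.
Proof.
have N0 : N i != 0 by rewrite gt_eqF ?N_gt0.
rewrite /sample_mean; under eq_bigr do rewrite obs_stdz.
rewrite big_split/= sumr_const card_ord -mulr_sumr -/(SY i v) -mulr_natl.
by field.
Qed.

Lemma sample_varE i v : sample_var i v =
  sd i ^+ 2 * ((SQ i v - SY i v ^+ 2 / N i) / (N i - 1)).
Proof.
have N0 : N i != 0 by rewrite gt_eqF ?N_gt0.
rewrite /sample_var.
rewrite (eq_bigr (fun k => sd i ^+ 2 * (stdz i (obs k v) ^+ 2 -
   2 * (SY i v / N i) * stdz i (obs k v) + (SY i v / N i) ^+ 2))); last first.
  move=> k _; have e := obs_stdz k v; set y := stdz i (obs k v) in e *.
  by rewrite sample_meanE e; ring.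
rewrite -mulr_sumr big_split/= sumrB -mulr_sumr -/(SY i v) -/(SQ i v).
rewrite sumr_const card_ord -(mulr_natl ((SY i v / N i) ^+ 2)).
have N1 : N i - 1 != 0.
  rewrite gt_eqF// subr_gt0 (ltr_nat R 1); exact: gsize_ge2.
by field; rewrite N0 N1.
Qed.

Lemma cp_sum x (h : 'I_m -> R) : \sum_i cp x i * h i =
  (sd x.1 * h x.1 / N x.1 - sd x.2 * h x.2 / N x.2) / dd x.
Proof.
have d0 : dd x != 0 by rewrite gt_eqF ?dd_gt0.
rewrite (eq_bigr (fun i => (i == x.1)%:R * (sd i / (N i * dd x) * h i) -
  (i == x.2)%:R * (sd i / (N i * dd x) * h i))); last first.
  by move=> i _; rewrite /cp /dl; ring.
rewrite sumrB !sum_delta.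
have N1 : N x.1 != 0 by rewrite gt_eqF ?N_gt0.
have N2 : N x.2 != 0 by rewrite gt_eqF ?N_gt0.
by field; apply/and3P.
Qed.

Variables (u iu g : R).
Hypotheses (u4 : 4 <= u) (iu0 : 0 < iu) (iu4 : iu <= 4^-1) (iuu : u * iu = 1).
Hypotheses (gN : forall i, 1 <= g ^+ 2 * N i).
Hypothesis ug : 64 * (u ^+ 6 * g ^+ 2) <= 1.
Hypothesis meanb : forall i, `|SY i w / Num.sqrt (N i)| <= 2 * u.
Hypothesis varb : forall i, `|SQ i w / N i - 1| <= iu ^+ 4.

Lemma sample_var_good i : `|sample_var i w / sd i ^+ 2 - 1| <= 2 * iu ^+ 4.
Proof.
have N0 : N i != 0 by rewrite gt_eqF ?N_gt0.
have N2 : 2 <= N i by rewrite (ler_nat R 2) gsize_ge2.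
have s0 : sd i ^+ 2 != 0 by rewrite expf_neq0// gt_eqF// sd_gt0.
rewrite sample_varE mulrC mulKf//.
set th := iu ^+ 4.
have th0 : 0 < th by rewrite exprn_gt0.
have th1 : th <= 4^-1.
  have iu0' := iu0; have iu4' := iu4; rewrite /th.
  have : iu ^+ 4 <= iu ^+ 1 by rewrite ler_wiXn2l//; lra.
  rewrite expr1; lra.
have g2 : 64 * g ^+ 2 <= th * iu ^+ 2.
  have -> : th * iu ^+ 2 = iu ^+ 6 by rewrite /th -exprD.
  have u60 : 0 < u ^+ 6 by rewrite exprn_gt0// (lt_le_trans _ u4).
  rewrite -(ler_pM2l u60) -exprMn iuu expr1n.
  by have := ug; lra.
set a := SQ i w / N i - 1; set b := (SY i w / N i) ^+ 2; set q := (N i)^-1.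
have aN := varb i; rewrite -/a in aN.
have qg : q <= g ^+ 2 by rewrite /q -[X in X <= _]mul1r ler_pdivrMr ?N_gt0.
have q0 : 0 < q by rewrite invr_gt0 N_gt0.
have i20 : 0 <= iu ^+ 2 by exact: sqr_ge0.
have i21 : iu ^+ 2 <= 1.
  by rewrite exprn_ile1// ?ltW//; have := iu4; lra.
have q8 : 64 * q <= th by nra.
have b0 : 0 <= b by exact: sqr_ge0.
have bE : b = (SY i w / Num.sqrt (N i)) ^+ 2 * q.
  by rewrite /b !exprMn !exprVn sqr_sqrtr// /q expr2 invfM mulrA.
have b8 : b <= th / 8.
  have h1 : (SY i w / Num.sqrt (N i)) ^+ 2 <= (2 * u) ^+ 2.
    rewrite -[leLHS]real_normK ?num_real// lerXn2r ?nnegrE//.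
    by rewrite mulr_ge0// (le_trans _ u4).
  have h2 : b <= (2 * u) ^+ 2 * g ^+ 2 by rewrite bE ler_pM ?sqr_ge0// ltW.
  have h3 : u ^+ 2 * (64 * g ^+ 2) <= u ^+ 2 * (th * iu ^+ 2) by rewrite ler_wpM2l// sqr_ge0.
  have h4 : u ^+ 2 * (th * iu ^+ 2) = th.
    by rewrite mulrCA -exprMn iuu expr1n mulr1.
  by move: h2 h3; rewrite h4 exprMn; lra.
have N1 : N i - 1 != 0 by rewrite gt_eqF//; lra.
have -> : (SQ i w - SY i w ^+ 2 / N i) / (N i - 1) = (1 + a - b) / (1 - q).
  rewrite /a /b /q; field.
  by rewrite N0 N1.
have q1 : q <= 4^-1 by lra.
have q1' : 0 < 1 - q by lra.
exact: ratio_bound.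
Qed.

(** k is the estimated standard deviation over the true one; its square is within 2 * iu^4 of 1, and
    |k - 1| <= |k^2 - 1| as k > 0. *)
Lemma barT_good x : x.1 != x.2 ->
  exists k : R, [/\ 0 < k, `|k - 1| <= 2 * iu ^+ 4 &
    Sx B x w = k * barT x.1 x.2 w].
Proof.
move=> x12.
set th := iu ^+ 4.
have th0 : 0 < th by rewrite exprn_gt0.
have th1 : th <= 4^-1.
  have iu0' := iu0; have iu4' := iu4; rewrite /th.
  have : iu ^+ 4 <= iu ^+ 1 by rewrite ler_wiXn2l//; lra.
  rewrite expr1; lra.
set Dh := Num.sqrt (sample_var x.1 w / N x.1 + sample_var x.2 w / N x.2).
have d0 := dd_gt0 x.
have sv i : (1 - 2 * th) * wt i <= sample_var i w / N i <= (1 + 2 * th) * wt i.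
  have := sample_var_good i; rewrite -/th ler_norml.
  have s0 : 0 < sd i ^+ 2 by rewrite exprn_gt0// sd_gt0.
  set v := sample_var i w / sd i ^+ 2 => /andP[v1 v2].
  have -> : sample_var i w / N i = v * wt i.
    by rewrite /v /wt mulrA divfK// gt_eqF.
  by have w0 := ltW (wt_gt0 i); apply/andP; split; apply: ler_wpM2r => //; lra.
have /andP[a1 a2] := sv x.1; have /andP[b1 b2] := sv x.2.
have Dpos : 0 < sample_var x.1 w / N x.1 + sample_var x.2 w / N x.2.
  have w1 := wt_gt0 x.1; have w2 := wt_gt0 x.2; nra.
have Dh0 : 0 < Dh by rewrite sqrtr_gt0.
have Dh2 : Dh ^+ 2 = sample_var x.1 w / N x.1 + sample_var x.2 w / N x.2.
  by rewrite sqr_sqrtr// ltW.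
exists (Dh / dd x); split; first by rewrite divr_gt0.
  set k := Dh / dd x.
  have k0 : 0 < k by rewrite divr_gt0.
  have kd : k ^+ 2 * dd x ^+ 2 = Dh ^+ 2 by rewrite /k exprMn exprVn divfK// expf_neq0// gt_eqF.
  have d2 : 0 < dd x ^+ 2 by rewrite exprn_gt0.
  have k1 : 1 - 2 * th <= k ^+ 2.
    rewrite -(ler_pM2r d2) kd Dh2 dd_sqr; lra.
  have k2 : k ^+ 2 <= 1 + 2 * th.
    rewrite -(ler_pM2r d2) kd Dh2 dd_sqr; lra.
  rewrite ler_norml; apply/andP; split; nra.
rewrite /Sx LF_good cp_sum /barT -/Dh.
rewrite (_ : sample_mean x.1 w - sample_mean x.2 w - (mean x.1 - mean x.2) =
  sd x.1 * SY x.1 w / N x.1 - sd x.2 * SY x.2 w / N x.2); last first.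
  by rewrite !sample_meanE; ring.
set nm := sd x.1 * SY x.1 w / N x.1 - sd x.2 * SY x.2 w / N x.2.
by field; rewrite (gt_eqF d0) (gt_eqF Dh0).
Qed.

End studentization.

(** * Rejection counts *)

(** Swapping coordinates exchanges the two sides of the diagonal, so m^2 = 2 S + m. *)
Lemma card_lt_pairs (R : realType) (m : nat) :
  \sum_(x : 'I_m * 'I_m | (x.1 < x.2)%N) (1 : R) = m%:R * (m%:R - 1) / 2.
Proof.
have swK : involutive (fun x : 'I_m * 'I_m => (x.2, x.1)) by case.
set S := LHS.
have e1 : \sum_(x : 'I_m * 'I_m | (x.2 < x.1)%N) (1 : R) = S.
  by rewrite (reindex_inj (inv_inj swK)).
have e2 : \sum_(x : 'I_m * 'I_m | x.1 == x.2) (1 : R) = m%:R.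
  rewrite -(pair_big_dep xpredT (fun i j => i == j) (fun _ _ => 1))/=.
  under eq_bigr do under eq_bigl do rewrite eq_sym.
  under eq_bigr do rewrite big_pred1_eq.
  by rewrite sumr_const card_ord.
have : \sum_(x : 'I_m * 'I_m) (1 : R) = m%:R * m%:R.
  by rewrite sumr_const card_prod card_ord natrM.
rewrite (bigID (fun x : 'I_m * 'I_m => (x.1 < x.2)%N))/= -/S.
rewrite [X in S + X](bigID (fun x : 'I_m * 'I_m => (x.2 < x.1)%N))/=.
rewrite (eq_bigl (fun x : 'I_m * 'I_m => (x.2 < x.1)%N)); last first.
  by move=> x /=; case: (ltngtP x.1 x.2).
rewrite [X in _ + (_ + X)](eq_bigl (fun x : 'I_m * 'I_m => x.1 == x.2)); last first.
  by move=> x; rewrite /= -val_eqE/=; case: (ltngtP x.1 x.2).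
by rewrite e1 e2; lra.
Qed.

Lemma distribution_function_bounds (R : realType) (F : R -> R) (s : R) :
  distribution_function F -> 0 <= F s <= 1.
Proof.
move=> [hF _ F0 F1]; apply/andP; split.
  apply: (ler_cvg_to F0 (cvg_cst (F s))).
  by near=> t; apply: hF; near: t; apply: nbhs_ninfty_le; exact: num_real.
apply: (ler_cvg_to (cvg_cst (F s)) F1).
by near=> t; apply: hF; near: t; apply: nbhs_pinfty_ge; exact: num_real.
Unshelve. all: by end_near. Qed.

Section rejections.
Context {R : realType}.
Variable E : experiment R.
Notation m := (ngroups E).
Implicit Types (i j : 'I_m) (x y : 'I_m * 'I_m) (w : space E).

Definition ordered_pairs : {set 'I_m * 'I_m} :=
  [set x : 'I_m * 'I_m | (x.1 != x.2) && (mean x.1 <= mean x.2)]%SET.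

Let swK : involutive (fun x : 'I_m * 'I_m => (x.2, x.1)). Proof. by case. Qed.

(* Each unordered pair is oriented so that its first mean is the smaller one;
   a pair with equal means is kept in both orientations. *)
Lemma sum_ordered_pairs (f : 'I_m * 'I_m -> R) :
  \sum_(x in ordered_pairs) f x =
  \sum_(x in (Hplus E :|: H0 E)%SET) f (x.2, x.1) +
  \sum_(x in (Hminus E :|: H0 E)%SET) f x.
Proof.
rewrite (bigID (fun x => (x.2 < x.1)%N))/=; congr (_ + _).
  rewrite (reindex_inj (inv_inj swK)); apply: eq_bigl => x /=.
  rewrite !inE/= subr_gt0 subr_eq0 -andb_orr andbC le_eqVlt (eq_sym (mean x.2)) orbC.
  by rewrite -val_eqE/=; case: (ltngtP x.1 x.2).
apply: eq_bigl => x /=; rewrite !inE/= subr_lt0 subr_eq0 -andb_orr le_eqVlt orbC.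
by rewrite -val_eqE/=; case: (ltngtP x.1 x.2); rewrite ?andbT ?andbF// orbC.
Qed.

Lemma card_ordered_pairs : #|ordered_pairs|%:R = q E + (q0 E)%:R :> R.
Proof.
have -> : #|ordered_pairs|%:R = \sum_(x in ordered_pairs) (1 : R) by rewrite sumr_const.
rewrite sum_ordered_pairs /q -card_lt_pairs.
have -> : (q0 E)%:R = \sum_(x in H0 E) (1 : R) by rewrite sumr_const.
rewrite [\sum_(x in _ :|: _) _]big_mkcond/= [X in _ + X = _]big_mkcond/=.
rewrite [X in _ = X + _]big_mkcond/= [X in _ = _ + X]big_mkcond/=.
rewrite -!big_split/=; apply: eq_bigr => x _.
rewrite !inE subr_gt0 subr_lt0 subr_eq0.
case: (x.1 < x.2)%N => /=; last by rewrite addr0.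
by case: (ltgtP (mean x.1) (mean x.2)); rewrite /= ?addr0 ?add0r.
Qed.

Lemma barT_sym i j w : barT j i w = - barT i j w.
Proof.
rewrite /barT (addrC (sample_var j w / _)); ring.
Qed.

Variable F : 'I_m -> 'I_m -> R -> R.
Hypothesis F_df : forall i j, (i < j)%N -> distribution_function (F i j).
Hypothesis F_sym : forall i j, (i < j)%N ->
  forall t : R, 0 <= t -> F i j t = 1 - F i j (- t).

Definition refdist x : R -> R := if (x.1 < x.2)%N then F x.1 x.2 else F x.2 x.1.

Lemma F_symT i j (t : R) : (i < j)%N -> F i j (- t) = 1 - F i j t.
Proof.
move=> ij; have [t0|t0] := leP 0 t; first by rewrite [in RHS](F_sym ij t0); ring.
by rewrite (F_sym ij)// ?oppr_ge0 ?(ltW t0)// opprK.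
Qed.

Lemma refdist_df x : x.1 != x.2 -> distribution_function (refdist x).
Proof.
rewrite /refdist -val_eqE/=; case: ltngtP => // h _; exact: F_df.
Qed.

(** For a pair whose first mean is the larger, or equal, the lower p-value is an upper p-value of
    the reversed pair: the statistic changes sign under the swap and [F] is symmetric. Both sums
    thus take a single form. *)
Lemma rejectionsE (t : R) w : rejections F t w =
  \sum_(x in ordered_pairs) ((1 - refdist x (barT x.1 x.2 w) <= barPhi t)%R : nat)%:R.
Proof.
rewrite sum_ordered_pairs /rejections; congr (_ + _); apply: eq_bigr => x.
  rewrite !inE -andb_orr => /andP[x12 _]; have Fb := distribution_function_bounds _ (F_df x12).
  rewrite barPhi_invE ?Fb// /barpL /refdist/= ltnNge (ltnW x12)/= barT_sym F_symT//.

rewrite !inE -andb_orr => /andP[x12 _]; have Fb := distribution_function_bounds _ (F_df x12).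
rewrite barPhi_invE; first by rewrite /barpU /refdist x12.
by have /andP[h1 h2] := Fb (barT x.1 x.2 w); rewrite /barpU; apply/andP; split; lra.
Qed.

Variable eF : R.
Hypothesis eFle : null_approx_error F <= eF.

(** For s < 0 symmetry makes the absolute error the same as at -s, and barPhi (- s) <= barPhi s, so
    the relative bound persists. *)
Lemma refdist_tail x (s : R) : x.1 != x.2 -> `|s| <= 2 * Num.sqrt (ln m%:R) ->
  `|1 - refdist x s - barPhi s| <= eF * barPhi s.
Proof.
move=> x12.
wlog xlt : x x12 / (x.1 < x.2)%N.
  move=> h; have := x12; rewrite -val_eqE/=; case: ltngtP => // xlt _; first exact: h.
  have := h (x.2, x.1); rewrite /refdist/= xlt eq_sym x12.
  by rewrite ltnNge (ltnW xlt)/=; exact.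
rewrite /refdist xlt.
set L := 2 * _ => sL.
have Fb t := distribution_function_bounds t (F_df xlt).
have pos (t : R) : 0 <= t <= L -> `|1 - F x.1 x.2 t - barPhi t| <= eF * barPhi t.
  move=> /andP[t0 tL]; have b0 := barPhi_gt0 t.
  rewrite (_ : _ - _ = ((1 - F x.1 x.2 t) / barPhi t - 1) * barPhi t); last first.
    by rewrite mulrBl mul1r divfK// gt_eqF.
  rewrite normrM (gtr0_norm b0) ler_pM2r//; apply: le_trans eFle.
  rewrite /null_approx_error (bigD1 x)//= le_max; apply/orP; left.
  apply: ub_le_sup; last by exists t => //=; rewrite in_itv/= t0.
  exists (1 + (barPhi L)^-1) => _ [v /= + <-]; rewrite in_itv/= => /andP[v0 vL].
  apply: le_trans (ler_normB _ _) _; rewrite normr1 addrC lerD2l normrM.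
  have /andP[f0 f1] := Fb v.
  rewrite (ger0_norm (_ : 0 <= _ - _)) ?subr_ge0// ger0_norm ?invr_ge0 ?barPhi_ge0//.
  apply: le_trans (_ : (barPhi v)^-1 <= _).
    by rewrite ler_piMl ?invr_ge0 ?barPhi_ge0//; lra.
  by rewrite lef_pV2 ?posrE ?barPhi_gt0// barPhi_le.
have [s0|s0] := leP 0 s; first by apply: pos; rewrite s0 (le_trans (ler_norm _)).
have := pos (- s); rewrite -ler0_norm ?(ltW s0)// normr_ge0 sL => /(_ isT).
rewrite ler0_norm ?(ltW s0)// F_symT// => h.
have bs : barPhi (- s) = 1 - barPhi s by rewrite barPhiN /barPhi; ring.
move: h; rewrite bs => h.
have e0 : 0 <= eF.
  apply: le_trans eFle; rewrite /null_approx_error; elim/big_rec: _ => // y z _ z0.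
  by rewrite le_max z0 orbT.
have bb : 1 - barPhi s <= barPhi s.
  rewrite -bs; apply: barPhi_le; lra.
rewrite -normrN; apply: le_trans (_ : eF * (1 - barPhi s) <= _); last by rewrite ler_wpM2l.
apply: le_trans h; rewrite le_eqVlt; apply/orP; left; apply/eqP; congr (`|_|); ring.
Qed.

End rejections.

(** * Rejection compared with a threshold for the truncated statistic *)

Section sandwich.
Context {R : realType}.
Variables (F : R -> R) (eF tau L u iu T S k t : R).
Hypothesis F_homo : {homo F : x y / x <= y}.
Hypothesis F_tail : forall s : R, `|s| <= L ->
  `|1 - F s - barPhi s| <= eF * barPhi s.
Hypotheses (eF0 : 0 <= eF) (eF4 : eF <= 4^-1) (eFc : 8 * eF <= c0 * iu ^+ 2).
Hypotheses (tau1 : 1 <= tau) (utau : u = tau + 4).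
Hypotheses (iu0 : 0 < iu) (iuu : u * iu = 1).
Hypotheses (L0 : 0 <= L) (LL : L ^+ 2 = 2 * tau ^+ 2).
Hypotheses (k0 : 0 < k) (k1 : `|k - 1| <= 2 * iu ^+ 4) (SE : S = k * T).
Hypotheses (t0 : 0 <= t) (ttau : t <= tau).
Let kap := iu ^+ 2.

Let iu5 : 5 * iu <= 1.
Proof. by rewrite -[leRHS]iuu ler_pM2r// utau; have := tau1; lra. Qed.

Let kap0 : 0 < kap. Proof. exact: exprn_gt0. Qed.
Let kap1 : 25 * kap <= 1.
Proof. have := iu5; have := iu0; rewrite /kap; nra. Qed.

Let dev (s : R) : `|s| <= u -> `|(k - 1) * s| <= kap / 2.
Proof.
move=> su; rewrite normrM.
have h : `|k - 1| * `|s| <= 2 * iu ^+ 4 * u by rewrite ler_pM.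
have e : 2 * iu ^+ 4 * u = 2 * kap * iu by rewrite /kap -[RHS]mulr1 -iuu; ring.
have := kap0; have := iu5; have := iu0; rewrite e in h; nra.
Qed.

(** L is sqrt 2 times tau: the reference distribution is controlled slightly beyond the largest
    threshold, as the shifts require. *)
Let inL (s : R) : -1 <= s -> s <= tau + kap / 2 -> `|s| <= L.
Proof.
move=> s1 s2; have h1 := tau1; have h2 := kap0; have h3 := kap1.
rewrite -(@ler_sqr _ `|s|) ?nnegrE// real_normK ?num_real// LL; nra.
Qed.

(** Half of the shift [kap] pays for the factor k, by [dev]. The other half pays for the relative
    error [eF], since by [barPhi_shift_ge] it gains a factor 1 + c0 * kap / 2. The converse below
    splits the shift in the same way. *)
Lemma reject_of_ge : t + kap <= S -> 1 - F T <= barPhi t.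
Proof.
move=> hS; have h1 := tau1; have h2 := kap0; have h3 := kap1; have h4 := t0; have h5 := ttau.
set s := t + kap / 2.
have sT : s <= T.
  rewrite leNgt; apply/negP => Ts.
  have : k * T < k * s by rewrite ltr_pM2l.
  have : `|s| <= u by rewrite ger0_norm /s ?utau; lra.
  move=> /dev; rewrite ler_norml => /andP[_ e1].
  by move: hS; rewrite SE /s in e1 *; lra.
have := F_homo sT.
have : `|s| <= L by apply: inL; rewrite /s; lra.
move=> /F_tail; rewrite ler_norml => /andP[_ f1] f2.
have := @barPhi_shift_ge R t (kap / 2) _ _; rewrite -/s => b1.
have {}b1 : (1 + c0 * (kap / 2)) * barPhi s <= barPhi t by apply: b1; lra.
have e1 : eF * barPhi s <= c0 * (kap / 2) * barPhi s.
  by rewrite ler_wpM2r ?barPhi_ge0//; have := eFc; have := eF0; rewrite -/kap; lra.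
lra.
Qed.

Lemma ge_of_reject : 1 - F T <= barPhi t -> t - kap <= S.
Proof.
move=> hF; have h1 := tau1; have h2 := kap0; have h3 := kap1; have h4 := t0; have h5 := ttau.
rewrite leNgt; apply/negP => hS.
set s := t - kap / 2.
have sT : T <= s.
  rewrite leNgt; apply/negP => Ts.
  have : k * s < k * T by rewrite ltr_pM2l.
  have : `|s| <= u by rewrite ler_norml /s utau; apply/andP; split; lra.
  move=> /dev; rewrite ler_norml => /andP[e1 _].
  by move: hS; rewrite SE /s in e1 *; lra.
have := F_homo sT.
have : `|s| <= L by apply: inL; rewrite /s; lra.
move=> /F_tail; rewrite ler_norml => /andP[f1 _] f2.
have := @barPhi_shift_ge R s (kap / 2) _ _; rewrite (_ : s + kap / 2 = t); last by rewrite /s; ring.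
move=> b1.
have {}b1 : (1 + c0 * (kap / 2)) * barPhi t <= barPhi s by apply: b1; rewrite /s; lra.
have bt := barPhi_gt0 t.
have e0 := eF0; have e4 := eF4; have ec := eFc; rewrite -/kap in ec.
have c00 : 0 < c0 :> R := c0_gt0.
have ck : 0 < c0 * kap by rewrite mulr_gt0.
have b2 : (1 - eF) * ((1 + c0 * (kap / 2)) * barPhi t) <= (1 - eF) * barPhi s.
  by apply: ler_wpM2l => //; lra.
have b3 : 0 < ((1 - eF) * (1 + c0 * (kap / 2)) - 1) * barPhi t.
  by apply: mulr_gt0 => //; nra.
lra.
Qed.

End sandwich.

Section grid_arithmetic.
Context {R : realType}.

Definition Cdev : R := 64 * (2 * CM * expR 1 + 4 * CM ^+ 2 * expR 3).

Lemma Cdev_ge0 : 0 <= Cdev.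
Proof.
have CM0 : 0 <= CM :> R := ltW CM_gt0.
have h1 : 0 <= CM * expR 1 :> R by apply: mulr_ge0 => //; exact: expR_ge0.
have h3 : 0 <= CM ^+ 2 * expR 3 :> R.
  by apply: mulr_ge0; [exact: sqr_ge0|exact: expR_ge0].
rewrite /Cdev; lra.
Qed.

(** [a] stands for the number of oriented pairs and [M] for the number of groups. By [q1], barPhi s
    is at least of order 1/(u M). By [q2], the joint tail exceeds (barPhi s)^2 by a factor of order
    u^2 M^(1 - be) at most, where be = (1 - rho)/(1 + rho). *)
Lemma chebyshev_grid (rho eps u tau s a M : R) : 0 <= rho -> rho <= 1 ->
  0 < eps -> 4 <= u -> -1 <= s <= u -> s ^+ 2 <= tau ^+ 2 + 2 ->
  M = expR (tau ^+ 2 / 2) -> M ^+ 2 <= 4 * a ->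
  a * (2 * barPhi s + 4 * M * expR (1 - s ^+ 2 / (1 + rho))) /
    (eps / 4 * (a * barPhi s)) ^+ 2 <=
  Cdev / eps ^+ 2 * u ^+ 2 * M `^ (- ((1 - rho) / (1 + rho))).
Proof.
move=> rho0 rho1 e0 u4 su' s3 ME M2.
have b0 := barPhi_gt0 s.
have a0 : 0 < a.
  have : 0 < M ^+ 2 by rewrite ME exprn_gt0// expR_gt0.
  lra.
have d0 : 0 < eps / 4 * (a * barPhi s) by rewrite !mulr_gt0.
set Lm := tau ^+ 2 / 2 in ME.
have M0 : 0 < M by rewrite ME expR_gt0.
set be := (1 - rho) / (1 + rho).
have r1 : 0 < 1 + rho by lra.
have beE : 1 - be = 2 * (rho / (1 + rho)) by rewrite /be; field; lra.
have rr : 0 <= rho / (1 + rho) <= 2^-1.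
  rewrite divr_ge0 ?(ltW r1)//= ler_pdivrMr//; lra.
set JJ := expR (1 - _).
have -> : M `^ (- be) = expR (- be * Lm) by rewrite /powR gt_eqF// ME expRK.
set D := expR (- be * Lm).
have D0 : 0 < D by exact: expR_gt0.
have Lm0 : 0 <= Lm by rewrite divr_ge0 ?sqr_ge0.
have DM : 1 <= D * M.
  rewrite ME /D -expRD -[leLHS]expR0 ler_expR.
  have : 0 <= (1 - be) * Lm by rewrite mulr_ge0// beE; lra.
  lra.
have CM0 : 0 < CM :> R := CM_gt0.
have u0 : 0 < u by lra.
have ex := exp_le_barPhi (le_trans (ler1n R 4) u4) su'.
have q1 : 1 <= CM * expR 1 * u * M * barPhi s.
  have h : expR (- s ^+ 2 / 2) * (expR 1 * M) <= CM * u * barPhi s * (expR 1 * M).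
    by rewrite ler_wpM2r// mulr_ge0 ?expR_ge0// ltW.
  have : 1 <= expR (- s ^+ 2 / 2) * (expR 1 * M).
    by rewrite ME -!expRD -[leLHS]expR0 ler_expR /Lm; lra.
  lra.
have q2 : JJ <= (CM * u * barPhi s) ^+ 2 * expR 3 * (D * M).
  have h : expR (- s ^+ 2) <= (CM * u * barPhi s) ^+ 2.
    rewrite (_ : - s ^+ 2 = - s ^+ 2 / 2 + - s ^+ 2 / 2); last by lra.
    have c1 : 0 <= CM * u * barPhi s by apply: le_trans ex; exact: expR_ge0.
    by rewrite expRD -expr2 lerXn2r ?nnegrE ?expR_ge0.
  have h0 : 0 <= expR 3 * (D * M) by rewrite !mulr_ge0 ?expR_ge0// ltW.
  rewrite -mulrA; apply: le_trans (ler_wpM2r h0 h).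
  rewrite /JJ /D ME -!expRD ler_expR.
  have -> : - s ^+ 2 + (3 + (- be * Lm + Lm)) = - s ^+ 2 + 3 + (1 - be) * Lm by ring.
  have -> : s ^+ 2 / (1 + rho) = s ^+ 2 - s ^+ 2 * (rho / (1 + rho)) by field; lra.
  rewrite beE /Lm; case/andP: rr => r2 r3.
  have : s ^+ 2 * (rho / (1 + rho)) <= (tau ^+ 2 + 2) * (rho / (1 + rho)) by rewrite ler_wpM2r.
  lra.
rewrite ler_pdivrMr ?exprn_gt0//.
have key : 2 * barPhi s + 4 * M * JJ <=
    (2 * CM * expR 1 + 4 * CM ^+ 2 * expR 3) * u ^+ 2 * D * M ^+ 2 * barPhi s ^+ 2.
  have h1 : 1 <= CM * expR 1 * u * M * barPhi s * (u * (D * M)).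
    rewrite -[leLHS]mulr1 ler_pM// -[leLHS]mulr1 ler_pM//; lra.
  have h2 : 2 * barPhi s * 1 <= 2 * barPhi s * (CM * expR 1 * u * M * barPhi s * (u * (D * M))).
    by rewrite ler_wpM2l// mulr_ge0// ltW.
  have h3 : 4 * M * JJ <= 4 * M * ((CM * u * barPhi s) ^+ 2 * expR 3 * (D * M)).
    by rewrite ler_wpM2l// mulr_ge0// ltW.
  lra.
have h4 : a * (2 * barPhi s + 4 * M * JJ) <= a *
    ((2 * CM * expR 1 + 4 * CM ^+ 2 * expR 3) * u ^+ 2 * D * M ^+ 2 * barPhi s ^+ 2).
  by rewrite ler_wpM2l// ltW.
apply: le_trans h4 _.
set X := (2 * CM * expR 1 + 4 * CM ^+ 2 * expR 3).
have X0 : 0 <= X by have := Cdev_ge0; rewrite /Cdev -/X; lra.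
have -> : Cdev / eps ^+ 2 * u ^+ 2 * D * (eps / 4 * (a * barPhi s)) ^+ 2 =
  a * (X * u ^+ 2 * D * (4 * a) * barPhi s ^+ 2).
  by rewrite /Cdev -/X; field; lra.
rewrite ler_pM2l// ler_pM2r ?exprn_gt0// ler_wpM2l//.
by rewrite !mulr_ge0// ?sqr_ge0// ltW.
Qed.

(** The shift to a grid point costs a factor 1 + eps/4 and the deviation of the count there a factor
    1 + eps/2; their product is at most 1 + eps because eps <= 1. *)
Lemma ratio_sandwich (a eps u t k s s' r up lo : R) : 0 < a -> 0 < eps -> eps <= 1 ->
  1 <= u -> 0 <= t -> 0 <= k -> t + k <= u -> k * u <= 1 -> C1 * u * k <= eps / 4 ->
  t - k <= s -> s' <= t + k -> r <= up -> lo <= r ->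
  `|up - a * barPhi s| <= eps / 2 * (a * barPhi s) ->
  `|lo - a * barPhi s'| <= eps / 2 * (a * barPhi s') ->
  `|r / (barPhi t * a) - 1| <= eps.
Proof.
move=> a0 e0 e1 u1 t0 k0 tk ku cc ts ts' rup lor.
rewrite !ler_norml => /andP[_ c1] /andP[c2 _].
have b0 := barPhi_gt0 t.
have sh1 : barPhi s <= (1 + eps / 4) * barPhi t.
  apply: le_trans (barPhi_le ts) _.
  have tu : -1 <= t <= u by apply/andP; split; lra.
  apply: le_trans (barPhi_shift_le u1 tu k0 ku) _.
  by rewrite ler_wpM2r ?(ltW b0)//; lra.
have sh2 : barPhi t <= (1 + eps / 4) * barPhi s'.
  have tu : -1 <= t + k <= u by apply/andP; split; lra.
  have := barPhi_shift_le u1 tu k0 ku; rewrite addrK => h.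
  apply: le_trans h _; apply: ler_pM; rewrite ?barPhi_ge0 ?barPhi_le//; last by lra.
  have C10 : 0 <= C1 :> R := ltW C1_gt0.
  have : 0 <= C1 * u * k by rewrite mulr_ge0// mulr_ge0//; lra.
  lra.
have sa1 : a * barPhi s <= (1 + eps / 4) * (barPhi t * a).
  by rewrite mulrC mulrA ler_pM2r.
have sa2 : barPhi t * a <= (1 + eps / 4) * (a * barPhi s').
  by rewrite (mulrC a) mulrA ler_pM2r.
have Y0 : 0 < barPhi t * a by rewrite mulr_gt0.
have Y1 : 0 < a * barPhi s' by rewrite mulr_gt0 ?barPhi_gt0.
have Y2 : 0 < a * barPhi s by rewrite mulr_gt0 ?barPhi_gt0.
apply/andP; split.
  rewrite lerBrDr ler_pdivlMr//.
  set Y := barPhi t * _ in sa1 sa2 Y0 *; set X := a * barPhi s' in sa2 c2 Y1.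
  have m1 : (1 - eps) * Y <= (1 - eps) * ((1 + eps / 4) * X).
    by apply: ler_wpM2l => //; lra.
  have m2' : 0 <= eps ^+ 2 * X by rewrite mulr_ge0 ?sqr_ge0// ltW.
  have m3 : 0 <= eps * X by rewrite mulr_ge0// ltW.
  lra.
rewrite lerBlDr ler_pdivrMr//.
set Y := barPhi t * _ in sa1 sa2 Y0 *; set X := a * barPhi s in sa1 c1 Y2.
have m1 : (1 + eps / 2) * X <= (1 + eps / 2) * ((1 + eps / 4) * Y).
  by apply: ler_wpM2l => //; lra.
have m3 : 0 <= eps * Y by rewrite mulr_ge0// ltW.
have m2' : eps * (eps * Y) <= 1 * (eps * Y) by rewrite ler_wpM2r.
lra.
Qed.

End grid_arithmetic.

(** * Concentration *)

Section experiment_bound.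
Context {R : realType}.
Variable E : experiment R.
Notation m := (ngroups E).
Notation idx := {i : 'I_m & 'I_(gsize i)}.
Notation N i := ((gsize i)%:R : R).
Notation P := (prob E).
Implicit Types (i j : 'I_m) (x y : 'I_m * 'I_m).

Variables (rho : R).
Hypotheses (rho0 : 0 <= rho) (rho1 : rho <= 1).
Hypothesis wt_rho : forall i j, i != j -> wt i <= rho * (wt i + wt j).

(** Only a group on the same side of both pairs contributes positively, and distinct pairs have at
    most one such group. Its variance is at most rho times [dd x] squared and rho times [dd y]
    squared, hence at most rho times their geometric mean. *)
Lemma cp_inner x y : x.1 != x.2 -> y.1 != y.2 -> y != x ->
  \sum_i N i * (cp x i * cp y i) <= rho.
Proof.
move=> x12 y12 yx; under eq_bigr do rewrite cp_mul.
rewrite sum_dl_mul.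
have dxy : 0 < dd x * dd y by rewrite mulr_gt0 ?dd_gt0.
have w0 i : 0 <= wt i / (dd x * dd y) by rewrite divr_ge0// ltW// wt_gt0.
have key i : wt i <= rho * dd x ^+ 2 -> wt i <= rho * dd y ^+ 2 ->
    wt i / (dd x * dd y) <= rho.
  move=> h1 h2; rewrite ler_pdivrMr//.
  rewrite -(@ler_sqr _ (wt i)) ?nnegrE ?(ltW (wt_gt0 _))//; last first.
    by rewrite mulr_ge0// ltW.
  rewrite (_ : (rho * (dd x * dd y)) ^+ 2 = (rho * dd x ^+ 2) * (rho * dd y ^+ 2));
    last by ring.
  by rewrite expr2 ler_pM// ltW// wt_gt0.
have h1 i j (b : bool) : 0 <= b%:R * (wt i / (dd x * dd y)) by rewrite mulr_ge0.
have [e1|n1] := eqVneq x.1 y.1.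
  have n2 : (x.2 == y.2) = false.
    apply/negbTE; apply: contra yx => /eqP e2.
    by rewrite [y]surjective_pairing [x]surjective_pairing -e1 -e2.
  rewrite n2 mul0r addr0 mul1r.
  have : wt x.1 / (dd x * dd y) <= rho.
    apply: key; rewrite dd_sqr; first exact: wt_rho.
    by rewrite e1; exact: wt_rho.
  have := h1 x.1 x.1 (x.1 == y.2); have := h1 x.2 x.2 (x.2 == y.1); lra.
rewrite mul0r sub0r.
have [e2|n2] := eqVneq x.2 y.2; last first.
  rewrite mul0r addr0.
  have := h1 x.1 x.1 (x.1 == y.2); have := h1 x.2 x.2 (x.2 == y.1).
  have := rho0; lra.
have : wt x.2 / (dd x * dd y) <= rho.
  apply: key; rewrite dd_sqr addrC; first by apply: wt_rho; rewrite eq_sym.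
  by rewrite e2; apply: wt_rho; rewrite eq_sym.
have := h1 x.1 x.1 (x.1 == y.2); have := h1 x.2 x.2 (x.2 == y.1).
rewrite mul1r; lra.
Qed.

Variables (p K B : R).
Hypothesis p2 : 2 <= p.
Hypothesis moment : forall i : 'I_m,
  ('E_P[fun w => (`|(obs1 i w - mean i) / sd i| `^ p)%R] <= K%:E)%E.
Hypotheses (B0 : 0 < B) (K0 : 0 <= K).
(* g bounds the (gsize i)^(-1/2), sn the (gsize i)^(1/2), and zeta the Lindeberg
   errors of all the sums considered. *)
Variables (u iu g sn zeta : R).
Hypotheses (u4 : 4 <= u) (iu0 : 0 < iu) (iu4 : iu <= 4^-1) (iuu : u * iu = 1).
Hypotheses (g0 : 0 <= g) (gN : forall i, 1 <= g ^+ 2 * N i).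
Hypotheses (sn0 : 0 <= sn) (nN : forall i, N i <= sn ^+ 2).
Hypothesis Z : 4 * sn * (K * B `^ (1 - p)) + 4 * (K * B `^ (2 - p)) +
  8 * (g * B) + 16 * g ^+ 2 + 2 * (g ^+ 2 * B2 B) <= zeta.
Hypothesis uz : cE * 27 * (u ^+ 20 * zeta) <= 1.

Let K1 := K * B `^ (1 - p).
Let K2 := K * B `^ (2 - p).
Let K10 : 0 <= K1. Proof. by rewrite mulr_ge0 ?powR_ge0. Qed.
Let K20 : 0 <= K2. Proof. by rewrite mulr_ge0 ?powR_ge0. Qed.
Let B20 : 0 <= B2 B. Proof. by rewrite addr_ge0 ?sqr_ge0. Qed.
Let gB0 : 0 <= g * B. Proof. by rewrite mulr_ge0// ltW. Qed.
Let gg0 : 0 <= g ^+ 2. Proof. exact: sqr_ge0. Qed.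
Let gB20 : 0 <= g ^+ 2 * B2 B. Proof. exact: mulr_ge0. Qed.
Let sK0 : 0 <= sn * K1. Proof. exact: mulr_ge0. Qed.

Let zeta0 : 0 <= zeta.
Proof.
apply: le_trans Z; rewrite -/K1 -/K2.
have := sK0; have := K20; have := gB0; have := gg0; have := gB20; lra.
Qed.

Let zz : [/\ 8 * (g * B) <= zeta, 16 * g ^+ 2 <= zeta & 2 * (g ^+ 2 * B2 B) <= zeta].
Proof.
have := Z; rewrite -/K1 -/K2.
have := sK0; have := K20; have := gB0; have := gg0; have := gB20.
by move=> *; split; lra.
Qed.

Let u1 : 1 <= u. Proof. by apply: le_trans u4; rewrite ler1n. Qed.
Let cE1 : 1 <= cE :> R. Proof. by rewrite /cE lerDl expR_ge0. Qed.

Let upow k : (k <= 20)%N -> cE * 27 * (u ^+ k * zeta) <= 1.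
Proof.
move=> k20; apply: le_trans uz; rewrite ler_wpM2l//.
  by rewrite mulr_ge0// (le_trans ler01).
by rewrite ler_wpM2r// ler_weXn2l.
Qed.

Let upow' k : (k <= 20)%N -> 27 * (u ^+ k * zeta) <= 1.
Proof.
move=> /upow; apply: le_trans; rewrite -mulrA ler_peMl//.
by rewrite mulr_ge0// mulr_ge0// exprn_ge0// (le_trans ler01).
Qed.

Let zeta1 : 27 * zeta <= 1. Proof. by have := @upow' 0; rewrite expr0 mul1r; apply. Qed.

(** The bounds 4 * sn, 4 and 2 * g are wide enough for the sum of two pair statistics. *)
Lemma errS_le (c : 'I_m -> R) (gm : R) : \sum_i N i * `|c i| <= 4 * sn ->
  \sum_i N i * c i ^+ 2 <= 4 -> 0 <= gm -> gm <= 2 * g ->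
  errS p K B c gm <= zeta.
Proof.
move=> h1 h2 gm0 gmg; apply: le_trans Z; rewrite /errS -/K1 -/K2.
have gB' : gm * B <= 2 * (g * B) by rewrite mulrA ler_wpM2r// ltW.
have gg' : gm ^+ 2 <= 4 * g ^+ 2.
  by rewrite (_ : 4 * g ^+ 2 = (2 * g) ^+ 2); [rewrite lerXn2r ?nnegrE// mulr_ge0|ring].
have h3 : (\sum_i N i * `|c i|) * K1 <= 4 * sn * K1 by rewrite ler_wpM2r.
have h4 : (\sum_i N i * c i ^+ 2) * (K2 + gm * B + gm ^+ 2) <=
    4 * (K2 + 2 * (g * B) + 4 * g ^+ 2).
  apply: ler_pM => //.
  - by apply: sumr_ge0 => i _; rewrite mulr_ge0 ?sqr_ge0.
  - by rewrite !addr_ge0 ?sqr_ge0// mulr_ge0// ltW.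
  - by rewrite !lerD.
have := gB20; lra.
Qed.

Lemma errS_ge0 (c : 'I_m -> R) (gm : R) : 0 <= gm -> 0 <= errS p K B c gm.
Proof.
move=> gm0; apply: addr_ge0; apply: mulr_ge0 => //.
- by apply: sumr_ge0 => i _; rewrite mulr_ge0.
- by apply: sumr_ge0 => i _; rewrite mulr_ge0 ?sqr_ge0.
- by rewrite !addr_ge0 ?sqr_ge0// mulr_ge0// ltW.
Qed.

Let cp_sq_le x i : x.1 != x.2 -> N i * cp x i ^+ 2 <= 1.
Proof.
move=> x12; rewrite -[leRHS](cp_norm x12) (bigD1 i)//= lerDl.
by apply: sumr_ge0 => j _; rewrite mulr_ge0 ?sqr_ge0.
Qed.

Let sq_le_g (c : R) i : N i * c ^+ 2 <= 1 -> `|c| <= g.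
Proof.
move=> h; rewrite -(@ler_sqr _ `|c|) ?nnegrE// real_normK ?num_real//.
have h1 : c ^+ 2 <= g ^+ 2 * (N i * c ^+ 2).
  by rewrite mulrA ler_peMl ?sqr_ge0// gN.
by apply: (le_trans h1); rewrite ler_piMr.
Qed.

Lemma cp_le x i : x.1 != x.2 -> `|cp x i| <= g.
Proof. by move=> x12; apply: (@sq_le_g _ i); exact: cp_sq_le. Qed.

Lemma cp_l1 x : x.1 != x.2 -> \sum_i N i * `|cp x i| <= 2 * sn.
Proof.
move=> x12; apply: (@le_trans _ _ (\sum_i ((i == x.1)%:R * sn + (i == x.2)%:R * sn))).
  apply: ler_sum => i _.
  have h : N i * `|cp x i| <= sn.
    rewrite -(@ler_sqr _ (N i * `|cp x i|)) ?nnegrE ?mulr_ge0//.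
    rewrite exprMn real_normK ?num_real// expr2 -mulrA.
    by apply: le_trans (nN i); rewrite ler_piMr// cp_sq_le.
  case: (eqVneq i x.1) => [_|n1].
    by rewrite mul1r; apply: (le_trans h); rewrite lerDl mulr_ge0.
  case: (eqVneq i x.2) => [_|n2]; first by rewrite mul0r add0r mul1r.
  by rewrite /cp /dl (negbTE n1) (negbTE n2) subrr mul0r normr0 mulr0 !mul0r addr0.
rewrite big_split/= (sum_delta x.1 (fun=> sn)) (sum_delta x.2 (fun=> sn)); lra.
Qed.

Theorem pair_tail x (t : R) : x.1 != x.2 -> -1 <= t <= u - 1 ->
  `|fine (P [set w | t <= Sx B x w]) - barPhi t| <=
  C0 * (iu + u ^+ 20 * zeta) * barPhi t.
Proof.
move=> x12 tu.
have er : errS p K B (cp x) g <= zeta.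
  have sn0' := sn0; have g0' := g0.
  apply: errS_le => //; last by lra.
  - by apply: (le_trans (cp_l1 x12)); lra.
  - by rewrite cp_norm//; lra.
have er0 : 0 <= errS p K B (cp x) g by exact: errS_ge0.
have u0 : 0 <= u by rewrite (le_trans ler01).
have ule k : u ^+ k * errS p K B (cp x) g <= u ^+ k * zeta.
  by rewrite ler_wpM2l// exprn_ge0.
apply: le_trans (_ : C0 * (iu + u ^+ 20 * errS p K B (cp x) g) * barPhi t <= _).
  apply: (LF_tail p2 moment B0 K0 (fun i => cp_le i x12) (cp_norm x12)) => //.
  - have [z1 _ _] := zz; have := @upow' 1 isT; rewrite expr1.
    have : 2 * u * (g * B) <= 2 * u * zeta.
      rewrite ler_wpM2l//; first by rewrite mulr_ge0.
      by have := gB0; lra.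
    have : 0 <= u * zeta by rewrite mulr_ge0.
    lra.
  - have := @upow 3 isT; apply: le_trans.
    by rewrite -mulrA ler_wpM2l// mulr_ge0// (le_trans ler01).
  - have := @upow' 20 isT; have := ule 20%N.
    have : 0 <= u ^+ 20 * zeta by rewrite mulr_ge0// exprn_ge0.
    lra.
rewrite ler_wpM2r ?barPhi_ge0// ler_wpM2l//.
  exact: C0_ge0.
by rewrite lerD2l.
Qed.

Lemma LF_add (c1 c2 : 'I_m -> R) w :
  LF B (fun i => c1 i + c2 i) w = LF B c1 w + LF B c2 w.
Proof.
by rewrite /LF /SXT -big_split/=; apply: eq_bigr => z _; rewrite /fz mulrDl.
Qed.

(** Both events force the sum of the statistics, of variance at most 2 + 2 rho, to reach 2 t. The
    choice l = t/(1 + rho) minimizes - 2 l t + l^2 (1 + rho). *)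
Theorem pair_joint x y (t : R) : x.1 != x.2 -> y.1 != y.2 -> y != x ->
  -1 <= t <= u ->
  fine (P ([set w | t <= Sx B x w] `&` [set w | t <= Sx B y w])) <=
  expR (1 - t ^+ 2 / (1 + rho)).
Proof.
move=> x12 y12 yx /andP[t1 tu].
have r0 : 0 < 1 + rho by rewrite ltr_pwDl.
have mxy : measurable ([set w | t <= Sx B x w] `&` [set w | t <= Sx B y w]).
  by apply: measurableI; exact: measurable_LF_ge.
(* For t < 0 the right-hand side is at least 1, because t^2 <= 1. *)
have [t0|t0] := ltP t 0.
  apply: (@le_trans _ _ 1).
    rewrite -lee_fin fineK ?fin_num_measure//; exact: probability_le1.
  rewrite -[leLHS]expR0 ler_expR subr_ge0 ler_pdivrMr// mul1r.
  by have := rho0; nra.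
pose c i := cp x i + cp y i.
have cg i : `|c i| <= 2 * g.
  apply: (le_trans (ler_normD _ _)); have := cp_le i x12; have := cp_le i y12; lra.
have c1 : \sum_i N i * `|c i| <= 4 * sn.
  apply: (@le_trans _ _ (\sum_i (N i * `|cp x i| + N i * `|cp y i|))).
    by apply: ler_sum => i _; rewrite -mulrDr ler_wpM2l// ler_normD.
  by rewrite big_split/=; have := cp_l1 x12; have := cp_l1 y12; lra.
have c2 : \sum_i N i * c i ^+ 2 <= 2 + 2 * rho.
  rewrite (eq_bigr (fun i => N i * cp x i ^+ 2 + N i * cp y i ^+ 2 +
     2 * (N i * (cp x i * cp y i)))); last by move=> i _; rewrite /c; ring.
  rewrite !big_split/= -mulr_sumr !cp_norm//.
  by have := cp_inner x12 y12 yx; lra.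
have er : errS p K B c (2 * g) <= zeta.
  apply: errS_le => //; first by have := rho1; lra.
  by rewrite mulr_ge0.
set l := t / (1 + rho).
have l0 : 0 <= l by rewrite divr_ge0// ltW.
have lu : l <= u.
  rewrite ler_pdivrMr//; apply: (le_trans tu); rewrite ler_peMr//.
    by rewrite (le_trans ler01).
  by rewrite lerDl.
have lr : l * (1 + rho) = t by rewrite divfK// gt_eqF.
have [z1 _ _] := zz.
have lb : l * (2 * g * B) <= 1.
  have h1 := @upow' 1 isT; rewrite expr1 in h1.
  have : l * (2 * g * B) <= u * zeta.
    apply: ler_pM => //; first by rewrite -mulrA mulr_ge0.
    by rewrite -mulrA; have := gB0; lra.
  have : 0 <= u * zeta by rewrite mulr_ge0// (le_trans ler01).
  lra.
have := @LF_chernoff _ _ p K B p2 moment B0 K0 c (2 * g) l (2 * t) cg l0 lb.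
move=> ch; apply: (@le_trans _ _ (fine (P [set w | 2 * t <= LF B c w]))).
  apply: fine_le; rewrite ?fin_num_measure//; first exact: measurable_LF_ge.
  apply: le_measure; rewrite ?inE//; first exact: measurable_LF_ge.
  by move=> w [/= h1 h2]; rewrite /c LF_add; move: h1 h2; rewrite /Sx; lra.
apply: (le_trans ch); rewrite ler_expR.
have e1 : cE * (1 + l) ^+ 3 * errS p K B c (2 * g) <= 1.
  apply: le_trans (@upow 3 isT); rewrite -!(mulrA cE) ler_wpM2l//.
    by rewrite (le_trans ler01).
  apply: (@le_trans _ _ ((2 * u) ^+ 3 * zeta)).
    apply: ler_pM => //; first by rewrite exprn_ge0// addr_ge0.
      by apply: errS_ge0; rewrite mulr_ge0.
    rewrite lerXn2r ?nnegrE ?addr_ge0//; last by have := u1; lra.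
    by rewrite mulr_ge0// (le_trans ler01).
  have : 0 <= u ^+ 3 * zeta by rewrite mulr_ge0// exprn_ge0// (le_trans ler01).
  rewrite exprMn; lra.
have e2 : l ^+ 2 * (\sum_i N i * c i ^+ 2) / 2 <= l * t.
  apply: (@le_trans _ _ (l ^+ 2 * (2 + 2 * rho) / 2)).
    by rewrite ler_wpM2r// ler_wpM2l// sqr_ge0.
  by rewrite -[X in _ <= l * X]lr; lra.
have -> : t ^+ 2 / (1 + rho) = l * t by rewrite /l expr2 mulrAC.
lra.
Qed.

Definition cm (s : R) i0 i : R := s * ((i == i0)%:R * (Num.sqrt (N i))^-1).
Definition cq (s : R) i0 i : R := s * ((i == i0)%:R * (N i)^-1).

Let bool_sq (b : bool) : (b%:R : R) ^+ 2 = b%:R.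
Proof. by case: b; rewrite ?expr1n ?expr0n. Qed.

(** [var_tail] needs l as large as 2 * u^6: the sample variances must be accurate to u^(-4), and the
    exponent l u^(-4) should still be 2 u^2. The cube of l accounts for u^18. *)
Let mgf_err (l e : R) : 0 <= l -> l <= 2 * u ^+ 6 -> 0 <= e -> e <= zeta ->
  cE * (1 + l) ^+ 3 * e <= 1.
Proof.
move=> l0 lu e0 ez; apply: le_trans (@upow 18 isT); rewrite -!(mulrA cE) ler_wpM2l//.
  by rewrite (le_trans ler01).
have u60 : 1 <= u ^+ 6 by rewrite exprn_ege1.
rewrite mulrA; apply: ler_pM => //; first by rewrite exprn_ge0// addr_ge0.
rewrite (_ : 27 * u ^+ 18 = (3 * u ^+ 6) ^+ 3); last by rewrite exprMn -exprM; ring.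
by rewrite lerXn2r ?nnegrE ?addr_ge0//; lra.
Qed.

Let u6 : u <= u ^+ 6.
Proof. by rewrite -[leLHS]expr1 ler_weXn2l. Qed.

(** With l = 2 u the exponent is - 4 u^2 + 2 u^2 + 1. Once u exceeds sqrt (2 ln m), this tail is
    small enough for a union over all groups. *)
Lemma mean_tail (s : R) i0 : `|s| = 1 ->
  fine (P [set w | 2 * u <= LF B (cm s i0) w]) <= expR (1 - 2 * u ^+ 2).
Proof.
move=> s1.
have s2 : s ^+ 2 = 1 by rewrite -[LHS]real_normK ?num_real// s1 expr1n.
have sN i : Num.sqrt (N i) ^+ 2 = N i by rewrite sqr_sqrtr.
have sN0 i : 0 < Num.sqrt (N i) by rewrite sqrtr_gt0 N_gt0.
have c2 i : N i * cm s i0 i ^+ 2 = (i == i0)%:R * 1.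
  rewrite /cm !exprMn s2 mul1r bool_sq exprVn sN mulrCA divff ?mulr1//.
  by rewrite gt_eqF ?N_gt0.
have cg i : `|cm s i0 i| <= g.
  by apply: (@sq_le_g _ i); rewrite c2 mulr1 lern1 leq_b1.
have e2 : \sum_i N i * cm s i0 i ^+ 2 = 1.
  by under eq_bigr do rewrite c2; rewrite (sum_delta i0 (fun=> 1)).
have e1 : \sum_i N i * `|cm s i0 i| <= sn.
  rewrite (eq_bigr (fun i => (i == i0)%:R * Num.sqrt (N i))); last first.
    move=> i _; rewrite /cm normrM s1 mul1r normrM !ger0_norm ?invr_ge0//.
    rewrite mulrCA -{1}sN expr2 mulfK// gt_eqF//.
  rewrite sum_delta -(@ler_sqr _ (Num.sqrt _)) ?nnegrE ?sqrtr_ge0// sN.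
  exact: nN.
have sn0' := sn0; have g0' := g0; have u1' := u1; have u6' := u6.
have er : errS p K B (cm s i0) g <= zeta.
  by apply: errS_le => //; rewrite ?e2; lra.
have [z1 _ _] := zz.
have lb : 2 * u * (g * B) <= 1.
  have h1 := @upow' 1 isT; rewrite expr1 in h1.
  have : u * (g * B) <= u * zeta.
    by rewrite ler_wpM2l//; [lra|have := gB0; lra].
  have : 0 <= u * zeta by rewrite mulr_ge0//; lra.
  lra.
have u20 : 0 <= 2 * u by lra.
apply: le_trans (LF_chernoff p2 moment B0 K0 (2 * u) cg u20 lb) _.
rewrite ler_expR e2.
have := @mgf_err (2 * u) _ u20 ltac:(lra) (errS_ge0 (cm s i0) g0) er.
lra.
Qed.

Lemma var_tail (s : R) i0 : `|s| = 1 ->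
  fine (P [set w | iu ^+ 4 <= QF B (cq s i0) w]) <= expR (1 - 2 * u ^+ 2).
Proof.
move=> s1.
have s2 : s ^+ 2 = 1 by rewrite -[LHS]real_normK ?num_real// s1 expr1n.
have N0 i : N i != 0 by rewrite gt_eqF ?N_gt0.
have iN i : (N i)^-1 <= g ^+ 2.
  by rewrite -[(N i)^-1]mul1r ler_pdivrMr ?N_gt0.
have iN0 i : 0 <= (N i)^-1 by rewrite invr_ge0.
have cn i : `|cq s i0 i| = (i == i0)%:R * (N i)^-1.
  by rewrite /cq normrM s1 mul1r ger0_norm// mulr_ge0.
have cg i : `|cq s i0 i| <= g ^+ 2.
  by rewrite cn; case: eqP => _; rewrite ?mul1r ?mul0r.
have e1 : \sum_i N i * `|cq s i0 i| = 1.
  rewrite (eq_bigr (fun i => (i == i0)%:R * 1)) ?(sum_delta i0 (fun=> 1))//.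
  by move=> i _; rewrite cn mulrCA divff.
have e2 : \sum_i N i * cq s i0 i ^+ 2 <= g ^+ 2.
  rewrite (eq_bigr (fun i => (i == i0)%:R * (N i)^-1)) ?sum_delta//.
  move=> i _; rewrite -real_normK ?num_real// cn exprMn bool_sq mulrCA expr2.
  by rewrite mulVKf.
have [_ z2 z3] := zz.
have u1' := u1; have gB20' := gB20; have zeta1' := zeta1; have K20' := K20.
have er : errQ p K B (cq s i0) (g ^+ 2) <= zeta.
  apply: le_trans Z; rewrite /errQ e1 mul1r -/K1 -/K2.
  have : (\sum_i N i * cq s i0 i ^+ 2) * (B2 B * (1 + g ^+ 2 * B2 B)) <=
      g ^+ 2 * (B2 B * 2).
    apply: ler_pM => //; first by apply: sumr_ge0 => i _; rewrite mulr_ge0 ?sqr_ge0.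
      by rewrite mulr_ge0// addr_ge0.
    by rewrite ler_wpM2l//; lra.
  have := sK0; have := gB0; have := gg0; rewrite mulrA; lra.
have er0 : 0 <= errQ p K B (cq s i0) (g ^+ 2).
  rewrite /errQ e1 mul1r; apply: addr_ge0 => //; apply: mulr_ge0.
    by apply: sumr_ge0 => i _; rewrite mulr_ge0 ?sqr_ge0.
  by rewrite mulr_ge0// addr_ge0.
have u60 : 0 <= u ^+ 6 by rewrite exprn_ge0//; lra.
have l0 : 0 <= 2 * u ^+ 6 by rewrite mulr_ge0.
have lb : 2 * u ^+ 6 * (g ^+ 2 * B2 B) <= 1.
  have h1 := @upow' 6 isT.
  have : u ^+ 6 * (2 * (g ^+ 2 * B2 B)) <= u ^+ 6 * zeta by rewrite ler_wpM2l.
  have : 0 <= u ^+ 6 * zeta by rewrite mulr_ge0.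
  lra.
apply: le_trans (QF_chernoff p2 moment B0 K0 (iu ^+ 4) cg l0 lb) _.
rewrite ler_expR.
have -> : 2 * u ^+ 6 * iu ^+ 4 = 2 * u ^+ 2.
  have -> : 2 * u ^+ 6 * iu ^+ 4 = 2 * u ^+ 2 * (u * iu) ^+ 4 by ring.
  by rewrite iuu expr1n mulr1.
have := @mgf_err (2 * u ^+ 6) _ l0 (lexx _) er0 er.
lra.
Qed.

Let ug : 64 * (u ^+ 6 * g ^+ 2) <= 1.
Proof.
have [_ z2 _] := zz; have u60 : 0 <= u ^+ 6 by rewrite exprn_ge0// (le_trans ler01).
have := @upow' 6 isT; have := ler_wpM2l u60 z2.
have : 0 <= u ^+ 6 * zeta by rewrite mulr_ge0.
lra.
Qed.

(** The Chernoff bounds are one-sided; a sign attached to each group yields both sides. *)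
Let sgn (b : bool) : R := if b then 1 else -1.
Let sgn1 b : `|sgn b| = 1. Proof. by case: b; rewrite /sgn ?normrN normr1. Qed.

(* Outside bad nothing is truncated, and sample means and variances are close to
   their targets. *)
Definition bad : set (space E) :=
  [set w | exists z : idx, B < `|Yz z w|] `|`
  ([set w | exists ib : 'I_m * bool, 2 * u <= LF B (cm (sgn ib.2) ib.1) w] `|`
   [set w | exists ib : 'I_m * bool, iu ^+ 4 <= QF B (cq (sgn ib.2) ib.1) w]).

Let mY (z : idx) : measurable [set w | B < `|Yz z w|].
Proof.
have mn : measurable_fun setT (fun w => `|Yz z w|).
  by apply: measurableT_comp => //; exact: measurable_Yz.
have := mn measurableT `]B, +oo[%classic (measurable_itv _).
by rewrite setTI; congr (measurable _); apply/seteqP; split=> w /=;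
  rewrite in_itv/= andbT.
Qed.

Let mL (ib : 'I_m * bool) :
  measurable [set w | 2 * u <= LF B (cm (sgn ib.2) ib.1) w].
Proof. exact: measurable_LF_ge. Qed.

Let mQ (ib : 'I_m * bool) :
  measurable [set w | iu ^+ 4 <= QF B (cq (sgn ib.2) ib.1) w].
Proof. exact: measurable_QF_ge. Qed.

Lemma measurable_bad : measurable bad.
Proof.
by apply: measurableU; [|apply: measurableU]; exact: measurable_exists.
Qed.

Lemma bad_prob : fine (P bad) <=
  m%:R * (sn ^+ 2 * (K * B `^ (- p))) + m%:R * (4 * expR (1 - 2 * u ^+ 2)).
Proof.
have mA1 := measurable_exists mY.
have mA2 := measurable_exists mL.
have mA3 := measurable_exists mQ.
apply: le_trans (prob_setU_le P mA1 (measurableU _ _ mA2 mA3)) _.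
apply: lerD.
  apply: le_trans (prob_exists_le P mY) _.
  apply: (@le_trans _ _ (\sum_(z : idx) (K * B `^ (- p)))).
    by apply: ler_sum => z _; exact: (obs_tail p2 moment B0 z).
  rewrite (sum_tag (fun=> K * B `^ (- p))).
  apply: (@le_trans _ _ (\sum_(i < m) sn ^+ 2 * (K * B `^ (- p)))).
    by apply: ler_sum => i _; rewrite ler_wpM2r ?mulr_ge0 ?powR_ge0.
  by rewrite sumr_const card_ord mulr_natl.
apply: le_trans (prob_setU_le P mA2 mA3) _.
have card2 (c : R) : \sum_(ib : 'I_m * bool) c = m%:R * (2 * c).
  rewrite sumr_const card_prod card_ord card_bool -(mulr_natl c) natrM; ring.
rewrite (_ : m%:R * _ = m%:R * (2 * expR (1 - 2 * u ^+ 2)) +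
  m%:R * (2 * expR (1 - 2 * u ^+ 2))); last by ring.
rewrite -card2; apply: lerD.
  apply: le_trans (prob_exists_le P mL) _; apply: ler_sum => -[i b] _ /=.
  exact: mean_tail.
apply: le_trans (prob_exists_le P mQ) _; apply: ler_sum => -[i b] _ /=.
exact: var_tail.
Qed.

Lemma good_barT w x : ~ bad w -> x.1 != x.2 -> exists k : R,
  [/\ 0 < k, `|k - 1| <= 2 * iu ^+ 4 & Sx B x w = k * barT x.1 x.2 w].
Proof.
move=> /not_orP[n1 /not_orP[n2 n3]] x12.
have YB z : `|Yz z w| <= B.
  by rewrite leNgt; apply/negP => h; apply: n1; exists z.
apply: (barT_good YB u4 iu0 iu4 iuu gN ug) => // i.
- have e (s : R) : LF B (cm s i) w = s * (SY i w / Num.sqrt (N i)).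
    rewrite (LF_good YB) (eq_bigr (fun j => (j == i)%:R *
      (s * (SY j w / Num.sqrt (N j))))); first by rewrite sum_delta.
    by move=> j _; rewrite /cm; ring.
  have h b : sgn b * (SY i w / Num.sqrt (N i)) < 2 * u.
    by rewrite -e ltNge; apply/negP => h; apply: n2; exists (i, b).
  have := h true; have := h false; rewrite /sgn mul1r mulN1r => h1 h2.
  by rewrite ler_norml; apply/andP; split; lra.
- have N0 : N i != 0 by rewrite gt_eqF ?N_gt0.
  have e (s : R) : QF B (cq s i) w = s * (SQ i w / N i - 1).
    rewrite (QF_good YB) (eq_bigr (fun j => (j == i)%:R *
      (s * ((SQ j w - N j) / N j)))); last by move=> j _; rewrite /cq; ring.
    by rewrite sum_delta mulrBl divff.
  have h b : sgn b * (SQ i w / N i - 1) < iu ^+ 4.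
    by rewrite -e ltNge; apply/negP => h; apply: n3; exists (i, b).
  have := h true; have := h false; rewrite /sgn mul1r mulN1r => h1 h2.
  by rewrite ler_norml; apply/andP; split; lra.
Qed.

Lemma Sx_indep x y (t : R) : [/\ x.1 != y.1, x.1 != y.2, x.2 != y.1 & x.2 != y.2] ->
  P ([set w | t <= Sx B x w] `&` [set w | t <= Sx B y w]) =
  (P [set w | (t <= Sx B x w)%R] * P [set w | (t <= Sx B y w)%R])%E.
Proof.
move=> [a1 a2 a3 a4].
pose Jx : {set idx} := [set z : idx | (tag z == x.1) || (tag z == x.2)]%SET.
pose Jy : {set idx} := [set z : idx | (tag z == y.1) || (tag z == y.2)]%SET.
have sx : smeas (@Xz R E) Jx (Sx B x).
  apply: LF_smeas => z; rewrite inE negb_or => /andP[h1 h2].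
  by rewrite /cp /dl (negbTE h1) (negbTE h2) subrr mul0r.
have sy : smeas (@Xz R E) Jy (Sx B y).
  apply: LF_smeas => z; rewrite inE negb_or => /andP[h1 h2].
  by rewrite /cp /dl (negbTE h1) (negbTE h2) subrr mul0r.
have dj z : z \in Jx -> z \notin Jy.
  rewrite !inE negb_or => /orP[/eqP ->|/eqP ->]; first by rewrite a1 a2.
  by rewrite a3 a4.
have := smeas_indep2 (@ind_Xz R E) dj sx sy (measurable_itv `[t, +oo[)
  (measurable_itv `[t, +oo[).
rewrite (_ : Sx B x @^-1` `[t, +oo[ = [set w | t <= Sx B x w]); last first.
  by apply/seteqP; split=> w /=; rewrite in_itv/= andbT.
rewrite (_ : Sx B y @^-1` `[t, +oo[ = [set w | t <= Sx B y w])//.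
by apply/seteqP; split=> w /=; rewrite in_itv/= andbT.
Qed.

(** * Variance of the count at one threshold *)

Section second_moment.
Variables (A : {set 'I_m * 'I_m}) (t pm : R).
Hypothesis A12 : forall x, x \in A -> x.1 != x.2.
Hypothesis tu : -1 <= t <= u.
Let I_ x := [set w | t <= Sx B x w].
Let p_ x := fine (P (I_ x)).
Hypothesis pmle : forall x, x \in A -> p_ x <= pm.
Hypothesis pm0 : 0 <= pm.
Let JJ := expR (1 - t ^+ 2 / (1 + rho)).

Definition count (w : space E) : R := \sum_(x in A) \1_(I_ x) w.

Let mI x : measurable (I_ x). Proof. exact: measurable_LF_ge. Qed.
Let bI x : bm (\1_(I_ x) : space E -> R). Proof. exact: bm_indic. Qed.
Let p0 x : 0 <= p_ x. Proof. by rewrite fine_ge0. Qed.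
Let JJ0 : 0 <= JJ. Proof. exact: expR_ge0. Qed.

Let cov (x y : 'I_m * 'I_m) : Ex P (fun w => (\1_(I_ x) w - p_ x) * (\1_(I_ y) w - p_ y)) =
  fine (P (I_ x `&` I_ y)) - p_ x * p_ y.
Proof.
rewrite (_ : (fun w => _) = (fun w => \1_(I_ x `&` I_ y) w -
    p_ x * \1_(I_ y) w - p_ y * \1_(I_ x) w + p_ x * p_ y)); last first.
  apply/funext => w; rewrite !indicE in_setI.
  by case: (w \in I_ x); case: (w \in I_ y); rewrite /=; ring.
have bxy : bm (\1_(I_ x `&` I_ y) : space E -> R) by apply: bm_indic; exact: measurableI.
rewrite ExD; [|by apply: bmB; [apply: bmB|] => //; exact: bmZ|exact: bm_cst].
rewrite ExB; [|by apply: bmB => //; exact: bmZ|exact: bmZ].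
rewrite ExB//; last exact: bmZ.
rewrite (ExZ P _ (bI y)) (ExZ P _ (bI x)) (Ex_cst P (p_ x * p_ y)).
rewrite (Ex_indic P (mI x)) (Ex_indic P (mI y)) (Ex_indic P (measurableI _ _ (mI x) (mI y))).
rewrite -/(p_ x) -/(p_ y); ring.
Qed.

(** Counts coincidences between the groups of x and y. It is at least 1 as soon as a group is
    shared, and its sum over all y is just 4 m, which avoids enumerating the cases. *)
Let share x y : R := (y.1 == x.1)%:R + (y.1 == x.2)%:R + (y.2 == x.1)%:R + (y.2 == x.2)%:R.

Let cov_le x y : x \in A -> y \in A ->
  fine (P (I_ x `&` I_ y)) - p_ x * p_ y <= (y == x)%:R * pm + share x y * JJ.
Proof.
move=> xA yA.
have sh0 : 0 <= share x y * JJ by rewrite mulr_ge0// !addr_ge0.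
have pp : 0 <= p_ x * p_ y by rewrite mulr_ge0.
have [->|yx] := eqVneq y x.
  rewrite setIid mul1r; have := pmle xA; rewrite -/(p_ x).
  have := mulr_ge0 (p0 x) (p0 x).
  have : 0 <= share x x * JJ by rewrite mulr_ge0// !addr_ge0.
  lra.
rewrite mul0r add0r.
have [s0|s1] := boolP [&& x.1 != y.1, x.1 != y.2, x.2 != y.1 & x.2 != y.2].
  have /and4P s0' := s0.
  rewrite Sx_indep// fineM; [|by rewrite fin_num_measure//; exact: mI..].
  by rewrite -/(p_ x) -/(p_ y) subrr.
have s2 : 1 <= share x y.
  move: s1; rewrite /share !negb_and !negbK (eq_sym x.1) (eq_sym x.1) (eq_sym x.2) (eq_sym x.2).
  by case: (y.1 == x.1); case: (y.2 == x.1); case: (y.1 == x.2); case: (y.2 == x.2) => //= _; lra.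
have : fine (P (I_ x `&` I_ y)) <= JJ.
  exact: (pair_joint (A12 xA) (A12 yA) yx tu).
have : JJ <= share x y * JJ by rewrite ler_peMl.
lra.
Qed.

Lemma count_var : Ex P (fun w => (count w - \sum_(x in A) p_ x) ^+ 2) <=
  #|A|%:R * (pm + 4 * m%:R * JJ).
Proof.
rewrite (_ : (fun w => _) = (fun w => \sum_(x in A) \sum_(y in A)
   (\1_(I_ x) w - p_ x) * (\1_(I_ y) w - p_ y))); last first.
  apply/funext => w; rewrite /count -sumrB expr2 mulr_suml.
  by apply: eq_bigr => x _; rewrite mulr_sumr.
have bc x : bm (fun w => \1_(I_ x) w - p_ x) by apply: bmB => //; exact: bm_cst.
rewrite Ex_sum; last by move=> x; apply: bm_sum => y; exact: bmM.
rewrite mulr_natl -sumr_const; apply: ler_sum => x xA.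
rewrite Ex_sum; last by move=> y; exact: bmM.
apply: (@le_trans _ _ (\sum_(y in A) ((y == x)%:R * pm + share x y * JJ))).
  by apply: ler_sum => y yA; rewrite cov; exact: cov_le.
apply: (@le_trans _ _ (\sum_y ((y == x)%:R * pm + share x y * JJ))).
  rewrite big_mkcond/=; apply: ler_sum => y _; case: ifP => // _.
  by rewrite addr_ge0// mulr_ge0// !addr_ge0.
rewrite big_split/= -!mulr_suml; apply: lerD.
  rewrite (bigD1 x)//= eqxx big1 ?addr0 ?mul1r// => y /negbTE ->//.
rewrite ler_wpM2r// /share.
have s1 (a : 'I_m) : \sum_(y : 'I_m * 'I_m) (y.1 == a)%:R = m%:R :> R.
  rewrite -(pair_bigA _ (fun i j => (i == a)%:R))/= (bigD1 a)//= eqxx.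
  rewrite sumr_const card_ord big1 ?addr0// => i /negbTE ->.
  by rewrite sumr_const mul0rn.
have s2 (a : 'I_m) : \sum_(y : 'I_m * 'I_m) (y.2 == a)%:R = m%:R :> R.
  rewrite -(pair_bigA _ (fun i j => (j == a)%:R))/= exchange_big/= (bigD1 a)//= eqxx.
  rewrite sumr_const card_ord big1 ?addr0// => i /negbTE ->.
  by rewrite sumr_const mul0rn.
by rewrite !big_split/= !s1 !s2; lra.
Qed.

Lemma measurable_count_dev (c dl : R) : measurable [set w | dl <= `|count w - c|].
Proof.
have bc : bm (fun w => `|count w - c|).
  apply: bm_norm; apply: bmB; last exact: bm_cst.
  by apply: bm_sum => x; exact: bI.
have := (bm_meas bc) measurableT `[dl, +oo[%classic (measurable_itv _).
by rewrite setTI; congr (measurable _); apply/seteqP; split=> w /=;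
  rewrite in_itv/= andbT.
Qed.

Lemma count_chebyshev (dl : R) : 0 < dl ->
  fine (P [set w | dl <= `|count w - \sum_(x in A) p_ x|]) <=
  #|A|%:R * (pm + 4 * m%:R * JJ) / dl ^+ 2.
Proof.
move=> dl0.
have bc : bm (fun w => (count w - \sum_(x in A) p_ x) ^+ 2).
  apply: bmX; apply: bmB; last exact: bm_cst.
  by apply: bm_sum => x; exact: bI.
have d2 : 0 < dl ^+ 2 by rewrite exprn_gt0.
apply: le_trans (Ex_markov P bc _ (measurable_count_dev _ _) _ d2) _.
- by move=> w; exact: sqr_ge0.
- move=> w /= h; rewrite -[leRHS]real_normK ?num_real//.
  by rewrite lerXn2r ?nnegrE// ltW.
by rewrite ler_wpM2r ?invr_ge0 ?(ltW d2)// count_var.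
Qed.

End second_moment.

Variable tau : R.
Hypotheses (tauE : tau = Num.sqrt (2 * ln m%:R)) (tau1 : 1 <= tau).
Hypothesis utau : u = tau + 4.
Hypothesis m2 : (2 <= m)%N.
Variable F : 'I_m -> 'I_m -> R -> R.
Hypothesis F_df : forall i j, (i < j)%N -> distribution_function (F i j).
Hypothesis F_sym : forall i j, (i < j)%N ->
  forall t : R, 0 <= t -> F i j t = 1 - F i j (- t).
Variables (eF eps : R).
Hypothesis eFle : null_approx_error F <= eF.
Hypotheses (eF0 : 0 <= eF) (eF4 : eF <= 4^-1) (eFc : 8 * eF <= c0 * iu ^+ 2).
Hypotheses (eps0 : 0 < eps) (eps1 : eps <= 1).
Hypothesis eta_eps : 4 * (C0 * (iu + u ^+ 20 * zeta)) <= eps.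
Hypothesis C1_eps : 8 * (C1 * iu) <= eps.

Let A := ordered_pairs E.
Let kap := iu ^+ 2.
Let kap0 : 0 < kap. Proof. exact: exprn_gt0. Qed.
Let ku : kap * u = iu. Proof. by rewrite /kap -[RHS]mulr1 -iuu; ring. Qed.
Let kap1 : 16 * kap <= 1.
Proof. have := iu4; have := iu0; rewrite /kap; nra. Qed.
Let A12 x : x \in A -> x.1 != x.2. Proof. by rewrite inE => /andP[]. Qed.

Let mR : 2 <= m%:R :> R. Proof. by rewrite ler_nat. Qed.
Let expm : expR (tau ^+ 2 / 2) = m%:R.
Proof.
have l0 : 0 <= ln (m%:R : R) by rewrite ln_ge0//; have := mR; lra.
rewrite tauE sqr_sqrtr ?mulr_ge0// mulrC mulKf// lnK// posrE; have := mR; lra.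
Qed.

Lemma card_ordered_pairs_ge : m%:R ^+ 2 <= 4 * #|A|%:R :> R.
Proof.
rewrite card_ordered_pairs /q; have h := mR.
have : 0 <= (q0 E)%:R :> R by [].
nra.
Qed.

(* The grid starts at -kap: if k * kap <= t < (k + 1) * kap, then
   t - 2 * kap <= gridp k <= t - kap and t + kap <= gridp (k + 3) <= t + 2 * kap. *)
Definition gridJ : nat := (Num.truncn (tau * u ^+ 2) + 4)%N.
Definition gridp (j : nat) : R := (j%:R - 1) * kap.

Let J_le : gridJ%:R <= u ^+ 3.
Proof.
have t0 : 0 <= tau * u ^+ 2.
  by rewrite mulr_ge0 ?sqr_ge0//; have := tau1; lra.
have /andP[h _] := truncn_itv t0.
rewrite /gridJ natrD; apply: le_trans (lerD h (lexx _)) _.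
have u40 := u4; have e : tau = u - 4 by rewrite utau; ring.
have u2 : 1 <= u ^+ 2 by rewrite expr_ge1//; lra.
rewrite e exprS mulrBl; lra.
Qed.

Let grid_le (j : nat) : (j < gridJ)%N -> -1 <= gridp j <= tau + 2 * kap.
Proof.
have t0 : 0 <= tau * u ^+ 2.
  by rewrite mulr_ge0 ?sqr_ge0//; have := tau1; lra.
have /andP[h _] := truncn_itv t0.
rewrite /gridJ addnS ltnS -(ler_nat R) natrD => hj.
have k0 := kap0; have k1 := kap1; apply/andP; split; rewrite /gridp.
  have : 0 <= j%:R * kap by rewrite mulr_ge0// ltW.
  lra.
have -> : tau + 2 * kap = (tau * u ^+ 2 + 2) * kap.
  by rewrite [RHS]mulrDl -[tau * _ * _]mulrA /kap -exprMn iuu expr1n mulr1.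
by rewrite ler_pM2r//; lra.
Qed.

(** As exp (- tau^2/2) = 1/m, the Gaussian factor at every grid point stays at least of order 1/m,
    although the grid goes a little beyond tau. *)
Let grid_sqr (j : nat) : (j < gridJ)%N -> gridp j ^+ 2 <= tau ^+ 2 + 2.
Proof.
move=> /grid_le; set s := gridp j => /andP[s1 s2].
have k0 := kap0; have k1 := kap1; have t1 := tau1.
have kt : 4 * (kap * tau) <= 1.
  have : kap * tau <= kap * u by rewrite ler_pM2l// utau; lra.
  by rewrite ku; have := iu4; lra.
have [s0|s0] := leP 0 s; last by nra.
have : s ^+ 2 <= (tau + 2 * kap) ^+ 2 by rewrite lerXn2r ?nnegrE//; lra.
nra.
Qed.

Let mu (t : R) : R := \sum_(x in A) fine (P [set w | t <= Sx B x w]).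

Definition dev (j : nat) : set (space E) :=
  [set w | eps / 4 * (#|A|%:R * barPhi (gridp j)) <= `|count A (gridp j) w - mu (gridp j)|].

Let mu_approx (t : R) : -1 <= t <= u - 1 ->
  `|mu t - #|A|%:R * barPhi t| <= eps / 4 * (#|A|%:R * barPhi t).
Proof.
move=> tu; have -> : #|A|%:R * barPhi t = \sum_(x in A) barPhi t by rewrite sumr_const mulr_natl.
rewrite -sumrB mulr_sumr; apply: le_trans (ler_norm_sum _ _ _) _.
apply: ler_sum => x xA.
apply: le_trans (pair_tail (A12 xA) tu) _.
by rewrite ler_wpM2r ?barPhi_ge0//; have := eta_eps; lra.
Qed.

Let A0 : 0 < #|A|%:R :> R.
Proof. have := card_ordered_pairs_ge; have := mR; nra. Qed.

Lemma dev_prob (j : nat) : (j < gridJ)%N ->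
  fine (P (dev j)) <= Cdev / eps ^+ 2 * u ^+ 2 * m%:R `^ (- ((1 - rho) / (1 + rho))).
Proof.
move=> jJ; have /andP[s1 s2] := grid_le jJ; have s3 := grid_sqr jJ.
rewrite /dev; set s := gridp j in s1 s2 s3 *.
have k1 := kap1; have t1 := tau1; have k0 := kap0.
have su : -1 <= s <= u - 1 by rewrite s1 utau/=; lra.
have su' : -1 <= s <= u by case/andP: su => -> /=; lra.
have b0 := barPhi_gt0 s; have a0 := A0; have u40 := u4; have e0 := eps0.
have pm x : x \in A -> fine (P [set w | s <= Sx B x w]) <= 2 * barPhi s.
  move=> xA; have := pair_tail (A12 xA) su.
  have : C0 * (iu + u ^+ 20 * zeta) * barPhi s <= 1 * barPhi s.
    by rewrite ler_wpM2r ?(ltW b0)//; have := eta_eps; have := eps1; lra.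
  by rewrite ler_norml => h1 /andP[_ h2]; lra.
have pm0 : 0 <= 2 * barPhi s by lra.
have d0 : 0 < eps / 4 * (#|A|%:R * barPhi s) by rewrite !mulr_gt0.
apply: le_trans (count_chebyshev A12 su' pm pm0 d0) _.
exact: (chebyshev_grid rho0 rho1 eps0 u4 su' s3 (esym expm) card_ordered_pairs_ge).
Qed.

Lemma measurable_dev (j : nat) : measurable (dev j).
Proof. exact: measurable_count_dev. Qed.

Definition exceptional : set (space E) :=
  bad `|` [set w | exists j : 'I_gridJ, dev j w].

Lemma measurable_exceptional : measurable exceptional.
Proof.
apply: measurableU; first exact: measurable_bad.
by apply: measurable_exists => j; exact: measurable_dev.
Qed.

(** The factor u^5 is the u^2 of [dev_prob] times the at most u^3 grid points. *)
Lemma exceptional_prob : fine (P exceptional) <=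
  m%:R * (sn ^+ 2 * (K * B `^ (- p))) + m%:R * (4 * expR (1 - 2 * u ^+ 2)) +
  Cdev / eps ^+ 2 * u ^+ 5 * m%:R `^ (- ((1 - rho) / (1 + rho))).
Proof.
have mE : measurable [set w | exists j : 'I_gridJ, dev j w].
  by apply: measurable_exists => j; exact: measurable_dev.
apply: le_trans (prob_setU_le P measurable_bad mE) _.
apply: lerD; first exact: bad_prob.
have hU := @prob_exists_le _ _ _ P 'I_gridJ (fun j : 'I_gridJ => dev j)
  (fun j : 'I_gridJ => measurable_dev j).
apply: le_trans hU _.
set b := _ `^ _; have b0 : 0 <= b by exact: powR_ge0.
apply: (@le_trans _ _ (\sum_(j < gridJ) (Cdev / eps ^+ 2 * u ^+ 2 * b))).
  by apply: ler_sum => j _; exact: dev_prob.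
rewrite sumr_const card_ord -(mulr_natl _ gridJ).
have c0 : 0 <= Cdev / eps ^+ 2 * u ^+ 2 * b.
  apply: mulr_ge0 => //; apply: mulr_ge0; last exact: sqr_ge0.
  by apply: divr_ge0; [exact: Cdev_ge0|exact: sqr_ge0].
apply: le_trans (ler_wpM2r c0 J_le) _.
by rewrite le_eqVlt; apply/orP; left; apply/eqP; ring.
Qed.

Let refdist_sandwich w x (t : R) : ~ bad w -> x.1 != x.2 -> 0 <= t <= tau ->
  (t + kap <= Sx B x w -> 1 - refdist F x (barT x.1 x.2 w) <= barPhi t) /\
  (1 - refdist F x (barT x.1 x.2 w) <= barPhi t -> t - kap <= Sx B x w).
Proof.
move=> nb x12 /andP[t0 tt].
have [k [k0 k1 kS]] := good_barT nb x12.
have [hF _ _ _] := refdist_df F_df x12.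
have L0 : 0 <= 2 * Num.sqrt (ln m%:R) :> R by rewrite mulr_ge0// sqrtr_ge0.
have LL : (2 * Num.sqrt (ln m%:R)) ^+ 2 = 2 * tau ^+ 2 :> R.
  have l0 : 0 <= ln (m%:R : R) by rewrite ln_ge0//; have := mR; lra.
  by rewrite tauE exprMn !sqr_sqrtr ?mulr_ge0//; ring.
have ht s := refdist_tail F_df F_sym eFle (s := s) x12.
split.
  exact: (reject_of_ge hF ht eF0 eFc tau1 utau iu0 iuu L0 LL k0 k1 kS t0 tt).
exact: (ge_of_reject hF ht eF0 eF4 eFc tau1 utau iu0 iuu L0 LL k0 k1 kS t0 tt).
Qed.

Let count_approx w (j : nat) : ~ exceptional w -> (j < gridJ)%N ->
  `|count A (gridp j) w - #|A|%:R * barPhi (gridp j)| <=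
  eps / 2 * (#|A|%:R * barPhi (gridp j)).
Proof.
move=> /not_orP[_ nd] jJ.
have : ~ dev j w by move=> h; apply: nd; exists (Ordinal jJ).
rewrite /dev/= => /negP; rewrite -ltNge => h1.
have /andP[s1 s2] := grid_le jJ.
have : `|mu (gridp j) - #|A|%:R * barPhi (gridp j)| <=
    eps / 4 * (#|A|%:R * barPhi (gridp j)).
  by apply: mu_approx; rewrite s1/=; have := kap1; rewrite utau; lra.
have := ler_normD (count A (gridp j) w - mu (gridp j))
  (mu (gridp j) - #|A|%:R * barPhi (gridp j)).
rewrite addrA subrK; lra.
Qed.

Lemma rejections_approx w (t : R) : ~ exceptional w -> 0 <= t <= tau ->
  `|rejections F t w / (barPhi t * (q E + (q0 E)%:R)) - 1| <= eps.
Proof.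
move=> ne tt; have /andP[t0 t1] := tt; have /not_orP[nb _] := ne.
have k0 := kap0; have k1 := kap1; have u40 := u4.
have tu0 : 0 <= t * u ^+ 2 by rewrite mulr_ge0// sqr_ge0.
have Tu0 : 0 <= tau * u ^+ 2 by rewrite mulr_ge0// ?sqr_ge0//; have := tau1; lra.
set k := Num.truncn (t * u ^+ 2).
have /andP[h1 h2] := truncn_itv tu0; have /andP[_ h3] := truncn_itv Tu0.
(* The 4 added in [gridJ] makes k + 3 an index of the grid even for t = tau. *)
have kJ : (k + 3 < gridJ)%N.
  rewrite /gridJ addn3 addn4 !ltnS -ltnS -(ltr_nat R).
  by apply: le_lt_trans h3; apply: le_trans h1 _; rewrite ler_wpM2r// sqr_ge0.
have tE : t = t * u ^+ 2 * kap by rewrite /kap -mulrA -exprMn iuu expr1n mulr1.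
have g1 : gridp k <= t - kap.
  have : k%:R * kap <= t * u ^+ 2 * kap by rewrite ler_wpM2r// ltW.
  rewrite -tE /gridp; lra.
have g1' : t - 2 * kap <= gridp k.
  have : t * u ^+ 2 * kap <= k.+1%:R * kap by rewrite ler_wpM2r// ltW.
  rewrite -tE -natr1 /gridp; lra.
have e3 : gridp (k + 3) = gridp k + 3 * kap by rewrite /gridp natrD; ring.
set r := rejections F t w; rewrite -card_ordered_pairs -/A.
have rE : r = \sum_(x in A) ((1 - refdist F x (barT x.1 x.2 w) <= barPhi t)%R : nat)%:R.
  exact: rejectionsE.
have up : r <= count A (gridp k) w.
  rewrite rE; apply: ler_sum => x xA.
  have [_ h] := refdist_sandwich nb (A12 xA) tt.
  case: (boolP (1 - refdist F x (barT x.1 x.2 w) <= barPhi t)) => [|_].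
    by move=> /h hS; rewrite indicE mem_set//= (le_trans g1).
  by rewrite indicE.
have lo : count A (gridp (k + 3)) w <= r.
  rewrite rE; apply: ler_sum => x xA; rewrite indicE.
  have [h _] := refdist_sandwich nb (A12 xA) tt.
  case: (boolP (w \in _)) => [|_] //; rewrite inE/= => hS.
  by rewrite h//; apply: le_trans hS; lra.
have kJ' : (k < gridJ)%N by apply: leq_ltn_trans kJ; exact: leq_addr.
have k2 : 0 <= 2 * kap by lra.
have ku2 : 2 * kap * u <= 1 by rewrite -mulrA ku; have := iu4; lra.
have cc : C1 * u * (2 * kap) <= eps / 4.
  have -> : C1 * u * (2 * kap) = 2 * (C1 * (kap * u)) by ring.
  by rewrite ku; have := C1_eps; lra.
have tk : t + 2 * kap <= u by rewrite utau; lra.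
have s3 : gridp (k + 3) <= t + 2 * kap by rewrite e3; lra.
exact: (ratio_sandwich A0 eps0 eps1 u1 t0 k2 tk ku2 cc g1' s3 up lo
  (count_approx ne kJ') (count_approx ne kJ)).
Qed.

Lemma sup_relative_error_le w : ~ exceptional w -> `|sup_relative_error F w| <= eps.
Proof.
move=> ne; rewrite /sup_relative_error -tauE.
set S := [set _ | _ in _].
have Sub : ubound S eps.
  by move=> _ [t /= + <-]; rewrite in_itv/= => tt; exact: rejections_approx.
have S0 : S `|rejections F 0 w / (barPhi 0 * (q E + (q0 E)%:R)) - 1|.
  by exists 0 => //=; rewrite in_itv/= lexx/=; have := tau1; lra.
rewrite ger0_norm; first by apply: ge_sup => //; eexists; exact: S0.
by apply: le_trans (ub_le_sup _ S0) => //; exists eps.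
Qed.

End experiment_bound.

(** * Measurability of the supremum *)

(** Square root and inverse both default to 0, so for v <= 0 the value is 0: the function is a power
    restricted to v > 0. *)
Lemma measurable_inv_sqrt (R : realType) :
  measurable_fun [set: R] (fun v => (Num.sqrt v)^-1).
Proof.
rewrite (_ : (fun v => _) = (fun v : R => \1_`]0, +oo[ v * (v `^ (- 2^-1)))).
  apply: measurable_funM; last exact: measurable_powR.
  by apply: measurable_indic; exact: measurable_itv.
apply/funext => v; rewrite indicE; have [v0|v0] := leP v 0.
  by rewrite ler0_sqrtr// invr0 memNset ?mul0r//= in_itv/= andbT ltNge v0.
by rewrite mem_set ?mul1r ?powRN ?powR12_sqrt ?(ltW v0)//= in_itv/= v0.
Qed.

Lemma continuous_barPhi (R : realType) : continuous (@barPhi R).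
Proof. by move=> t; apply/differentiable_continuous/derivable1_diffP. Qed.

Section measurability.
Context {R : realType}.
Variable E : experiment R.
Notation m := (ngroups E).
Implicit Types (i j : 'I_m) (x y : 'I_m * 'I_m) (w : space E).

Lemma measurable_sample_mean i : measurable_fun setT (@sample_mean R E i).
Proof. by apply: measurable_funM => //; apply: measurable_sum => k. Qed.

Lemma measurable_sample_var i : measurable_fun setT (@sample_var R E i).
Proof.
apply: measurable_funM => //; apply: measurable_sum => k; apply: measurable_funX.
by apply: measurable_funB => //; exact: measurable_sample_mean.
Qed.

Lemma measurable_barT i j : measurable_fun setT (@barT R E i j).
Proof.
apply: measurable_funM.
  by apply: measurable_funB => //; apply: measurable_funB; exact: measurable_sample_mean.
have mv : measurable_fun [set: space E]
    (fun w => sample_var i w / (gsize i)%:R + sample_var j w / (gsize j)%:R).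
  by apply: measurable_funD; apply: measurable_funM => //; exact: measurable_sample_var.
have mis := @measurable_inv_sqrt R.
have := measurableT_comp mis mv.
exact.
Qed.

Variable F : 'I_m -> 'I_m -> R -> R.
Hypothesis F_df : forall i j, (i < j)%N -> distribution_function (F i j).
Hypothesis F_sym : forall i j, (i < j)%N ->
  forall t : R, 0 <= t -> F i j t = 1 - F i j (- t).

Let rerr (t : R) w : R := `|rejections F t w / (barPhi t * (q E + (q0 E)%:R)) - 1|.

Lemma measurable_rejections (t : R) : measurable_fun setT (rejections F t).
Proof.
have -> : rejections F t = (fun w => \sum_x if x \in ordered_pairs E then
    \1_[set w' | 1 - refdist F x (barT x.1 x.2 w') <= barPhi t] w else 0).
  apply/funext => w; rewrite (rejectionsE F_df F_sym) big_mkcond/=.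
  apply: eq_bigr => x _; case: ifP => // _; rewrite indicE; congr (_%:R); congr nat_of_bool.
  by apply/idP/idP => [h|/set_mem//]; exact: mem_set.
have mx x : x.1 != x.2 -> measurable [set w' | 1 - refdist F x (barT x.1 x.2 w') <= barPhi t].
  move=> x12; have [hF _ _ _] := refdist_df F_df x12.
  have mF : measurable_fun setT (fun w => 1 - refdist F x (barT x.1 x.2 w)).
    apply: measurable_funB => //; apply: (measurableT_comp _ (measurable_barT _ _)).
    exact: nondecreasing_measurable.
  have := mF measurableT `]-oo, barPhi t]%classic (measurable_itv _).
  by rewrite setTI; congr (measurable _); apply/seteqP; split=> w /=; rewrite in_itv.
apply: bm_meas; apply: bm_sum => x.
have [|_] := boolP (x \in ordered_pairs E); last exact: bm_cst.
by rewrite inE => /andP[x12 _]; apply: bm_indic; exact: mx.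
Qed.

Let measurable_rerr (t eps : R) : measurable [set w | eps < rerr t w].
Proof.
have mr : measurable_fun setT (rerr t).
  apply: measurableT_comp => //; apply: measurable_funB => //; apply: measurable_funM => //.
  exact: measurable_rejections.
have := mr measurableT `]eps, +oo[%classic (measurable_itv _).
by rewrite setTI; congr (measurable _); apply/seteqP; split=> w /=; rewrite in_itv/= andbT.
Qed.

(* The rejection count is a left-continuous step function of the threshold,
   so the supremum may be taken over rational thresholds. *)
Let rerr_left (t eps : R) w : eps < rerr t w -> \forall s \near t^'-, eps < rerr s w.
Proof.
move=> h.
have rejE : \forall s \near t^'-, rejections F s w = rejections F t w.
  have : \forall s \near t^'-, forall x,
      (1 - refdist F x (barT x.1 x.2 w) <= barPhi s) =
      (1 - refdist F x (barT x.1 x.2 w) <= barPhi t).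
    apply: filter_forall => x; set v := 1 - _.
    have [vt|vt] := leP v (barPhi t).
      near=> s; apply: le_trans vt _; apply: barPhi_le; apply: ltW.
      by near: s; exact: nbhs_left_lt.
    have cs : barPhi s @[s --> t^'-] --> barPhi t.
      exact: cvg_at_left_filter (@continuous_barPhi R t).
    have nl := cvgr_lt _ cs _ vt.
    near=> s; apply/negbTE; rewrite -ltNge.
    by near: s; exact: nl.
  apply: filterS => s e; rewrite !(rejectionsE F_df F_sym).
  by apply: eq_bigr => x _; rewrite e.
have cg : `|rejections F t w / (barPhi s * (q E + (q0 E)%:R)) - 1| @[s --> t^'-] --> rerr t w.
  apply: cvg_at_left_filter; apply: cvg_norm; apply: cvgB; last exact: cvg_cst.
  apply: cvgM; first exact: cvg_cst.
  have [a0|a0] := eqVneq (q E + (q0 E)%:R) (0 : R).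
    by rewrite a0; under eq_fun do rewrite mulr0; rewrite mulr0; exact: cvg_cst.
  apply: cvgV; first by rewrite mulf_neq0// gt_eqF// barPhi_gt0.
  by apply: cvgM; [exact: continuous_barPhi|exact: cvg_cst].
have ng := cvgr_gt _ cg _ h.
near=> s; have e : rejections F s w = rejections F t w by near: s; exact: rejE.
by rewrite /rerr e; near: s; exact: ng.
Unshelve. all: by end_near. Qed.

Lemma measurable_sup_relative_error (eps : R) :
  measurable [set w | eps < `|sup_relative_error F w|].
Proof.
set tau := Num.sqrt (2 * ln m%:R) : R.
have tau0 : 0 <= tau by exact: sqrtr_ge0.
have ne w : [set rerr t w | t in `[0, tau]] !=set0.
  by exists (rerr 0 w); exists 0 => //=; rewrite in_itv/= lexx.
have a0 : 0 <= q E + (q0 E)%:R :> R by rewrite -card_ordered_pairs.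
have ub w : has_ubound [set rerr t w | t in `[0, tau]].
  set a := q E + (q0 E)%:R in a0 *.
  (* The quotient a / a is kept, because a = 0 when there are fewer than two groups. *)
  suff key (t : R) : 0 <= t <= tau -> rerr t w <= a / a / barPhi tau + 1.
    by exists (a / a / barPhi tau + 1) => _ [t /= + <-]; rewrite in_itv/=; exact: key.
  move=> /andP[t0 t1]; rewrite /rerr -/a; apply: le_trans (ler_normB _ _) _; rewrite normr1 lerD2r.
  have r0 : 0 <= rejections F t w by rewrite (rejectionsE F_df F_sym) sumr_ge0.
  have ra : rejections F t w <= a.
    rewrite (rejectionsE F_df F_sym) /a -card_ordered_pairs -sumr_const.
    by apply: ler_sum => x _; rewrite lern1 leq_b1.
  have -> : rejections F t w / (barPhi t * a) = rejections F t w / a / barPhi t.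
    by rewrite invfM mulrA mulrAC.
  have bt : 0 <= (barPhi t)^-1 by rewrite invr_ge0 barPhi_ge0.
  have ra0 : 0 <= rejections F t w / a by rewrite divr_ge0.
  rewrite (ger0_norm (mulr_ge0 ra0 bt)).
  apply: (ler_pM ra0 bt); first by rewrite ler_wpM2r ?invr_ge0.
  by rewrite lef_pV2 ?posrE ?barPhi_gt0// barPhi_le.
have supE w : sup_relative_error F w = sup [set rerr t w | t in `[0, tau]] by [].
have sup_ge0 w : 0 <= sup_relative_error F w.
  rewrite supE; apply: (@le_trans _ _ (rerr 0 w)); first exact: normr_ge0.
  by apply: ub_le_sup => //; exists 0 => //=; rewrite in_itv/= lexx.
rewrite (_ : [set w | _] = \bigcup_(r : rat)
    [set w | 0 <= (ratr r : R) <= tau /\ eps < rerr (ratr r) w]); last first.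
  apply/seteqP; split=> w /=; rewrite ger0_norm//.
    rewrite supE => /(sup_gt (ne w))[_ [t /= + <-]]; rewrite in_itv/= => /andP[t0 tt] h.
    (* At t = 0 there is no admissible threshold to the left, but 0 is itself rational. *)
    have [t00|tpos] := leP t 0.
      have te : t = 0 by apply/le_anti/andP.
      by exists 0 => //=; rewrite rmorph0 lexx tau0 -te.
    have := rerr_left h; rewrite /at_left /within/= => /nbhs_ballP[e /= e0 he].
    have : Num.max 0 (t - e) < t by rewrite gt_max tpos/=; lra.
    move=> /rat_in_itvoo[r]; rewrite in_itv/= gt_max => /andP[/andP[r0 re] rt].
    exists r => //=; split; first by rewrite (ltW r0) (le_trans (ltW rt)).
    apply: he => //; rewrite /ball/= /ball_/= gtr0_norm ?subr_gt0//.
    by rewrite ltrBlDr addrC -ltrBlDr.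
  move=> [r _ /= [r0 h]]; apply: lt_le_trans h _; rewrite supE.
  by apply: ub_le_sup => //; exists (ratr r).
apply: bigcupT_measurable_rat => r.
have [h|h] := boolP (0 <= (ratr r : R) <= tau).
  rewrite (_ : [set w | _] = [set w | eps < rerr (ratr r) w])//.
  by apply/seteqP; split=> w //= [].
rewrite (_ : [set w | _] = set0)//.
by apply/seteqP; split=> w //= [].
Qed.

End measurability.

(** * Asymptotics *)

Section powers.
Context {R : realType}.
Implicit Types (x y a b : R).

Lemma powRDgt0 x a b : 0 < x -> x `^ a * x `^ b = x `^ (a + b).
Proof. by move=> x0; rewrite powRD// (gt_eqF x0) implybT. Qed.

Lemma powR_expn x a (k : nat) : (x `^ a) ^+ k = x `^ (a * k%:R).
Proof. by rewrite -powR_mulrn ?powR_ge0// -powRrM. Qed.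

Definition lg (x : R) : R := Num.sqrt (2 * ln x) + 4.

Lemma lg_ge4 x : 4 <= lg x.
Proof. by rewrite /lg lerDr sqrtr_ge0. Qed.

(** From ln (x^b) < x^b; the square root is removed by sqrt s <= 1 + s. *)
Lemma lg_le b x : 0 < b -> 1 <= x -> lg x <= (5 + 2 / b) * x `^ b.
Proof.
move=> b0 x1.
have l0 : 0 <= ln x by rewrite ln_ge0.
have x0 : 0 < x by lra.
have h1 : 1 <= x `^ b by have := ler_powR x1 (ltW b0); rewrite powRr0.
have h2 : ln x <= x `^ b / b.
  rewrite ler_pdivlMr// mulrC -ln_powR; apply/ltW/ln_sublinear.
  by rewrite powR_gt0.
have h3 : Num.sqrt (2 * ln x) <= 1 + 2 * ln x.
  have e : Num.sqrt (2 * ln x) ^+ 2 = 2 * ln x by rewrite sqr_sqrtr ?mulr_ge0.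
  set s := Num.sqrt _ in e *; have s0 : 0 <= s by exact: sqrtr_ge0.
  by rewrite -e; nra.
rewrite /lg; set z := x `^ b in h1 h2 *.
have -> : (5 + 2 / b) * z = 5 * z + 2 * (z / b) by ring.
lra.
Qed.

Lemma lg_expn_le b x (k : nat) : 0 < b -> 1 <= x ->
  lg x ^+ k <= (5 + 2 / b) ^+ k * x `^ (b * k%:R).
Proof.
move=> b0 x1; have c0 : 0 <= 5 + 2 / b by rewrite addr_ge0// divr_ge0// ltW.
rewrite -powR_expn -exprMn lerXn2r ?nnegrE ?lg_le ?mulr_ge0 ?powR_ge0//.
by apply: le_trans (lg_ge4 _).
Qed.

Lemma sqrt_ln_ge a x : 0 <= a -> expR (a ^+ 2 / 2) <= x -> a <= Num.sqrt (2 * ln x).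
Proof.
move=> a0 h; have x0 : 0 < x by apply: lt_le_trans h; exact: expR_gt0.
have hl : a ^+ 2 / 2 <= ln x by rewrite -ler_expR lnK.
have {hl} : a ^+ 2 <= 2 * ln x by lra.
by move=> /ler_wsqrtr; rewrite sqrtr_sqr ger0_norm.
Qed.

End powers.

Section vanishing.
Context {R : realType}.
Implicit Types (f g x y : nat -> R).

(** One-sided: only upper bounds are transported, so domination and sums require no sign
    condition. *)
Definition vanishing f := forall d : R, 0 < d -> \forall l \near \oo, f l <= d.

Lemma vanishing_le f g : vanishing g -> (\forall l \near \oo, f l <= g l) ->
  vanishing f.
Proof.
move=> vg fg d d0; near=> l; apply: (@le_trans _ _ (g l)).
  by near: l; exact: fg.
by near: l; exact: vg.
Unshelve. all: by end_near. Qed.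

Lemma vanishingZ (c : R) f : 0 <= c -> vanishing f -> vanishing (fun l => c * f l).
Proof.
move=> c0 vf d d0; have c1 : 0 < c + 1 by lra.
have dc : 0 < d / (c + 1) by rewrite divr_gt0.
near=> l; have h : f l <= d / (c + 1) by near: l; exact: vf.
apply: (@le_trans _ _ (c * (d / (c + 1)))); first by rewrite ler_wpM2l.
by rewrite mulrA ler_pdivrMr// mulrC ler_pM2l//; lra.
Unshelve. all: by end_near. Qed.

Lemma vanishingD f g : vanishing f -> vanishing g -> vanishing (fun l => f l + g l).
Proof.
move=> vf vg d d0; have d2 : 0 < d / 2 by lra.
near=> l; have h1 : f l <= d / 2 by near: l; exact: vf.
have h2 : g l <= d / 2 by near: l; exact: vg.
lra.
Unshelve. all: by end_near. Qed.

Lemma vanishing_powRN x (a : R) : x l @[l --> \oo] --> +oo -> 0 < a ->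
  vanishing (fun l => x l `^ (- a)).
Proof.
move=> /cvgryPge xoo a0 d d0; near=> l.
have x1 : 1 <= x l by near: l; exact: xoo.
have xd : (d^-1) `^ (a^-1) <= x l by near: l; exact: xoo.
have x0 : 0 < x l by lra.
rewrite powRN invf_ple ?posrE ?powR_gt0//.
have := @ge0_ler_powR R a (ltW a0) _ _ (powR_ge0 _ _ : _ \is Num.nneg) (ltW x0 : _ \is Num.nneg) xd.
by rewrite -powRrM mulVf ?gt_eqF// powRr1// invr_ge0 ltW.
Unshelve. all: by end_near. Qed.

Lemma vanishing_lg x (k : nat) (a : R) : x l @[l --> \oo] --> +oo -> 0 < a ->
  vanishing (fun l => lg (x l) ^+ k * x l `^ (- a)).
Proof.
move=> xoo a0.
pose b := a / (2 * k.+1%:R).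
have b0 : 0 < b by rewrite divr_gt0// mulr_gt0.
have bk : b * k%:R <= a / 2.
  have -> : a / 2 = b * k.+1%:R.
    have k0 : k.+1%:R != 0 :> R by rewrite pnatr_eq0.
    by rewrite /b; move: k.+1%:R k0 => z z0; field.
  by rewrite ler_pM2l// ler_nat.
have c0 : 0 <= (5 + 2 / b) ^+ k.
  by rewrite exprn_ge0// addr_ge0// divr_ge0// ltW.
have a2 : 0 < a / 2 by lra.
apply: vanishing_le (vanishingZ c0 (vanishing_powRN xoo a2)) _.
move/cvgryPge in xoo; near=> l.
have x1 : 1 <= x l by near: l; exact: xoo.
have x0 : 0 < x l by lra.
apply: le_trans (ler_wpM2r (powR_ge0 _ _) (lg_expn_le k b0 x1)) _.
by rewrite -mulrA ler_wpM2l// powRDgt0// ler_powR//; lra.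
Unshelve. all: by end_near. Qed.

(** A power of the logarithm of x is below any power of x, hence below any power of y. This is how
    the growth condition on m lets negative powers of n absorb powers of u. *)
Lemma vanishing_lg_dom x y (C r : R) (k : nat) (a : R) :
  x l @[l --> \oo] --> +oo -> y l @[l --> \oo] --> +oo ->
  0 < C -> 0 < r -> (forall l, x l <= C * y l `^ r) -> 0 < a ->
  vanishing (fun l => lg (x l) ^+ k * y l `^ (- a)).
Proof.
move=> xoo yoo C0 r0 xy a0.
(* Chosen so that x^(b k) is at most a constant times y^(a/2); k + 1 instead of k avoids a division
   by 0. *)
pose b := a / (2 * r * k.+1%:R).
have b0 : 0 < b by rewrite divr_gt0// !mulr_gt0.
have bk : r * (b * k%:R) <= a / 2.
  have -> : a / 2 = r * (b * k.+1%:R).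
    have k0 : k.+1%:R != 0 :> R by rewrite pnatr_eq0.
    by rewrite /b; move: k.+1%:R k0 => z z0; field; rewrite z0 gt_eqF.
  by rewrite ler_pM2l// ler_pM2l// ler_nat.
have bk0 : 0 <= b * k%:R by rewrite mulr_ge0// ltW.
have c0 : 0 <= (5 + 2 / b) ^+ k * C `^ (b * k%:R).
  by rewrite mulr_ge0 ?powR_ge0// exprn_ge0// addr_ge0// divr_ge0// ltW.
have a2 : 0 < a / 2 by lra.
apply: vanishing_le (vanishingZ c0 (vanishing_powRN yoo a2)) _.
move/cvgryPge in xoo; move/cvgryPge in yoo; near=> l.
have x1 : 1 <= x l by near: l; exact: xoo.
have y1 : 1 <= y l by near: l; exact: yoo.
have y0 : 0 < y l by lra.
have x0 : 0 <= x l by lra.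
apply: le_trans (ler_wpM2r (powR_ge0 _ _) (lg_expn_le k b0 x1)) _.
rewrite -[leLHS]mulrA -[leRHS]mulrA ler_wpM2l//.
  by rewrite exprn_ge0// addr_ge0// divr_ge0// ltW.
have h : x l `^ (b * k%:R) <= C `^ (b * k%:R) * y l `^ (r * (b * k%:R)).
  rewrite [y l `^ (r * _)]powRrM -powRM ?powR_ge0 ?(ltW C0)//.
  apply: ge0_ler_powR; rewrite ?nnegrE//.
  by rewrite mulr_ge0 ?powR_ge0// ltW.
apply: le_trans (ler_wpM2r (powR_ge0 _ _) h) _.
by rewrite -mulrA ler_wpM2l ?powR_ge0// powRDgt0// ler_powR//; lra.
Unshelve. all: by end_near. Qed.

Lemma vanishing_lg_inv x : x l @[l --> \oo] --> +oo ->
  vanishing (fun l => (lg (x l))^-1).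
Proof.
move=> /cvgryPge xoo d d0; near=> l.
have h : expR (d^-1 ^+ 2 / 2) <= x l by near: l; exact: xoo.
have d1 : 0 <= d^-1 by rewrite invr_ge0 ltW.
have u0 : 0 < lg (x l) by apply: lt_le_trans (lg_ge4 _).
rewrite invf_ple ?posrE//.
by apply: le_trans (sqrt_ln_ge d1 h) _; rewrite /lg; lra.
Unshelve. all: by end_near. Qed.

End vanishing.

Section parameters.
Context {R : realType}.
Variables (r nu K cL n : R).
Hypotheses (r0 : 0 < r) (nu0 : 0 < nu) (K0 : 0 < K) (cL0 : 0 < cL) (n1 : 1 <= n).

(* dexp is chosen so that n * tlevel `^ (- pexp) = n `^ (- 2 * r - nu / 4), which
   beats the number of groups. *)
Definition pexp : R := 2 + 4 * r + nu.
Definition dexp : R := nu / (4 * pexp).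
Definition tlevel : R := n `^ (2^-1 - dexp).
Definition gscale : R := (Num.sqrt cL)^-1 * n `^ (- 2^-1).
Definition sscale : R := n `^ 2^-1.
Definition Czeta : R := 8 * K + 8 * (Num.sqrt cL)^-1 + 20 * cL^-1.
Definition zeta : R := Czeta * n `^ (- dexp).

Let n0 : 0 < n. Proof. by rewrite (lt_le_trans _ n1). Qed.

Lemma pexp_ge2 : 2 <= pexp. Proof. rewrite /pexp; have := r0; have := nu0; lra. Qed.

Lemma dexp_gt0 : 0 < dexp.
Proof. by rewrite divr_gt0// mulr_gt0// (lt_le_trans _ pexp_ge2). Qed.

Let dexp_p : dexp * pexp = nu / 4.
Proof.
by rewrite /dexp; field; rewrite gt_eqF// (lt_le_trans _ pexp_ge2).
Qed.

Let dexp_le : 8 * dexp <= nu.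
Proof. have := dexp_p; have := dexp_gt0; have := pexp_ge2; nra. Qed.

Let dexp_le4 : 4 * dexp <= 1.
Proof.
rewrite /dexp mulrA ler_pdivrMr ?mulr_gt0 ?(lt_le_trans _ pexp_ge2)//.
rewrite /pexp; have := r0; have := nu0; lra.
Qed.

Lemma tlevel_gt0 : 0 < tlevel. Proof. exact: powR_gt0. Qed.

Lemma gscale_ge0 : 0 <= gscale.
Proof. by rewrite mulr_ge0 ?powR_ge0// invr_ge0 sqrtr_ge0. Qed.

Lemma gscale_sqr : gscale ^+ 2 = cL^-1 * n^-1.
Proof.
rewrite exprMn exprVn sqr_sqrtr ?(ltW cL0)// powR_expn.
by rewrite mulNr mulVf// powR_inv1// ltW.
Qed.

Lemma sscale_sqr : sscale ^+ 2 = n.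
Proof. by rewrite powR_expn mulVf// powRr1// ltW. Qed.

Let tlevel_powR (a : R) : tlevel `^ a = n `^ ((2^-1 - dexp) * a).
Proof. by rewrite -powRrM. Qed.

(** The term [gscale * tlevel], the bound on a single summand, has order exactly n^(- dexp) and
    fixes the rate; the exponents of the other terms are at most - dexp. *)
Lemma zeta_bound :
  4 * sscale * (K * tlevel `^ (1 - pexp)) + 4 * (K * tlevel `^ (2 - pexp)) +
  8 * (gscale * tlevel) + 16 * gscale ^+ 2 + 2 * (gscale ^+ 2 * B2 tlevel) <= zeta.
Proof.
have h0 := dexp_p; have h1 := dexp_le; have h2 := dexp_le4; have h3 := dexp_gt0.
have h4 := r0; have h5 := nu0; have h6 := K0.
have pE : pexp = 2 + 4 * r + nu by [].
have le_d (a : R) : a <= - dexp -> n `^ a <= n `^ (- dexp) by exact: ler_powR.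
have z0 : 0 <= n `^ (- dexp) by exact: powR_ge0.
have t1 : sscale * tlevel `^ (1 - pexp) <= n `^ (- dexp).
  rewrite tlevel_powR powRDgt0//; apply: le_d.
  have -> : 2^-1 + (2^-1 - dexp) * (1 - pexp) = 1 - pexp / 2 - dexp + dexp * pexp by field.
  by rewrite h0 pE; lra.
have t2 : tlevel `^ (2 - pexp) <= n `^ (- dexp).
  rewrite tlevel_powR; apply: le_d.
  have -> : (2^-1 - dexp) * (2 - pexp) = 1 - pexp / 2 - 2 * dexp + dexp * pexp by field.
  by rewrite h0 pE; lra.
have t3 : gscale * tlevel = (Num.sqrt cL)^-1 * n `^ (- dexp).
  rewrite /gscale /tlevel -mulrA powRDgt0//; congr (_ * _ `^ _); ring.
have ni : n^-1 = n `^ (-1) by rewrite powR_inv1// ltW.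
have t4 : n^-1 <= n `^ (- dexp) by rewrite ni; apply: le_d; lra.
have t5 : n^-1 * tlevel ^+ 2 <= n `^ (- dexp).
  by rewrite ni powR_expn powRDgt0//; apply: le_d; lra.
have c0 : 0 <= cL^-1 by rewrite invr_ge0 ltW.
have k1 := ler_wpM2l (ltW K0) t1; have k2 := ler_wpM2l (ltW K0) t2.
have k4 := ler_wpM2l c0 t4; have k5 := ler_wpM2l c0 t5.
rewrite t3 gscale_sqr /zeta /Czeta /B2.
set z := n `^ (- dexp) in z0 t1 t2 t4 t5 k1 k2 k4 k5 *.
have -> : 4 * sscale * (K * tlevel `^ (1 - pexp)) = 4 * (K * (sscale * tlevel `^ (1 - pexp))) by ring.
have -> : cL^-1 * n^-1 * (tlevel ^+ 2 + 1) = cL^-1 * (n^-1 * tlevel ^+ 2) + cL^-1 * n^-1 by ring.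
lra.
Qed.

Lemma trunc_prob_bound (M C : R) : 0 <= C -> M <= C * n `^ r ->
  M * (sscale ^+ 2 * (K * tlevel `^ (- pexp))) <= C * K * n `^ (- r).
Proof.
move=> C0 MC; rewrite sscale_sqr tlevel_powR.
have -> : (2^-1 - dexp) * - pexp = - pexp / 2 + dexp * pexp by field.
rewrite dexp_p; set e := - pexp / 2 + _.
have e0 : 0 <= n * (K * n `^ e) by rewrite !mulr_ge0 ?powR_ge0// ltW.
apply: le_trans (ler_wpM2r e0 MC) _.
have -> : C * n `^ r * (n * (K * n `^ e)) = C * K * (n `^ r * n `^ 1 * n `^ e).
  by rewrite (powRr1 (ltW n0)); ring.
rewrite ler_wpM2l ?mulr_ge0 ?(ltW K0)// !powRDgt0//; apply: ler_powR => //.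
by rewrite /e /pexp; have := nu0; lra.
Qed.

End parameters.

Section group_sizes.
Context {R : realType}.
Variables (E : experiment R) (cL cU : R).
Notation m := (ngroups E).
Implicit Types i j : 'I_m.
Hypotheses (cL_gt0 : 0 < cL) (cL_le1 : cL <= 1).
Hypothesis var_ratio : forall i j, i != j -> cL <= sd i ^+ 2 / sd j ^+ 2 <= cU.
Hypothesis size_ratio : forall i j, i != j ->
  cL <= ((gsize i)%:R / (gsize j)%:R : R) <= cU.

Lemma gsize_le_max i : (gsize i)%:R <= (maxsize E)%:R :> R.
Proof. by rewrite ler_nat; exact: (leq_bigmax i). Qed.

Lemma gsize_ge_max i : cL * (maxsize E)%:R <= (gsize i)%:R.
Proof.
have i0 : (0 < #|'I_m|)%N by apply/card_gt0P; exists i.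
have [j jE] := @bigop.eq_bigmax 'I_m (fun i => gsize i) i0; rewrite /maxsize jE.
have [->|ij] := eqVneq i j; first by rewrite ler_piMl.
have /andP[h _] := size_ratio ij.
by move: h; rewrite ler_pdivlMr// ltr0n (leq_trans _ (gsize_ge2 j)).
Qed.

(* Bounds the correlation of two distinct pair statistics sharing a group. *)
Definition corr_bound : R := cU ^+ 2 / (1 + cU ^+ 2).

Let cU2 : 0 < 1 + cU ^+ 2. Proof. by rewrite ltr_wpDr// sqr_ge0. Qed.

Lemma corr_bound_ge0 : 0 <= corr_bound.
Proof. by rewrite divr_ge0 ?sqr_ge0// ltW. Qed.

Lemma corr_bound_lt1 : corr_bound < 1.
Proof. by rewrite ltr_pdivrMr// mul1r ltrDr. Qed.

(** The quotient of [wt i] and [wt j] is a variance ratio times a size ratio, each at most cU. *)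
Lemma wt_corr_bound i j : i != j -> wt i <= corr_bound * (wt i + wt j).
Proof.
move=> ij; have ji : j != i by rewrite eq_sym.
have w0 := wt_gt0 j; have wi0 := wt_gt0 i.
have key : wt i <= cU ^+ 2 * wt j.
  rewrite -ler_pdivrMr//.
  have s0 k : 0 < sd (e := E) k ^+ 2 by rewrite exprn_gt0// sd_gt0.
  have n0 k : 0 < (gsize (e := E) k)%:R :> R by rewrite ltr0n (leq_trans _ (gsize_ge2 k)).
  have -> : wt i / wt j = sd i ^+ 2 / sd j ^+ 2 * ((gsize j)%:R / (gsize i)%:R).
    rewrite /wt; have := s0 i; have := s0 j; have := n0 i; have := n0 j.
    move=> /gt_eqF h1 /gt_eqF h2 /gt_eqF h3 /gt_eqF h4.
    have s3 : sd j != 0 by rewrite gt_eqF ?sd_gt0.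
    by field; rewrite h1 h2 s3.
  have /andP[_ h1] := var_ratio ij; have /andP[_ h2] := size_ratio ji.
  by rewrite expr2; apply: ler_pM => //; apply: divr_ge0; rewrite ?sqr_ge0.
rewrite /corr_bound mulrAC ler_pdivlMr//; lra.
Qed.

End group_sizes.

(** The square of [lg x] is at least 2 ln x, so the exponential is at most e x^(-4), more than is
    needed. *)
Lemma ngroups_expR_lg (R : realType) (x : R) : 1 <= x ->
  x * (4 * expR (1 - 2 * lg x ^+ 2)) <= 4 * expR 1 * x `^ (-1).
Proof.
move=> x1; have x0 : 0 < x by lra.
have l0 : 0 <= ln x by rewrite ln_ge0.
have h : 2 * ln x <= lg x ^+ 2.
  have e : Num.sqrt (2 * ln x) ^+ 2 = 2 * ln x by rewrite sqr_sqrtr ?mulr_ge0.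
  rewrite -e /lg; set s := Num.sqrt _; have s0 : 0 <= s by exact: sqrtr_ge0.
  nra.
rewrite mulrCA -mulrA ler_pM2l// /powR gt_eqF// -[X in X * _](lnK (_ : x \is Num.pos)) ?posrE//.
rewrite -!expRD ler_expR; lra.
Qed.

Section one_experiment.
Context {R : realType}.
Variables (E : experiment R) (cL cU r C nu K e eF : R).
Notation m := (ngroups E).
Notation n := ((maxsize E)%:R : R).
Notation u := (lg (m%:R : R)).
Notation z := (zeta r nu K cL n).
Variable F : 'I_m -> 'I_m -> R -> R.
Hypotheses (cL_gt0 : 0 < cL) (cL_le1 : cL <= 1).
Hypothesis var_ratio : forall i j : 'I_m, i != j -> cL <= sd i ^+ 2 / sd j ^+ 2 <= cU.
Hypothesis size_ratio : forall i j : 'I_m, i != j ->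
  cL <= ((gsize i)%:R / (gsize j)%:R : R) <= cU.
Hypotheses (r_gt0 : 0 < r) (C_gt0 : 0 < C) (nu_gt0 : 0 < nu) (K_gt0 : 0 < K).
Hypothesis m_le : m%:R <= C * n `^ r.
Hypothesis moment : forall i : 'I_m,
  ('E_(prob E)[fun w => (`|(obs1 i w - mean i) / sd i| `^ pexp r nu)%R] <= K%:E)%E.
Hypothesis F_df : forall i j : 'I_m, (i < j)%N -> distribution_function (F i j).
Hypothesis F_sym : forall i j : 'I_m, (i < j)%N ->
  forall t : R, 0 <= t -> F i j t = 1 - F i j (- t).
Hypotheses (m2 : (2 <= m)%N) (n1 : 1 <= n) (tau1 : expR (1 ^+ 2 / 2) <= m%:R :> R).
Hypothesis eFle : null_approx_error F <= eF.
Hypotheses (eF0 : 0 <= eF) (eF4 : eF <= 4^-1) (eFc : 8 * (eF * u ^+ 2) <= c0).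
Hypotheses (e0 : 0 < e) (e1 : e <= 1).
Hypothesis uz : cE * 27 * (u ^+ 20 * z) <= 1.
Hypothesis uze : 4 * (C0 * (u^-1 + u ^+ 20 * z)) <= e.
Hypothesis C1e : 8 * (C1 * u^-1) <= e.

Let rho := corr_bound cU.

Lemma sup_relative_error_prob :
  fine (prob E [set w | e < `|sup_relative_error F w|]) <=
  C * K * n `^ (- r) + 4 * expR 1 * m%:R `^ (-1) +
  Cdev / e ^+ 2 * (u ^+ 5 * m%:R `^ (- ((1 - rho) / (1 + rho)))).
Proof.
pose B := tlevel r nu n; pose g := gscale cL n; pose sn := sscale n.
have u0 : 0 < u by apply: lt_le_trans (lg_ge4 _).
have iu0 : 0 < u^-1 by rewrite invr_gt0.
have iu4 : u^-1 <= 4^-1 by rewrite lef_pV2 ?posrE ?lg_ge4.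
have iuu : u * u^-1 = 1 by rewrite divff// gt_eqF.
have n0 : 0 < n by apply: lt_le_trans n1.
have B0 : 0 < B := tlevel_gt0 r nu n1.
have sn0 : 0 <= sn by exact: powR_ge0.
have g0 : 0 <= g := gscale_ge0 cL n.
have tau1' : 1 <= Num.sqrt (2 * ln m%:R) :> R by exact: sqrt_ln_ge.
have gN (i : 'I_m) : 1 <= g ^+ 2 * ((gsize i)%:R : R).
  rewrite (gscale_sqr cL_gt0 n1) -invfM mulrC ler_pdivlMr ?mulr_gt0// mul1r.
  exact: (gsize_ge_max cL_le1 size_ratio).
have nN (i : 'I_m) : (gsize i)%:R <= sn ^+ 2 by rewrite (sscale_sqr n1) gsize_le_max.
have Z := zeta_bound r_gt0 nu_gt0 K_gt0 cL_gt0 n1.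
have p2 := pexp_ge2 r_gt0 nu_gt0.
have ec : 8 * eF <= c0 * u^-1 ^+ 2.
  by rewrite exprVn ler_pdivlMr ?exprn_gt0// -mulrA.
have mX := measurable_exceptional E B0 u u^-1 (Num.sqrt (2 * ln m%:R)) e.
have mS := measurable_sup_relative_error F_df F_sym e.
apply: le_trans (prob_le (prob E) mS mX _) _.
  move=> w /=; apply: contraPP => nX; apply/negP; rewrite -leNgt.
  exact: (sup_relative_error_le p2 moment B0 (ltW K_gt0) (lg_ge4 _) iu0 iu4 iuu
    g0 gN sn0 nN Z uz erefl tau1' erefl m2 F_df F_sym eFle eF0 eF4 ec e0 e1 uze C1e).
apply: le_trans (exceptional_prob (corr_bound_ge0 cU) (ltW (corr_bound_lt1 cU))
  (wt_corr_bound var_ratio size_ratio) p2 moment B0 (ltW K_gt0) (lg_ge4 _)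
  iu0 iu4 iuu g0 gN sn0 nN Z uz erefl tau1' erefl m2 e0 e1 uze) _.
rewrite -/rho -[X in _ + X <= _]mulrA lerD2r; apply: lerD.
  exact: (trunc_prob_bound r_gt0 nu_gt0 K_gt0 n1 (ltW C_gt0) m_le).
by apply: ngroups_expR_lg; rewrite ler1n ltnW.
Qed.

End one_experiment.

Theorem lemma3p1 (R : realType) (E : nat -> experiment R)
  (F : forall l, 'I_(ngroups (E l)) -> 'I_(ngroups (E l)) -> R -> R)
  (cL cU r C nu K c : R)
  (m_oo : ngroups (E l) @[l --> \oo] --> \oo)
  (n_oo : maxsize (E l) @[l --> \oo] --> \oo)
  (cL_gt0 : 0 < cL) (cL_le1 : cL <= 1) (cU_ge1 : 1 <= cU)
  (var_ratio : forall l (i j : 'I_(ngroups (E l))), i != j ->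
     cL <= sd i ^+ 2 / sd j ^+ 2 <= cU)
  (size_ratio : forall l (i j : 'I_(ngroups (E l))), i != j ->
     cL <= (gsize i)%:R / (gsize j)%:R <= cU)
  (r_gt0 : 0 < r) (C_gt0 : 0 < C) (nu_gt0 : 0 < nu) (K_gt0 : 0 < K)
  (m_le : forall l, (ngroups (E l))%:R <= C * (maxsize (E l))%:R `^ r)
  (moment_le : forall l (i : 'I_(ngroups (E l))),
     ('E_(prob (E l))[fun w =>
        (`|(obs1 i w - mean i) / sd i| `^ (2 + 4 * r + nu))%R] <= K%:E)%E)
  (F_df : forall l (i j : 'I_(ngroups (E l))), (i < j)%N ->
     distribution_function (F l i j))
  (F_sym : forall l (i j : 'I_(ngroups (E l))), (i < j)%N ->
     forall t : R, 0 <= t -> F l i j t = 1 - F l i j (- t))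
  (c_gt0 : 0 < c)
  (F_approx : (fun l => null_approx_error (F l) : R^o) =O_\oo
              (fun l => (maxsize (E l))%:R `^ (- c) : R^o)) :
  cvg0_in_probability (fun l => prob (E l))
    (fun l => sup_relative_error (F l)).
Proof.
move=> eps eps0.
pose M l : R := (ngroups (E l))%:R; pose n l : R := (maxsize (E l))%:R.
have Moo : M l @[l --> \oo] --> +oo by apply/cvgrnyP.
have noo : n l @[l --> \oo] --> +oo by apply/cvgrnyP.
have mS l (e : R) := measurable_sup_relative_error (F_df l) (F_sym l) e.
(* The estimates for one experiment assume a tolerance of at most 1. *)
pose e := Num.min eps 1.
have e0 : 0 < e by rewrite lt_min eps0/=.
have e1 : e <= 1 by rewrite ge_min lexx orbT.
have ee : e <= eps by rewrite ge_min lexx.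
pose z l := zeta r nu K cL (n l).
have Cz0 : 0 <= Czeta K cL.
  have h1 : 0 <= (Num.sqrt cL)^-1 by rewrite invr_ge0 sqrtr_ge0.
  have h2 : 0 <= cL^-1 by rewrite invr_ge0 ltW.
  by rewrite /Czeta; lra.
have vz : vanishing (fun l => lg (M l) ^+ 20 * z l).
  apply: vanishing_le (vanishingZ Cz0 (vanishing_lg_dom 20 Moo noo C_gt0 r_gt0 m_le
    (dexp_gt0 r_gt0 nu_gt0))) _.
  by near=> l; rewrite /z /zeta mulrCA.
have viu := vanishing_lg_inv Moo.
have [KF KF0 hF] : exists2 KF : R, 0 < KF &
    \forall l \near \oo, null_approx_error (F l) <= KF * n l `^ (- c).
  have /eqO_exP[KF KF0 h] := F_approx; exists KF => //.
  apply: filterS h => l; rewrite (ger0_norm (powR_ge0 _ _)); apply: le_trans.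
  exact: ler_norm.
have vF : vanishing (fun l => KF * n l `^ (- c)).
  exact: vanishingZ (ltW KF0) (vanishing_powRN noo c_gt0).
have vFu : vanishing (fun l => KF * (lg (M l) ^+ 2 * n l `^ (- c))).
  exact: vanishingZ (ltW KF0) (vanishing_lg_dom 2 Moo noo C_gt0 r_gt0 m_le c_gt0).
have c00 : 0 < c0 :> R := c0_gt0.
have C00 : 0 <= C0 :> R := C0_ge0.
have C10 : 0 < C1 :> R := C1_gt0.
have cE0 : 0 < cE :> R by rewrite /cE ltr_pwDl// expR_ge0.
pose rho := corr_bound cU.
have be0 : 0 < (1 - rho) / (1 + rho).
  have := corr_bound_ge0 cU; have := corr_bound_lt1 cU; rewrite -/rho => h1 h2.
  by rewrite divr_gt0//; lra.
have vP : vanishing (fun l => C * K * n l `^ (- r) + 4 * expR 1 * M l `^ (-1) +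
    Cdev / e ^+ 2 * (lg (M l) ^+ 5 * M l `^ (- ((1 - rho) / (1 + rho))))).
  apply: vanishingD; first apply: vanishingD.
  - by apply: vanishingZ (vanishing_powRN noo r_gt0); rewrite mulr_ge0 ?ltW.
  - by apply: vanishingZ (vanishing_powRN Moo ltr01); rewrite mulr_ge0 ?expR_ge0.
  - apply: vanishingZ (vanishing_lg 5 Moo be0).
    by rewrite divr_ge0 ?Cdev_ge0 ?sqr_ge0.
apply: cvg_EFin; first by near=> l; rewrite fin_num_measure.
apply/cvgr0Pnorm_le => d d0.
have vz1 := vanishingZ (ltW (mulr_gt0 cE0 (ltr0Sn R 26))) vz.
have vze := vanishingZ (mulr_ge0 (ler0n R 4) C00) (vanishingD viu vz).
have vC1 := vanishingZ (mulr_ge0 (ler0n R 8) (ltW C10)) viu.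
have vF8 := vanishingZ (ler0n R 8) vFu.
move: Moo noo => /cvgryPge Moo /cvgryPge noo.
near=> l.
rewrite /= ger0_norm ?fine_ge0//.
apply: (@le_trans _ _ (fine (prob (E l) [set w | e < `|sup_relative_error (F l) w|]))).
  by apply: prob_le => // w /=; exact: le_lt_trans.
have m2 : (2 <= ngroups (E l))%N by rewrite -(ler_nat R); near: l; exact: Moo.
have n1 : 1 <= n l by near: l; exact: noo.
have eF0 : 0 <= KF * n l `^ (- c) by rewrite mulr_ge0 ?powR_ge0// ltW.
apply: le_trans (@sup_relative_error_prob R (E l) cL cU r C nu K e (KF * n l `^ (- c)) (F l)
  cL_gt0 cL_le1 (var_ratio l) (size_ratio l) r_gt0 C_gt0 nu_gt0 K_gt0 (m_le l)
  (moment_le l) (F_df l) (F_sym l) m2 n1 _ _ eF0 _ _ e0 e1 _ _ _) _.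
- by near: l; exact: Moo.
- by near: l; exact: hF.
- by near: l; apply: vF; rewrite invr_gt0.
- rewrite -/(M l) -(mulrA KF) (mulrC (n l `^ _)).
  by near: l; exact: vF8.
- by near: l; exact: vz1.
- by rewrite mulrA; near: l; exact: vze.
- by rewrite mulrA; near: l; exact: vC1.
by near: l; exact: vP.
Unshelve. all: by end_near. Qed.
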